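(* Let $X$ be an infinite dimensional real superreflexive Banach space. Then there exists an equivalent norm on $X$ which is LUR and WUR but not UR. Moreover, the class of all equivalent norms on $X$ which are LUR and WUR but not UR is dense.
   Context: All Banach spaces are real. For a norm $\|\cdot\|$ on $X$, write $B_{\|\cdot\|}=\{x\in X:\|x\|\le 1\}$ and $S_{\|\cdot\|}=\{x\in X:\|x\|=1\}$. An equivalent norm $\|\cdot\|$ on $X$ is uniformly rotund (UR) if for every pair of sequences $(x_n)_{n\in\mathbb N}$, $(y_n)_{n\in\mathbb N}$ in $B_{\|\cdot\|}$ with $\left\|\frac{x_n+y_n}{2}\right\|\to 1$ one has $\|y_n-x_n\|\to 0$. It is weakly uniformly rotund (WUR) if for every such pair of sequences one has $y_n-x_n\to 0$ in the weak topology of $X$. An equivalent norm $\|\cdot\|$ on $X$ is locally uniformly rotund (LUR) at $x\in S_{\|\cdot\|}$ if for every sequence $(y_n)_{n\in\mathbb N}$ in $B_{\|\cdot\|}$ with $\left\|\frac{x+y_n}{2}\right\|\to 1$ one has $\|x-y_n\|\to 0$. The norm is LUR if it is LUR at every $x\in S_{\|\cdot\|}$. A class $\mathcal S$ of equivalent norms on $X$ is dense if for every equivalent norm $\|\cdot\|$ on $X$ and every $\varepsilon>0$ there exists a norm $N\in\mathcal S$ such that $N(x)\le\|x\|\le(1+\varepsilon)N(x)$ for all $x\in X$. Superreflexive has its standard meaning (every Banach space finitely representable in $X$ is reflexive); it is a classical fact that a Banach space is superreflexive if and only if it admits an equivalent UR norm. *)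

(* Defs.v *)
From HB Require Import structures.
From mathcomp Require Import all_boot all_order all_algebra.
From mathcomp Require Import all_classical all_reals all_analysis.

Set Implicit Arguments.
Unset Strict Implicit.
Unset Printing Implicit Defensive.

Import Order.TTheory GRing.Theory Num.Theory.
Import numFieldNormedType.Exports.

Local Open Scope classical_set_scope.
Local Open Scope ring_scope.

Definition lin_span (R : realType) (V : lmodType R) (n : nat) (e : 'I_n -> V) :
  set V := [set x | exists c : 'I_n -> R, x = \sum_(i < n) c i *: e i].

Definition findim_subspace (R : realType) (V : lmodType R) (F : set V) : Prop :=
  exists (n : nat) (e : 'I_n -> V), F = lin_span e.

Definition infinite_dimensional (R : realType) (V : lmodType R) : Prop :=
  ~ findim_subspace [set: V].

(* Only the values of [T] on the subspace [F] matter. *)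
Definition linear_on (R : realType) (V W : lmodType R) (F : set V)
    (T : V -> W) : Prop :=
  forall (a : R) (u v : V), F u -> F v -> T (a *: u + v) = a *: T u + T v.

(* [Y] is finitely representable in [X].  The isomorphism of [F] onto [T F],
   which has distortion at most [1 + eps], is scaled so that its inverse has
   norm at most 1. *)
Definition finitely_representable (R : realType) (Y X : normedModType R) :
    Prop :=
  forall F : set Y, findim_subspace F -> forall eps : R, 0 < eps ->
  exists T : Y -> X, linear_on F T /\
    forall y, F y -> `|y| <= `|T y| /\ `|T y| <= (1 + eps) * `|y|.

Definition dual (R : realType) (X : normedModType R) : set (X -> R^o) :=
  [set f | linear f /\ continuous f].

Definition dual_norm (R : realType) (X : normedModType R) (f : X -> R^o) : R :=
  sup [set `|f x| | x in [set x : X | `|x| <= 1]].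

(* The bidual is represented by the functions [Phi] on [X -> R^o] whose
   restriction to [dual X] is linear and bounded for [dual_norm]; the canonical
   embedding of [X] into it is required to be onto. *)
Definition reflexive_space (R : realType) (X : normedModType R) : Prop :=
  forall Phi : (X -> R^o) -> R^o,
    linear_on (@dual R X) Phi ->
    (exists C : R, forall f, dual f -> `|Phi f| <= C * dual_norm f) ->
    exists x : X, forall f, dual f -> Phi f = f x.

Definition superreflexive (R : realType) (X : normedModType R) : Prop :=
  forall Y : completeNormedModType R,
    finitely_representable Y X -> reflexive_space Y.

(* [X] with its weak topology: the coarsest one making every element of the
   dual continuous. *)
Definition weak (R : realType) (X : normedModType R) : Type :=
  initial_topology
    (fun x : X => (fun f => \val f x) : {ptws (@dual R X) -> R}).

HB.instance Definition _ (R : realType) (X : normedModType R) :=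
  Topological.on (@weak R X).

Definition equivalent_norm (R : realType) (X : normedModType R) (N : X -> R) :
    Prop :=
  [/\ forall x y, N (x + y) <= N x + N y,
      forall (a : R) x, N (a *: x) = `|a| * N x,
      forall x, N x = 0 -> x = 0
    & exists a b : R, [/\ 0 < a, 0 < b
        & forall x, a * `|x| <= N x /\ N x <= b * `|x|]].

Definition uniformly_rotund (R : realType) (X : normedModType R) (N : X -> R) :
    Prop :=
  forall x y : nat -> X,
    (forall n, N (x n) <= 1) -> (forall n, N (y n) <= 1) ->
    (fun n => N (2^-1 *: (x n + y n))) @ \oo --> (1 : R) ->
    (fun n => N (y n - x n)) @ \oo --> (0 : R).

Definition weakly_uniformly_rotund (R : realType) (X : normedModType R)
    (N : X -> R) : Prop :=
  forall x y : nat -> X,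
    (forall n, N (x n) <= 1) -> (forall n, N (y n) <= 1) ->
    (fun n => N (2^-1 *: (x n + y n))) @ \oo --> (1 : R) ->
    (fun n => y n - x n) @ \oo --> (0 : weak X).

Definition locally_uniformly_rotund_at (R : realType) (X : normedModType R)
    (N : X -> R) (x : X) : Prop :=
  forall y : nat -> X, (forall n, N (y n) <= 1) ->
    (fun n => N (2^-1 *: (x + y n))) @ \oo --> (1 : R) ->
    (fun n => N (x - y n)) @ \oo --> (0 : R).

Definition locally_uniformly_rotund (R : realType) (X : normedModType R)
    (N : X -> R) : Prop :=
  forall x, N x = 1 -> locally_uniformly_rotund_at N x.

Definition norm_dense (R : realType) (X : normedModType R) (S : set (X -> R)) :
    Prop :=
  forall M : X -> R, equivalent_norm M -> forall eps : R, 0 < eps ->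
  exists2 N, S N & forall x, N x <= M x /\ M x <= (1 + eps) * N x.

Definition LUR_WUR_not_UR (R : realType) (X : normedModType R) :
    set (X -> R) :=
  [set N | [/\ equivalent_norm N, locally_uniformly_rotund N,
               weakly_uniformly_rotund N & ~ uniformly_rotund N]].

(* Main.v *)
Require Import Defs.
From HB Require Import structures.
From mathcomp Require Import all_boot all_order all_algebra.
From mathcomp Require Import all_classical all_reals all_analysis.
From mathcomp Require Import ring lra.

Set Implicit Arguments.
Unset Strict Implicit.
Unset Printing Implicit Defensive.

Import Order.TTheory GRing.Theory Num.Theory.
Import numFieldNormedType.Exports.

Local Open Scope classical_set_scope.
Local Open Scope ring_scope.

(** The proof has two halves.

    The first half renorms the space.  If X is superreflexive, its ultrapower is
    finitely representable in X, hence reflexive, and so X contains no long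
    sequences whose initial and final segments are uniformly separated
    ([no_james_seq]).  In quantitative form this is an inequality between
    squared norms ([split_inequality]); being quadratic, it survives averaging
    over random points of X.  Call a point of the unit ball n times splittable
    if it is a convex combination of midpoints of pairs of (n-1) times
    splittable points at distance at least eps ([split_set]).  Such a point is
    the start of an n-step martingale in the unit ball, all of whose steps have
    mean square size at least eps / 2.  If n could be arbitrarily large, a limit
    of these martingales would give a seminorm on finite sequences of reals that
    does not change when zeros are inserted ([spread]).  For this seminorm let
    kap m be the infimum of the squared norms of the sequences whose tails have
    sums alternating m times between 1 and -1.  It grows at most quadratically
    in m, but n interlaced copies of one sequence and the averaged inequality
    give kap m <= (1 - d) * kap m.+1 ([interlaced], [split_set_empty]), a
    contradiction.  So the sets of n times splittable points are eventually
    empty.  A weighted sum of the squared distances to these sets is convex, it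
    controls |x - y| through its convexity defect at x and y, and the gauge of
    one of its sublevel sets is an equivalent uniformly rotund norm
    ([superreflexive_rotund_norm]).  Adding a small multiple of its square to
    the square of a given norm shows that uniformly rotund norms are dense
    ([rotund_approx]).

    The second half destroys uniform rotundity of such a norm A in a controlled
    way.  Reflexivity provides an A-normalized weakly null sequence u with
    norming functionals f n that vanish on the later terms
    ([weakly_null_sequence]).  Since A is uniformly rotund, the slices where
    |f n| is almost A are pairwise disjoint ([disjoint_slices]).  The seminorm
    [flat n] dominates A only inside the n-th slice; it is uniformly rotund, but
    with a modulus in the direction u n.+1 that deteriorates with n.  The
    supremum N of A and all the [flat n] is the required norm.  Near a given
    point at most one [flat n] matters, so N is locally uniformly rotund.  If
    midpoints of points x, y of the N-ball come close to the sphere because of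
    [flat n] with n large, then x - y is almost a multiple of u n.+1, which is
    weakly small; the remaining finitely many seminorms force x - y to be small
    in norm, so N is weakly uniformly rotund.  The segments from u n - tau u n.+1
    to u n + tau u n.+1 show that N is not uniformly rotund. *)

(** * Limits along ultrafilters *)

Section UltraLimit.
Context {R : realType} (U : set_system nat) {UU : UltraFilter U}.

(** A supremum makes sense for every f; on bounded sequences it is the limit. *)
Definition ulim (f : nat -> R) : R :=
  sup [set a | \forall n \near U, a <= f n].

Lemma ulim_cvg (f : nat -> R) (C : R) :
  (\forall n \near U, `|f n| <= C) -> f @ U --> ulim f.
Proof.
move=> fC; set S := [set a | \forall n \near U, a <= f n].
have SC : ubound S C.
  move=> a Sa; have [n [an fnC]] := @filter_ex _ U _ _ (filterI Sa fC).
  by apply: le_trans an _; apply: le_trans fnC; exact: ler_norm.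
have S0 : S (- C).
  by apply: filterS fC => n; rewrite ler_norml => /andP[].
have hS : has_sup S by split; [exists (- C)|exists C].
apply/cvgrPdist_le => e e0.
have [a Sa ae] := sup_adherent e0 hS.
have h1 : \forall n \near U, ulim f - e <= f n.
  by apply: filterS Sa => n; apply: le_trans; exact: ltW.
have h2 : \forall n \near U, f n <= ulim f + e.
  have [//|nU] := in_ultra_setVsetC [set n | f n <= ulim f + e] UU.
  have : S (ulim f + e).
    by apply: filterS nU => n /= /negP; rewrite -ltNge => /ltW.
  by move/(ub_le_sup (proj2 hS)); rewrite -/(ulim f) gerDl leNgt e0.
apply: filterS2 h1 h2 => n h1 h2.
by rewrite ler_distl; apply/andP; split; lra.
Qed.

Lemma ulim_eq (f : nat -> R) (l : R) : f @ U --> l -> ulim f = l.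
Proof.
move=> fl; have b : \forall n \near U, `|f n| <= `|l| + 1.
  have /cvgrPdist_le/(_ 1 ltr01) := fl; apply: filterS => n h.
  have -> : f n = l - (l - f n) by ring.
  by apply: le_trans (ler_normB _ _) _; rewrite lerD2l.
by apply: (cvg_unique _ (ulim_cvg b) fl).
Qed.

Lemma ulim_cst (a : R) : ulim (fun=> a) = a.
Proof. by apply: ulim_eq; exact: cvg_cst. Qed.

Lemma ulim_le (f g : nat -> R) (C D : R) :
  (\forall n \near U, `|f n| <= C) -> (\forall n \near U, `|g n| <= D) ->
  (\forall n \near U, f n <= g n) -> ulim f <= ulim g.
Proof.
move=> fC gD fg; apply: (ler_cvg_to (ulim_cvg fC) (ulim_cvg gD)).
by apply: filterS fg.
Qed.

Lemma ulim_ge (f : nat -> R) (a C : R) :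
  (\forall n \near U, `|f n| <= C) ->
  (\forall n \near U, a <= f n) -> a <= ulim f.
Proof.
move=> fC af; rewrite -[leLHS](ulim_cst a); apply: (@ulim_le _ _ `|a|) fC af.
by apply: filterE.
Qed.

Lemma ulim_leC (f : nat -> R) (a C : R) :
  (\forall n \near U, `|f n| <= C) ->
  (\forall n \near U, f n <= a) -> ulim f <= a.
Proof.
move=> fC af; rewrite -[leRHS](ulim_cst a); apply: (ulim_le (D := `|a|) fC) af.
by apply: filterE.
Qed.

Lemma ulimD (f g : nat -> R) (C D : R) :
  (\forall n \near U, `|f n| <= C) -> (\forall n \near U, `|g n| <= D) ->
  ulim (fun n => f n + g n) = ulim f + ulim g.
Proof.
by move=> fC gD; apply: ulim_eq; apply: cvgD; [exact: ulim_cvg fC|exact: ulim_cvg gD].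
Qed.

Lemma ulimZ (f : nat -> R) (a C : R) :
  (\forall n \near U, `|f n| <= C) -> ulim (fun n => a * f n) = a * ulim f.
Proof.
move=> fC; apply: ulim_eq; apply: cvgM; first exact: cvg_cst.
exact: (ulim_cvg fC).
Qed.

Lemma ulim_sum (I : Type) (s : seq I) (f : I -> nat -> R) (C : I -> R) :
  (forall i, \forall n \near U, `|f i n| <= C i) ->
  ulim (fun n => \sum_(i <- s) f i n) = \sum_(i <- s) ulim (f i).
Proof.
move=> fC; apply: ulim_eq.
elim: s => [|i s ih].
  rewrite big_nil; under eq_fun do rewrite big_nil; exact: cvg_cst.
rewrite big_cons; under eq_fun do rewrite big_cons.
by apply: cvgD ih; exact: ulim_cvg (fC i).
Qed.

End UltraLimit.

(** * The Hahn-Banach theorem for seminorms *)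

Section HahnBanach.
Context {R : realType} {X : lmodType R}.

Definition is_seminorm (p : X -> R) :=
  (forall x y, p (x + y) <= p x + p y) /\
  (forall (a : R) x, p (a *: x) = `|a| * p x).

Variable p : X -> R.
Hypothesis pS : is_seminorm p.

Let pD := proj1 pS.
Let pZ := proj2 pS.

Lemma seminorm0 : p 0 = 0.
Proof. by rewrite -(scale0r 0) pZ normr0 mul0r. Qed.

Lemma seminormN x : p (- x) = p x.
Proof. by rewrite -scaleN1r pZ normrN1 mul1r. Qed.

Lemma seminormB x y : p (x - y) <= p x + p y.
Proof. by apply: le_trans (pD _ _) _; rewrite seminormN. Qed.

Lemma seminorm_ge0 x : 0 <= p x.
Proof. by have := pD x (- x); rewrite subrr seminorm0 seminormN; lra. Qed.

Lemma seminorm_sum (I : Type) (s : seq I) (P : pred I) (F : I -> X) :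
  p (\sum_(i <- s | P i) F i) <= \sum_(i <- s | P i) p (F i).
Proof.
elim/big_ind2: _ => [|x a y b xa yb|//]; first by rewrite seminorm0.
by apply: le_trans (pD _ _) _; exact: lerD.
Qed.

(** Partial functionals are given by their graphs, so that chains of them have
    unions. *)
Let lingraph (G : set (X * R)) := forall (a : R) u v, G u -> G v ->
  G (a *: u.1 + v.1, a * u.2 + v.2).

Let good y (G : set (X * R)) :=
  [/\ G (y, p y), lingraph G & forall u, G u -> u.2 <= p u.1].

(** The value al at z has to lie above all r - p (x - z) and below all
    p (x + z) - r, for (x, r) in the graph; the supremum of the former works. *)
Let good_extend y (G : set (X * R)) (z : X) : good y G ->
  exists al, good y [set w | exists u t, G u /\
    w = (u.1 + t *: z, u.2 + t * al)].
Proof.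
move=> [Gy Gl Gp].
have Gz u t : G u -> G (t *: u.1, t * u.2).
  move=> Gu; have := Gl (t - 1) _ _ Gu Gu.
  by rewrite scalerBl scale1r subrK mulrBl mul1r subrK.
pose S := [set a | exists2 u, G u & a = u.2 - p (u.1 - z)].
have key u v : G u -> G v -> u.2 - p (u.1 - z) <= p (v.1 + z) - v.2.
  move=> Gu Gv; have := Gp _ (Gl 1 _ _ Gu Gv); rewrite /= scale1r mul1r.
  have := pD (u.1 - z) (v.1 + z); rewrite addrACA addNr addr0; lra.
have hS : has_sup S.
  split; first by exists (p y - p (y - z)), (y, p y).
  by exists (p (y + z) - p y) => _ [u Gu ->]; exact: (key _ (y, p y)).
exists (sup S); split.
- exists (y, p y), 0; split => //=; by rewrite scale0r mul0r !addr0.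
- move=> a _ _ [u [t [Gu ->]]] [v [s [Gv ->]]] /=.
  exists (a *: u.1 + v.1, a * u.2 + v.2), (a * t + s); split; first exact: Gl.
  congr pair => /=; last by ring.
  by rewrite scalerDr scalerDl scalerA addrACA.
- move=> _ [u [t [Gu ->]]] /=.
  have sub1 v : G v -> v.2 - p (v.1 - z) <= sup S.
    by move=> Gv; apply: ub_le_sup; [exact: (proj2 hS)|exists v].
  have sub2 v : G v -> sup S <= p (v.1 + z) - v.2.
    move=> Gv; apply: ge_sup; first exact: (proj1 hS).
    by move=> _ [w Gw ->]; exact: key.
  have [t0|t0|->] := ltgtP t 0.
  + have := sub1 _ (Gz _ (- t)^-1 Gu) => /= h.
    have e : (- t)^-1 *: u.1 - z = (- t)^-1 *: (u.1 + t *: z).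
      rewrite scalerDr scalerA invrN mulNr mulVf ?scaleN1r//.
      by rewrite lt_eqF.
    rewrite e pZ gtr0_norm in h; last by rewrite invr_gt0 oppr_gt0.
    have nt : 0 < - t by rewrite oppr_gt0.
    move: h; rewrite -mulrBr ler_pdivrMl//; lra.
  + have := sub2 _ (Gz _ t^-1 Gu) => /= h.
    have e : t^-1 *: u.1 + z = t^-1 *: (u.1 + t *: z).
      by rewrite scalerDr scalerA mulVf ?scale1r// gt_eqF.
    rewrite e pZ gtr0_norm ?invr_gt0// in h.
    move: h; rewrite -mulrBr ler_pdivlMl//; lra.
  + by rewrite scale0r mul0r !addr0; exact: Gp.
Qed.

Lemma hahn_banach (y : X) : exists f : X -> R,
  [/\ forall (a : R) u v, f (a *: u + v) = a * f u + f v,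
      forall x, `|f x| <= p x & f y = p y].
Proof.
(* The empty graph is there for the empty chain. *)
pose P := [set G | G = set0 \/ good y G].
have [|A [PA maxA]] := @Zorn_bigcup _ P.
  move=> F FP totF; have [e|] := pselect (forall G, F G -> G = set0).
    left; rewrite -subset0 => u [G FG Gu].
    by rewrite (e _ FG) in Gu.
  move=> /existsNP[G0 /not_implyP[FG0 G00]]; right.
  have gF G u : F G -> G u -> good y G.
    by move=> FG Gu; have [G0'|//] := FP _ FG; rewrite G0' in Gu.
  have [//|gG0] := FP _ FG0.
  split.
  - by exists G0 => //; case: gG0.
  - move=> a u v [G FG Gu] [H FH Hv].
    have [GH|HG] := totF _ _ FG FH.
    + by exists H => //; have [_ + _] := gF _ _ FH Hv; apply => //; exact: GH.
    + by exists G => //; have [_ + _] := gF _ _ FG Gu; apply => //; exact: HG.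
  - by move=> u [G FG Gu]; have [_ _] := gF _ _ FG Gu; exact.
pose G0 := [set w : X * R | exists t : R, w = (t *: y, t * p y)].
have gG0 : good y G0.
  split; first by exists 1; rewrite scale1r mul1r.
  - move=> a _ _ [t ->] [s ->]; exists (a * t + s) => /=.
    by rewrite scalerDl scalerA mulrDl mulrA.
  - move=> _ [t ->] /=; rewrite pZ ler_wpM2r ?seminorm_ge0//; exact: ler_norm.
have gA : good y A.
  case: PA => [A0|//]; exfalso; apply: (maxA G0); last by right.
  rewrite A0 properEneq; split => //; apply/eqP => e0.
  by case: gG0 => + _ _; rewrite -e0.
have domA z : exists r, A (z, r).
  apply: contrapT => nz; have [al gG] := good_extend z gA.
  apply: (maxA _ _ (or_intror gG)); split.
    move=> u Au; exists u, 0; rewrite scale0r mul0r !addr0; split => //.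
    by case: (u).
  move=> /(_ (z, al)) h; apply: nz; exists al; apply: h.
  case: gA => Ay Al _; exists (0, 0), 1; split => /=.
    have := Al (-1) _ _ Ay Ay => /=.
    by rewrite scaleN1r addNr mulN1r addNr.
  by rewrite add0r scale1r add0r mul1r.
have [Ay Al Ap] := gA.
have Ab x r : A (x, r) -> `|r| <= p x.
  move=> Ax; have := Ap _ Ax => /= h1.
  have A0 : A (0, 0).
    by have := Al (-1) _ _ Ay Ay => /=; rewrite scaleN1r addNr mulN1r addNr.
  have := Ap _ (Al (-1) _ _ Ax A0) => /=.
  by rewrite scaleN1r !addr0 seminormN => h2; rewrite ler_norml; lra.
have Au x r s : A (x, r) -> A (x, s) -> r = s.
  move=> Ar As; have := Ab _ _ (Al (-1) _ _ Ar As) => /=.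
  rewrite scaleN1r addNr seminorm0 mulN1r normr_le0 => /eqP; lra.
have [f fA] := choice domA.
exists f; split.
- by move=> a u v; apply: Au (fA _) _; exact: (Al a _ _ (fA u) (fA v)).
- by move=> x; exact: Ab.
- exact: Au (fA _) Ay.
Qed.

End HahnBanach.

(** * Ultrapowers *)

Section FreeUltrafilter.

Let exists_free : exists G : set_system nat, UltraFilter G /\ \oo `<=` G.
Proof. exact: ultraFilterLemma. Qed.

Definition free_ultra : set_system nat := sval (cid exists_free).

#[global] Instance free_ultraP : UltraFilter free_ultra.
Proof. exact: (proj1 (svalP (cid exists_free))). Qed.

Lemma free_ultra_near (P : nat -> Prop) :
  (\forall n \near \oo, P n) -> \forall n \near free_ultra, P n.
Proof. by move=> h; apply: (proj2 (svalP (cid exists_free))). Qed.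

Lemma free_ultra_ge (m : nat) : \forall n \near free_ultra, (m <= n)%N.
Proof. by apply: free_ultra_near; exists m. Qed.

End FreeUltrafilter.

Notation fulim := (@ulim _ free_ultra).

Section Ultrapower.
Context {R : realType} {X : normedModType R}.
Implicit Types u v w : nat -> X.

Definition bounded_seq u := exists C : R, forall n, `|u n| <= C.

Lemma bounded_seqD u v : bounded_seq u -> bounded_seq v -> bounded_seq (u + v).
Proof.
move=> [C uC] [D vD]; exists (C + D) => n.
by apply: le_trans (ler_normD _ _) _; exact: lerD.
Qed.

Lemma bounded_seqZ (a : R) u : bounded_seq u -> bounded_seq (a *: u).
Proof.
by move=> [C uC]; exists (`|a| * C) => n; rewrite normrZ ler_wpM2l.
Qed.

Lemma bounded_seqB u v : bounded_seq u -> bounded_seq v -> bounded_seq (u - v).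
Proof.
move=> bu bv; rewrite -scaleN1r; apply: bounded_seqD => //.
exact: bounded_seqZ.
Qed.

Lemma bounded_seq0 : bounded_seq 0.
Proof. by exists 0 => n; rewrite normr0. Qed.

Lemma bounded_seq_near u : bounded_seq u ->
  exists C : R, \forall n \near free_ultra, `| `|u n| | <= C.
Proof. by move=> [C uC]; exists C; apply: filterE => n; rewrite normr_id. Qed.

Definition unorm u : R := fulim (fun n => `|u n|).

Lemma unorm_cvg u : bounded_seq u ->
  (fun n => `|u n|) @ free_ultra --> unorm u.
Proof. by move=> /bounded_seq_near[C]; exact: ulim_cvg. Qed.

Lemma unorm_ge0 u : bounded_seq u -> 0 <= unorm u.
Proof.
move=> /bounded_seq_near[C uC]; apply: (ulim_ge uC).
by apply: filterE => n.
Qed.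

Lemma unorm_le u (C : R) : bounded_seq u ->
  (\forall n \near free_ultra, `|u n| <= C) -> unorm u <= C.
Proof. by move=> /bounded_seq_near[D uD]; exact: ulim_leC uD. Qed.

Lemma unormD u v : bounded_seq u -> bounded_seq v ->
  unorm (u + v) <= unorm u + unorm v.
Proof.
move=> bu bv; have [C uC] := bounded_seq_near bu.
have [D vD] := bounded_seq_near bv.
have [E uvE] := bounded_seq_near (bounded_seqD bu bv).
rewrite /unorm -(ulimD uC vD); apply: (ulim_le (D := C + D) uvE).
  by apply: filterS2 uC vD => n h1 h2; apply: le_trans (ler_normD _ _) (lerD _ _).
by apply: filterE => n; exact: ler_normD.
Qed.

Lemma unormZ (a : R) u : bounded_seq u -> unorm (a *: u) = `|a| * unorm u.
Proof.
move=> /bounded_seq_near[C uC]; rewrite /unorm -(ulimZ _ uC); congr ulim.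
by apply/funext => n; rewrite normrZ.
Qed.

Lemma unormC u v : unorm (u - v) = unorm (v - u).
Proof. by rewrite /unorm; congr ulim; apply/funext => n; exact: distrC. Qed.

Lemma unorm0 : unorm 0 = 0.
Proof.
rewrite /unorm -[RHS](@ulim_cst _ free_ultra); congr ulim.
by apply/funext => n; rewrite normr0.
Qed.

Lemma unormB0_trans u v w : bounded_seq u -> bounded_seq v -> bounded_seq w ->
  unorm (u - v) = 0 -> unorm (v - w) = 0 -> unorm (u - w) = 0.
Proof.
move=> bu bv bw uv vw; apply/eqP; rewrite eq_le unorm_ge0 ?andbT.
  have -> : u - w = (u - v) + (v - w) by rewrite addrA subrK.
  by apply: le_trans (unormD _ _) _; rewrite ?uv ?vw ?addr0//; exact: bounded_seqB.
exact: bounded_seqB.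
Qed.

(** The chosen representative depends only on the class of u, so that the
    ultrapower can be a set of sequences instead of a quotient. *)
Definition ucanon u : nat -> X :=
  xget 0 [set v | bounded_seq v /\ unorm (u - v) = 0].

Lemma ucanonP u : bounded_seq u ->
  bounded_seq (ucanon u) /\ unorm (u - ucanon u) = 0.
Proof.
move=> bu; rewrite /ucanon; case: xgetP => [v _ //|/(_ u)] /not_andP[//|].
by rewrite subrr unorm0.
Qed.

Lemma ucanon_eq u v : bounded_seq u -> bounded_seq v -> unorm (u - v) = 0 ->
  ucanon u = ucanon v.
Proof.
move=> bu bv uv; rewrite /ucanon; congr xget; apply/seteqP; split => w /= [bw].
  by move=> uw; split => //; apply: unormB0_trans uw => //; rewrite unormC.
by move=> vw; split => //; apply: unormB0_trans vw.
Qed.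

Lemma ucanonK u : bounded_seq u -> ucanon (ucanon u) = ucanon u.
Proof.
move=> bu; have [bc uc] := ucanonP bu.
by apply: ucanon_eq => //; rewrite unormC.
Qed.

End Ultrapower.

Definition ultrapower (R : realType) (X : normedModType R) : Type :=
  {u : nat -> X | `[< bounded_seq u /\ ucanon u = u >]}.

HB.instance Definition _ (R : realType) (X : normedModType R) :=
  SubType.on (@ultrapower R X).
HB.instance Definition _ (R : realType) (X : normedModType R) :=
  [Choice of @ultrapower R X by <:].

Section UltrapowerOps.
Context {R : realType} {X : normedModType R}.
Implicit Types (u v w : nat -> X) (x y z : ultrapower X).

Lemma upow_bounded x : bounded_seq (val x).
Proof. by have /asboolP[] := valP x. Qed.

Lemma upow_canon x : ucanon (val x) = val x.
Proof. by have /asboolP[] := valP x. Qed.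

Let ucanon_sub u : bounded_seq u ->
  `[< bounded_seq (ucanon u) /\ ucanon (ucanon u) = ucanon u >].
Proof.
by move=> bu; apply/asboolP; split; [case: (ucanonP bu)|exact: ucanonK].
Qed.

(** Unbounded sequences get the class of zero. *)
Definition uclass u : ultrapower X :=
  if pselect (bounded_seq u) is left bu then Sub (ucanon u) (ucanon_sub bu)
  else Sub (ucanon 0) (ucanon_sub bounded_seq0).

Lemma val_uclass u : bounded_seq u -> val (uclass u) = ucanon u.
Proof. by move=> bu; rewrite /uclass; case: pselect. Qed.

Lemma uclass_eq u v : bounded_seq u -> bounded_seq v ->
  unorm (u - v) = 0 -> uclass u = uclass v.
Proof.
by move=> bu bv uv; apply: val_inj; rewrite !val_uclass//; exact: ucanon_eq.
Qed.

Lemma valK_uclass x : uclass (val x) = x.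
Proof.
by apply: val_inj; rewrite val_uclass ?upow_canon//; exact: upow_bounded.
Qed.

Lemma uclass_dist u : bounded_seq u -> unorm (u - val (uclass u)) = 0.
Proof. by move=> bu; rewrite val_uclass//; case: (ucanonP bu). Qed.

Definition uadd x y := uclass (val x + val y).
Definition uscale (a : R) x := uclass (a *: val x).

Let bu := upow_bounded.

Lemma uadd_class u v : bounded_seq u -> bounded_seq v ->
  uadd (uclass u) (uclass v) = uclass (u + v).
Proof.
move=> hu hv; apply: uclass_eq; rewrite ?/bu.
- by apply: bounded_seqD; exact: bu.
- exact: bounded_seqD.
rewrite unormC opprD addrACA; apply/eqP; rewrite eq_le unorm_ge0; last first.
  by apply: bounded_seqD; apply: bounded_seqB.
rewrite andbT; apply: le_trans (unormD _ _) _; try exact: bounded_seqB.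
by rewrite !uclass_dist// addr0.
Qed.

Lemma uscale_class (a : R) u : bounded_seq u ->
  uscale a (uclass u) = uclass (a *: u).
Proof.
move=> hu; apply: uclass_eq; try exact: bounded_seqZ.
rewrite unormC -scalerBr unormZ; last exact: bounded_seqB.
by rewrite uclass_dist// mulr0.
Qed.

Let uE x : exists2 u, bounded_seq u & x = uclass u.
Proof. by exists (val x); [exact: bu|rewrite valK_uclass]. Qed.

Let bD := @bounded_seqD R X.
Let bZ := @bounded_seqZ R X.

Lemma uaddA : associative uadd.
Proof.
move=> x y z; have [u hu ->] := uE x; have [v hv ->] := uE y.
by have [w hw ->] := uE z; rewrite !uadd_class ?addrA//; exact: bD.
Qed.

Lemma uaddC : commutative uadd.
Proof.
move=> x y; have [u hu ->] := uE x; have [v hv ->] := uE y.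
by rewrite !uadd_class// addrC.
Qed.

Lemma uadd0 : left_id (uclass 0) uadd.
Proof.
move=> x; have [u hu ->] := uE x; rewrite uadd_class ?add0r//.
exact: bounded_seq0.
Qed.

Lemma uaddN : left_inverse (uclass 0) (uscale (-1)) uadd.
Proof.
move=> x; have [u hu ->] := uE x; rewrite uscale_class// uadd_class//.
  by rewrite scaleN1r addNr.
exact: bZ.
Qed.

HB.instance Definition _ :=
  GRing.isZmodule.Build (ultrapower X) uaddA uaddC uadd0 uaddN.

Let uscaleA (a b : R) x : uscale a (uscale b x) = uscale (a * b) x.
Proof.
by have [u hu ->] := uE x; rewrite !uscale_class ?scalerA//; exact: bZ.
Qed.

Let uscale1 : left_id 1 uscale.
Proof. by move=> x; have [u hu ->] := uE x; rewrite uscale_class ?scale1r. Qed.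

Let uscaleDr : right_distributive uscale +%R.
Proof.
move=> a x y; have [u hu ->] := uE x; have [v hv ->] := uE y.
rewrite -[_ + _]/(uadd _ _) -[RHS]/(uadd _ _) !(uadd_class, uscale_class)//.
- by rewrite scalerDr.
- exact: bZ.
- exact: bZ.
- exact: bD.
Qed.

Let uscaleDl x : {morph uscale^~ x : a b / a + b}.
Proof.
move=> a b; have [u hu ->] := uE x.
rewrite -[RHS]/(uadd _ _) !uscale_class// uadd_class ?scalerDl//; exact: bZ.
Qed.

HB.instance Definition _ := GRing.Zmodule_isLmodule.Build R (ultrapower X)
  uscaleA uscale1 uscaleDr uscaleDl.

Lemma uclassD u v : bounded_seq u -> bounded_seq v ->
  uclass (u + v) = uclass u + uclass v.
Proof. by move=> hu hv; rewrite -uadd_class. Qed.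

Lemma uclassZ (a : R) u : bounded_seq u -> uclass (a *: u) = a *: uclass u.
Proof. by move=> hu; rewrite -uscale_class. Qed.

Definition upow_norm x : R := unorm (val x).

Lemma upow_norm_class u : bounded_seq u -> upow_norm (uclass u) = unorm u.
Proof.
move=> hu; rewrite /upow_norm; have d := uclass_dist hu.
have bB : bounded_seq (u - val (uclass u)) by exact: bounded_seqB.
apply/eqP; rewrite eq_le; apply/andP; split.
  rewrite (_ : val (uclass u) = (val (uclass u) - u) + u); last by rewrite subrK.
  apply: le_trans (unormD _ _) _ => //; first exact: bounded_seqB.
  by rewrite unormC d add0r.
rewrite -{1}(subrK (val (uclass u)) u).
by apply: le_trans (unormD _ _) _ => //; rewrite d add0r.
Qed.

Let upow_normD x y : upow_norm (x + y) <= upow_norm x + upow_norm y.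
Proof.
have [u hu ->] := uE x; have [v hv ->] := uE y.
rewrite -uclassD// !upow_norm_class//; first exact: unormD.
exact: bD.
Qed.

Let upow_normZ (a : R) x : upow_norm (a *: x) = `|a| * upow_norm x.
Proof.
have [u hu ->] := uE x; rewrite -uclassZ// !upow_norm_class//; last exact: bZ.
exact: unormZ.
Qed.

Let upow_norm0_eq0 x : upow_norm x = 0 -> x = 0.
Proof.
move=> x0; rewrite -(valK_uclass x); apply: uclass_eq; rewrite ?subr0//.
exact: bounded_seq0.
Qed.

HB.instance Definition _ := Lmodule_isNormed.Build R (ultrapower X)
  upow_normD upow_normZ upow_norm0_eq0.

Lemma normr_uclass u : bounded_seq u -> `|uclass u| = unorm u.
Proof. exact: upow_norm_class. Qed.

Lemma normr_upow x : `|x| = unorm (val x).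
Proof. by []. Qed.

Lemma uclassB u v : bounded_seq u -> bounded_seq v ->
  uclass (u - v) = uclass u - uclass v.
Proof.
move=> hu hv; have := uclassD hu (bZ (-1) hv).
by rewrite uclassZ// !scaleN1r.
Qed.

End UltrapowerOps.

Section UltrapowerComplete.
Context {R : realType} {X : normedModType R}.

Lemma upow_dist (x y : ultrapower X) : `|x - y| = unorm (val x - val y).
Proof.
have hx := upow_bounded x; have hy := upow_bounded y.
by rewrite -{1}(valK_uclass x) -{1}(valK_uclass y) -uclassB// normr_uclass//;
  exact: bounded_seqB.
Qed.

Lemma upow_dist_near (x y : ultrapower X) (e : R) : `|x - y| < e ->
  \forall n \near free_ultra, `|val x n - val y n| < e.
Proof.
rewrite upow_dist => xye.
have b : bounded_seq (val x - val y) by apply: bounded_seqB; exact: upow_bounded.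
have /cvgrPdist_lt/(_ (e - unorm (val x - val y))) := unorm_cvg b.
rewrite subr_gt0 => /(_ xye); apply: filterS => n.
have -> : val x n - val y n = (val x - val y) n by [].
by rewrite ltr_distl => /andP[]; lra.
Qed.

(** A diagonal argument: the n-th term of the limit w is the n-th term of the
    latest approximant u k, k <= n, such that u 0, ..., u k have at n the
    mutual distances that they should have. *)
Lemma upow_complete (F : set_system (ultrapower X)) :
  ProperFilter F -> cauchy F -> cvg F.
Proof.
move=> FF /cauchyP Fc.
have Fk (k : nat) : exists x, F (ball x (2^-1 ^+ k : R)) by exact: Fc.
have [a aF] := choice Fk.
have adist i j : `|a i - a j| < 2^-1 ^+ i + 2^-1 ^+ j.
  have [y []] := @filter_ex _ F _ _ (filterI (aF i) (aF j)).
  rewrite -ball_normE /= => h1 h2.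
  rewrite (_ : a i - a j = (a i - y) - (a j - y)); last by rewrite opprB addrA subrK.
  by apply: le_lt_trans (ler_normB _ _) (ltrD h1 h2).
pose u i := val (a i).
pose A k n := forall i j : 'I_k.+1,
  `|u i n - u j n| < 2^-1 ^+ i + 2^-1 ^+ j.
have nearA k : \forall n \near free_ultra, A k n.
  apply: filter_forall => i; apply: filter_forall => j.
  exact: upow_dist_near (adist i j).
have A0 n : A 0%N n.
  by move=> i j; rewrite !ord1 subrr normr0 expr0.
pose P n := [pred k : 'I_n.+1 | `[< A k n >]].
pose kk n : nat := [arg max_(k > (ord0 : 'I_n.+1) | P n k) (k : nat)].
have kkA n : A (kk n) n /\ forall k, (k <= n)%N -> A k n -> (k <= kk n)%N.
  rewrite /kk; case: arg_maxnP; first by apply/asboolP; exact: A0.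
  move=> i /asboolP Ai imax; split => // k kn Ak.
  by apply: (imax (Ordinal (kn : (k < n.+1)%N))); apply/asboolP.
pose w n := u (kk n) n.
have wu m n : (m <= n)%N -> A m n -> `|w n - u m n| < 2 * 2^-1 ^+ m.
  move=> mn Amn; have [Ak kmax] := kkA n; have mk := kmax _ mn Amn.
  have := Ak ord_max (Ordinal (mk : (m < (kk n).+1)%N)) => /= h.
  apply: lt_le_trans h _.
  rewrite [leRHS](_ : _ = 2^-1 ^+ m + 2^-1 ^+ m); last by ring.
  rewrite lerD2r.
  by apply: ler_wiXn2l => //; lra.
have [C uC] := upow_bounded (a 0%N).
have bw : bounded_seq w.
  exists (2 + C) => n; rewrite -(subrK (u 0%N n) (w n)).
  apply: le_trans (ler_normD _ _) _; apply: lerD; last exact: uC.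
  by apply: ltW; apply: lt_le_trans (wu _ _ (leq0n n) (A0 n)) _; rewrite expr0 mulr1.
have da k : `|uclass w - a k| <= 2 * 2^-1 ^+ k.
  rewrite -(valK_uclass (a k)) -uclassB//; last exact: upow_bounded.
  rewrite normr_uclass; last by apply: bounded_seqB => //; exact: upow_bounded.
  apply: unorm_le; first by apply: bounded_seqB => //; exact: upow_bounded.
  by apply: filterS2 (nearA k) (free_ultra_ge k) => n h1 h2; exact/ltW/wu.
apply/cvg_ex; exists (uclass w); apply/cvg_ballP => e e0.
have [k ke] : exists k, 3 * 2^-1 ^+ k < e :> R.
  have : (fun k => 3 * 2^-1 ^+ k : R) @ \oo --> (0 : R).
    rewrite -[X in _ --> X](mulr0 3); apply: cvgM; first exact: cvg_cst.
    by apply: cvg_expr; rewrite ger0_norm; lra.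
  move=> /cvgrPdist_lt/(_ e e0)[k _ /(_ k (leqnn k))] /=.
  rewrite sub0r normrN ger0_norm => [h|]; first by exists k.
  by rewrite mulr_ge0// exprn_ge0; lra.
apply: filterS (aF k) => y; rewrite -ball_normE /= => h.
rewrite (_ : uclass w - y = (uclass w - a k) + (a k - y)); last first.
  by rewrite addrA subrK.
apply: le_lt_trans (ler_normD _ _) _; apply: lt_trans ke.
by have := da k; lra.
Qed.

HB.instance Definition _ :=
  Uniform_isComplete.Build (ultrapower X) upow_complete.

End UltrapowerComplete.

Section FiniteDimensional.
Context {R : realType}.

(** A spanning family of minimal length is free. *)
Lemma lin_spanP (V : lmodType R) (F : set V) : findim_subspace F ->
  exists (n : nat) (e : 'I_n -> V), F = lin_span e /\
    forall c : 'I_n -> R, \sum_i c i *: e i = 0 -> forall i, c i = 0.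
Proof.
move=> fF.
have ex : exists n, `[< exists e : 'I_n -> V, F = lin_span e >].
  by case: fF => n [e Fe]; exists n; apply/asboolP; exists e.
case: (ex_minnP ex) => n /asboolP[e Fe] nmin; exists n, e; split => // c c0 i.
apply: contrapT => /eqP ci0.
case: n => [|n] in e Fe nmin c c0 i ci0 *; first by case: i ci0.
suff /asboolP/nmin : exists e' : 'I_n -> V, F = lin_span e' by rewrite ltnn.
exists (fun j => e (lift i j)); rewrite Fe; apply/seteqP.
have ei : e i = \sum_j (- (c i)^-1 * c (lift i j)) *: e (lift i j).
  move: c0; rewrite (bigD1_ord i)//= => /eqP; rewrite addr_eq0 => /eqP h.
  rewrite -[LHS](scalerK ci0) h scalerN -scaleNr scaler_sumr.
  by apply: eq_bigr => j _; rewrite scalerA.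
split => x [d ->].
  exists (fun j => d (lift i j) + d i * (- (c i)^-1 * c (lift i j))).
  rewrite (bigD1_ord i)//= {1}ei scaler_sumr -big_split/=.
  by apply: eq_bigr => j _; rewrite scalerA -scalerDl addrC.
exists (fun k => if unlift i k is Some j then d j else 0).
rewrite (bigD1_ord i)//= unlift_none scale0r add0r.
by apply: eq_bigr => j _; rewrite liftK.
Qed.

Variable X : normedModType R.

(** The coordinate sphere is compact and the norms N and Nk k are uniformly
    Lipschitz, so the pointwise convergence of Nk k to N along the ultrafilter
    is uniform there, up to a factor. *)
Let approx n (e : 'I_n -> ultrapower X) (eta : R) : 0 < eta ->
  (forall c : 'I_n -> R, \sum_i c i *: e i = 0 -> forall i, c i = 0) ->
  exists k, forall c : 'I_n -> R,
    `| `|\sum_i c i *: val (e i) k| - `|\sum_i c i *: e i| |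
      <= eta * `|\sum_i c i *: e i|.
Proof.
move=> eta0 efree.
pose N (c : 'rV[R]_n) : R := `|\sum_i c 0 i *: e i|.
pose Nk k (c : 'rV[R]_n) : R := `|\sum_i c 0 i *: val (e i) k|.
have NZ (a : R) c : N (a *: c) = `|a| * N c.
  rewrite /N -normrZ scaler_sumr; congr `|_|; apply: eq_bigr => i _.
  by rewrite mxE scalerA.
have NkZ k (a : R) c : Nk k (a *: c) = `|a| * Nk k c.
  rewrite /Nk -normrZ scaler_sumr; congr `|_|; apply: eq_bigr => i _.
  by rewrite mxE scalerA.
have [C C0 [CN CNk]] : exists2 C : R, 0 < C &
    (forall c, N c <= C * `|c|) /\ (forall k c, Nk k c <= C * `|c|).
  have /choice[B BP] i : exists B : R, forall k, `|val (e i) k| <= B.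
    exact: upow_bounded.
  have B0 i : 0 <= B i by apply: le_trans (BP i 0%N).
  have eB i : `|e i| <= B i.
    rewrite normr_upow; apply: unorm_le; first exact: upow_bounded.
    by apply: filterE; exact: BP.
  have cn (c : 'rV[R]_n) i : `|c 0 i| <= `|c|.
    rewrite [leRHS]/Num.norm /= mx_normrE; apply/bigmax_geP; right => /=.
    by exists (0, i).
  exists (1 + \sum_i B i); first by rewrite ltr_pwDl// sumr_ge0.
  have key (V : normedModType R) (v : 'I_n -> V) (c : 'rV[R]_n) :
      (forall i, `|v i| <= B i) ->
      `|\sum_i c 0 i *: v i| <= (1 + \sum_i B i) * `|c|.
    move=> vB; apply: le_trans (ler_norm_sum _ _ _) _.
    rewrite mulrDl mul1r mulr_suml -[leLHS]add0r lerD//.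
    by apply: ler_sum => i _; rewrite normrZ mulrC ler_pM.
  split => [c|k c]; first exact: key.
  by apply: key.
have ND c d : `|N c - N d| <= C * `|c - d|.
  apply: le_trans (CN _); apply: le_trans (ler_dist_dist _ _) _.
  rewrite -sumrB /N le_eqVlt; apply/orP; left; apply/eqP; congr `|_|.
  by apply: eq_bigr => i _; rewrite !mxE scalerBl.
have NkD k c d : `|Nk k c - Nk k d| <= C * `|c - d|.
  apply: le_trans (CNk k _); apply: le_trans (ler_dist_dist _ _) _.
  rewrite -sumrB /Nk le_eqVlt; apply/orP; left; apply/eqP; congr `|_|.
  by apply: eq_bigr => i _; rewrite !mxE scalerBl.
have Nlim c : (fun k => Nk k c) @ free_ultra --> N c.
  pose u : nat -> X := \sum_i c 0 i *: val (e i).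
  have [bu cu] : bounded_seq u /\ uclass u = \sum_i c 0 i *: e i.
    rewrite /u; elim/big_rec2 : _ => [|i y v _ [bv cv]].
      by split; first exact: bounded_seq0.
    have be := bounded_seqZ (c 0 i) (upow_bounded (e i)).
    split; first exact: bounded_seqD.
    by rewrite uclassD// cv uclassZ ?valK_uclass//; exact: upow_bounded.
  have -> : N c = unorm u by rewrite /N -cu normr_uclass.
  have -> : (fun k => Nk k c) = (fun k => `|u k|).
    by apply/funext => k; rewrite /Nk /u fct_sumE.
  exact: unorm_cvg.
pose S : set 'rV[R]_n := [set c | `|c| = 1].
have cS : compact S.
  apply: bounded_closed_compact.
    by exists 1; split => // r r1 c /= ->; exact: ltW.
  by apply: (closed_comp (f := fun c : 'rV[R]_n => `|c|) (D := [set 1]));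
    [move=> c _; exact: norm_continuous|exact: closed_eq].
have [k kP] : exists k, forall c, S c -> `|Nk k c - N c| <= eta * N c.
  have /compact_near_coveringP cov := cS.
  have := cov _ free_ultra (fun k c => `|Nk k c - N c| <= eta * N c) _.
  have /[swap] /[apply] : forall c, S c ->
      \forall c' \near c & k \near free_ultra, `|Nk k c' - N c'| <= eta * N c'.
    move=> c Sc; have Nc0 : 0 < N c.
      rewrite normr_gt0; apply/eqP => e0.
      have c0 : c = 0 by apply/rowP => i; rewrite mxE; exact: (efree (c 0)).
      by move: Sc; rewrite /S /= c0 normr0 => /esym/eqP; rewrite oner_eq0.
    pose m := Num.min (N c / (2 * C)) (eta * N c / (8 * C)).
    have m0 : 0 < m.
      by rewrite lt_min !divr_gt0 ?mulr_gt0.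
    exists (ball c m, [set k | `|Nk k c - N c| <= eta * N c / 4]) => /=.
      split; first exact: nbhsx_ballx.
      have /cvgrPdist_le/(_ (eta * N c / 4)) := Nlim c.
      rewrite divr_gt0 ?mulr_gt0// => /(_ isT); apply: filterS => k.
      by rewrite distrC.
    move=> [c' k] [/= + kc]; rewrite -ball_normE /= => cc'.
    have : C * `|c - c'| <= C * m by rewrite ler_pM2l// ltW.
    have Cm1 : C * m <= N c / 2.
      have -> : N c / 2 = C * (N c / (2 * C)) by field; rewrite gt_eqF.
      by rewrite ler_pM2l// /m ge_min lexx.
    have Cm2 : C * m <= eta * N c / 8.
      have -> : eta * N c / 8 = C * (eta * N c / (8 * C)) by field; rewrite gt_eqF.
      by rewrite ler_pM2l// /m ge_min lexx orbT.
    have := ND c c'; have := NkD k c c'; move: kc.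
    rewrite !ler_norml => /andP[a1 a2] /andP[b1 b2] /andP[d1 d2] cm.
    have : eta * (N c / 2) <= eta * N c' by rewrite ler_pM2l//; lra.
    by move=> ?; apply/andP; split; lra.
  by move=> h; have [k kS] := @filter_ex _ free_ultra _ _ h; exists k => c /kS.
exists k => c.
have -> : \sum_i c i *: val (e i) k = \sum_i (\row_i c i) 0 i *: val (e i) k.
  by apply: eq_bigr => i _; rewrite mxE.
have -> : \sum_i c i *: e i = \sum_i (\row_i c i) 0 i *: e i.
  by apply: eq_bigr => i _; rewrite mxE.
move: (\row_i c i) => {}c; rewrite -/(N c) -/(Nk k c).
have [->|c0] := eqVneq c 0.
  by rewrite -(scale0r 0) NZ NkZ normr0 !mul0r subrr normr0 mulr0.
have /kP : S (`|c|^-1 *: c).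
  by rewrite /S /= normrZ normfV normr_id mulVf// normr_eq0.
rewrite NZ NkZ -mulrBr normrM mulrCA normr_id ler_pM2l//.
by rewrite normfV normr_id invr_gt0 normr_gt0.
Qed.

(** A finite dimensional subspace is mapped to X by evaluating representatives
    of a free basis at a late index.  With eta = eps / (2 + eps), the distortion
    (1 + eta) / (1 - eta) is 1 + eps. *)
Lemma ultrapower_fin_rep : finitely_representable (ultrapower X) X.
Proof.
move=> F /lin_spanP[n [e [-> efree]]] eps eps0.
pose eta := eps / (2 + eps).
have eta0 : 0 < eta by rewrite divr_gt0// addr_gt0.
have eta1 : eta < 1 by rewrite ltr_pdivrMr; lra.
have [k kP] := approx eta0 efree.
have /choice[c cP] : forall y, exists c : 'I_n -> R,
    lin_span e y -> y = \sum_i c i *: e i.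
  move=> y; have [[c yc]|ny] := pselect (lin_span e y); first by exists c.
  by exists (fun=> 0).
have r0 : 0 < 1 - eta by rewrite subr_gt0.
exists (fun y => (1 - eta)^-1 *: \sum_i c y i *: val (e i) k); split.
  move=> a u v Fu Fv.
  have cD i : c (a *: u + v) i = a * c u i + c v i.
    have Fuv : lin_span e (a *: u + v).
      exists (fun i => a * c u i + c v i); rewrite {1}(cP _ Fu) {1}(cP _ Fv).
      rewrite scaler_sumr -big_split; apply: eq_bigr => j _ /=.
      by rewrite scalerDl scalerA.
    apply/eqP; rewrite -subr_eq0; apply/eqP; move: i; apply: efree.
    under eq_bigr do rewrite scalerBl.
    rewrite sumrB -(cP _ Fuv) {1}(cP _ Fu) {1}(cP _ Fv).
    rewrite scaler_sumr -big_split/= -sumrB; apply: big1 => j _ /=.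
    by rewrite scalerDl scalerA subrr.
  rewrite scalerA mulrC -scalerA -scalerDr; congr (_ *: _).
  rewrite scaler_sumr -big_split/=; apply: eq_bigr => j _.
  by rewrite cD scalerDl scalerA.
move=> y Fy; have := kP (c y); rewrite -(cP _ Fy) ler_norml => /andP[h1 h2].
rewrite normrZ gtr0_norm ?invr_gt0// ler_pdivlMl// ler_pdivrMl//; split; first by lra.
suff -> : (1 - eta) * ((1 + eps) * `|y|) = (1 + eta) * `|y| by lra.
by rewrite /eta; field; lra.
Qed.

End FiniteDimensional.

(** * Separated sequences in superreflexive spaces *)

Section Duality.
Context {R : realType}.
Implicit Types X : normedModType R.

Definition is_linear (V : lmodType R) (f : V -> R) :=
  forall (a : R) u v, f (a *: u + v) = a * f u + f v.

Section IsLinear.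
Context {V : lmodType R} (f : V -> R).
Hypothesis fl : is_linear f.

Lemma is_linear0 : f 0 = 0.
Proof. by have := fl (-1) 0 0; rewrite scaler0 addr0; lra. Qed.

Lemma is_linearZ (a : R) u : f (a *: u) = a * f u.
Proof. by have := fl a u 0; rewrite !addr0 is_linear0 addr0. Qed.

Lemma is_linearD u v : f (u + v) = f u + f v.
Proof. by have := fl 1 u v; rewrite scale1r mul1r. Qed.

Lemma is_linearN u : f (- u) = - f u.
Proof. by rewrite -scaleN1r is_linearZ mulN1r. Qed.

Lemma is_linearB u v : f (u - v) = f u - f v.
Proof. by rewrite is_linearD is_linearN. Qed.

Lemma is_linear_sum (I : Type) (s : seq I) (P : pred I) (F : I -> V) :
  f (\sum_(i <- s | P i) F i) = \sum_(i <- s | P i) f (F i).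
Proof. by elim/big_rec2: _ => [|i x y _ <-]; rewrite ?is_linear0 ?is_linearD. Qed.

End IsLinear.

Lemma bounded_dual X (f : X -> R) (C : R) : is_linear f ->
  (forall x, `|f x| <= C * `|x|) -> dual (f : X -> R^o).
Proof.
move=> fl fC; split; first exact: fl.
move=> x; apply/cvgrPdist_le => e e0.
have C1 : 0 < `|C| + 1 by rewrite ltr_wpDl.
near=> y.
rewrite -[f x - f y](is_linearB fl); apply: le_trans (fC _) _.
apply: (@le_trans _ _ ((`|C| + 1) * `|x - y|)).
  by rewrite ler_wpM2r//; have := ler_norm C; lra.
rewrite -ler_pdivlMl// mulrC; near: y.
apply: (@cvgr_dist_le _ _ _ (nbhs x) _ id); first exact: cvg_id.
by rewrite divr_gt0.
Unshelve. all: by end_near. Qed.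

Lemma dual_norm_unit X (f : X -> R^o) : dual f ->
  forall x, `|x| <= 1 -> `|f x| <= dual_norm f.
Proof.
move=> [fl' fc]; have fl : is_linear (f : X -> R) by exact: fl'.
have [r r0 fr] : exists2 r : R, 0 < r & forall x, `|x| < r -> `|f x| <= 1.
  have /cvgrPdist_le/(_ 1 ltr01) := fc 0.
  rewrite -nbhs_ballE => -[r /= r0 fr]; exists r => // x xr.
  have := fr x; rewrite -ball_normE /= sub0r normrN => /(_ xr).
  by rewrite (is_linear0 fl) sub0r normrN.
have fb x : `|x| <= 1 -> `|f x| <= 2 / r.
  move=> x1; have := fr ((r / 2) *: x).
  rewrite normrZ gtr0_norm ?divr_gt0// (is_linearZ fl) normrM.
  rewrite (gtr0_norm (_ : 0 < r / 2)) ?divr_gt0// => h.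
  have : r / 2 * `|f x| <= 1.
    apply: h; apply: (@le_lt_trans _ _ (r / 2)); last by lra.
    by rewrite ler_piMr// ltW// divr_gt0.
  by rewrite mulrC -ler_pdivlMr ?divr_gt0// invf_div mul1r.
move=> x x1; apply: ub_le_sup; last by exists x.
by exists (2 / r) => _ [z z1 <-]; exact: fb.
Qed.

Lemma dual_norm_ge0 X (f : X -> R^o) : dual f -> 0 <= dual_norm f.
Proof.
by move=> /dual_norm_unit/(_ 0); rewrite normr0 => /(_ ler01); apply: le_trans.
Qed.

Lemma dual_normP X (f : X -> R^o) : dual f ->
  forall x, `|f x| <= dual_norm f * `|x|.
Proof.
move=> df x; have fl : is_linear (f : X -> R) by case: df.
have [->|x0] := eqVneq x 0.
  by rewrite (is_linear0 fl) !normr0 mulr0.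
have n0 : 0 < `|x| by rewrite normr_gt0.
have := dual_norm_unit df (x := `|x|^-1 *: x).
rewrite normrZ normfV normr_id mulVf ?gt_eqF// => /(_ (lexx _)).
by rewrite (is_linearZ fl) normrM normfV normr_id ler_pdivrMl// mulrC.
Qed.

(** In a reflexive space bounded sequences have weak limits along ultrafilters:
    the limits of the values f (e j) define a bounded functional on the dual. *)
Lemma reflexive_ulim X (V : set_system nat) (UV : UltraFilter V)
    (e : nat -> X) (C : R) : reflexive_space X -> (forall j, `|e j| <= C) ->
  exists y, forall f, dual f -> f y = ulim V (fun j => f (e j) : R).
Proof.
move=> rX eC.
have fe f : dual f -> \forall j \near V, `|f (e j) : R| <= C * dual_norm f.
  move=> df; apply: filterE => j; apply: le_trans (dual_normP df _) _.
  by rewrite mulrC ler_wpM2r// dual_norm_ge0.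
have [||y yP] := rX (fun f => ulim V (fun j => f (e j) : R)).
- move=> a f g df dg /=.
  have b : \forall j \near V, `|a * f (e j) : R| <= `|a| * (C * dual_norm f).
    by apply: filterS (fe f df) => j h; rewrite normrM ler_wpM2l.
  by rewrite -[a *: ulim _ _]/(a * _) -(ulimZ a (fe f df)) -(ulimD b (fe g dg)).
- exists C => f df; rewrite ler_norml; apply/andP; split.
    apply: (ulim_ge (fe f df)); apply: filterS (fe f df) => j.
    by rewrite ler_norml => /andP[].
  apply: (ulim_leC (fe f df)); apply: filterS (fe f df) => j.
  by rewrite ler_norml => /andP[].
by exists y => f df; rewrite -yP.
Qed.

Definition ufun X (phi : nat -> X -> R) (z : ultrapower X) : R :=
  fulim (fun N => phi N (val z N)).

Section Ufun.
Context {X : normedModType R} (phi : nat -> X -> R).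
Hypothesis phil : forall N, is_linear (phi N).
Hypothesis phi1 : forall N x, `|phi N x| <= `|x|.

Let phib (u : nat -> X) : bounded_seq u ->
  exists C : R, \forall N \near free_ultra, `|phi N (u N)| <= C.
Proof.
by move=> [C uC]; exists C; apply: filterE => N; apply: le_trans (phi1 _ _) _.
Qed.

Lemma ufun_class u : bounded_seq u ->
  ufun phi (uclass u) = fulim (fun N => phi N (u N)).
Proof.
move=> bu; have bv := upow_bounded (uclass u).
have [C uC] := phib bu; have [D vD] := phib bv.
apply: ulim_eq.
have -> : (fun N => phi N (val (uclass u) N)) =
    (fun N => phi N (u N) - phi N (u N - val (uclass u) N)).
  by apply/funext => N; rewrite -(is_linearB (phil N)) subKr.
rewrite -[X in _ --> X]subr0; apply: cvgB; first exact: (ulim_cvg uC).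
have nz : (fun N => `|(u - val (uclass u)) N|) @ free_ultra --> (0 : R).
  by rewrite -(uclass_dist bu); apply: unorm_cvg; exact: bounded_seqB.
apply/cvgrPdist_le => e e0; have /cvgrPdist_le/(_ e e0) := nz.
apply: filterS => N; rewrite !sub0r !normrN normr_id => h.
by apply: le_trans (phi1 _ _) _.
Qed.

Lemma ufun_linear : is_linear (ufun phi).
Proof.
move=> a x y; have bx := upow_bounded x; have byy := upow_bounded y.
have -> : a *: x + y = uclass (a *: val x + val y).
  rewrite uclassD//; last exact: bounded_seqZ.
  by rewrite uclassZ// !valK_uclass.
rewrite ufun_class; last by apply: bounded_seqD => //; exact: bounded_seqZ.
have [C uC] := phib bx; have [D vD] := phib byy.
have b : \forall N \near free_ultra, `|a * phi N (val x N) : R| <= `|a| * C.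
  by apply: filterS uC => j h; rewrite normrM ler_wpM2l.
rewrite /ufun -(ulimZ _ uC) -(ulimD b vD); congr ulim.
by apply/funext => N; exact: phil.
Qed.

Lemma ufun_le x : `|ufun phi x| <= `|x|.
Proof.
have [C uC] := phib (upow_bounded x).
have [D xD] := bounded_seq_near (upow_bounded x).
have xN : \forall n \near free_ultra, `| - `|val x n| | <= D.
  by apply: filterS xD => n; rewrite normrN.
rewrite normr_upow ler_norml; apply/andP; split.
  rewrite -mulN1r -(ulimZ _ xD); apply: (ulim_le (C := D) (D := C)) => //.
    by apply: filterS xN => n; rewrite mulN1r.
  by apply: filterE => n; have := phi1 n (val x n); rewrite ler_norml => /andP[]; lra.
apply: (ulim_le uC xD); apply: filterE => n.
by have := phi1 n (val x n); rewrite ler_norml => /andP[].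
Qed.

Lemma ufun_dual : dual (ufun phi : ultrapower X -> R^o).
Proof.
apply: (@bounded_dual _ _ 1); first exact: ufun_linear.
by move=> x; rewrite mul1r; exact: ufun_le.
Qed.

End Ufun.

Definition split_sign n (k j : 'I_n) : R := if (j <= k)%N then 1 else -1.

Definition split_sum (V : lmodType R) n (x : 'I_n -> V) (k : 'I_n) : V :=
  \sum_j split_sign k j *: x j.

Lemma norm_split_sign n (k j : 'I_n) : `|split_sign k j| = 1.
Proof. by rewrite /split_sign; case: ifP => _; rewrite ?normrN1 ?normr1. Qed.

(** The functional f k separates the convex hull of x 0, ..., x k from that of
    the later terms by a gap that does not depend on n. *)
Definition james_seq X n (x : 'I_n -> X) (f : 'I_n -> X -> R) :=
  [/\ forall k, is_linear (f k), forall k z, `|f k z| <= `|z|,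
      forall j, `|x j| <= 2 & forall k j, 2^-1 <= split_sign k j * f k (x j)].

(** Otherwise the ultrapower contains an infinite sequence e with separating
    functionals F k.  Let y be its weak limit and G the limit of the F k.  Then
    F k y <= - 1/2 for every k, as F k (e j) <= - 1/2 for j > k, and so
    G y <= - 1/2; but G (e j) >= 1/2 for every j, and so G y >= 1/2. *)
Lemma no_james_seq X : superreflexive X ->
  exists n, forall (x : 'I_n.+1 -> X) f, ~ james_seq x f.
Proof.
move=> srX; apply: contrapT => /forallNP nex.
have xfex n : exists xf : ('I_n.+1 -> X) * ('I_n.+1 -> X -> R),
    james_seq xf.1 xf.2.
  by have /existsNP[x /existsNP[f /contrapT h]] := nex n; exists (x, f).
pose xf n := sval (cid (xfex n)); 
have xfP n : james_seq (xf n).1 (xf n).2 by exact: svalP (cid (xfex n)).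
pose e j := uclass (fun N => (xf N).1 (inord j)).
have be j : bounded_seq (fun N => (xf N).1 (inord j)).
  by exists 2 => N; have [_ _ + _] := xfP N.
have e2 j : `|e j| <= 2.
  rewrite normr_uclass//; apply: unorm_le => //; apply: filterE => N.
  by have [_ _ + _] := xfP N.
pose phi k N := (xf N).2 (inord k).
have phil k N : is_linear (phi k N) by have [+ _ _ _] := xfP N; apply.
have phi1 k N z : `|phi k N z| <= `|z| by have [_ + _ _] := xfP N; apply.
pose F k := ufun (phi k).
have Fd k : dual (F k : ultrapower X -> R^o) by exact: ufun_dual.
have Fl k : is_linear (F k) by exact: ufun_linear.
have F1 k z : `|F k z| <= `|z| by exact: ufun_le.
have bFe k j : \forall N \near free_ultra,
    `|phi k N ((xf N).1 (inord j))| <= 2.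
  apply: filterE => N; apply: le_trans (phi1 _ _ _) _.
  by have [_ _ + _] := xfP N.
have Fe k j : F k (e j) = fulim (fun N => phi k N ((xf N).1 (inord j))).
  by rewrite /F ufun_class.
have Fpos k j : (j <= k)%N -> 2^-1 <= F k (e j).
  move=> jk; rewrite Fe; apply: (ulim_ge (bFe k j)).
  apply: filterS (free_ultra_ge k) => N kN.
  have [_ _ _ /(_ (inord k) (inord j))] := xfP N.
  by rewrite /split_sign !inordK ?ltnS ?jk ?mul1r// (leq_trans jk).
have Fneg k j : (k < j)%N -> F k (e j) <= - 2^-1.
  move=> jk; rewrite Fe; apply: (ulim_leC (bFe k j)).
  apply: filterS (free_ultra_ge j) => N kN.
  have [_ _ _ /(_ (inord k) (inord j))] := xfP N.
  have kN' : (k <= N)%N by apply: ltnW; apply: leq_trans kN.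
  by rewrite /split_sign !inordK ?ltnS// leqNgt jk /= /phi; lra.
have rY := srX _ (@ultrapower_fin_rep _ X).
have [y yP] := reflexive_ulim free_ultraP rY e2.
have Fb z : \forall k \near free_ultra, `|F k z| <= `|z|.
  by apply: filterE => k.
pose G z := fulim (fun k => F k z).
have Gd : dual (G : ultrapower X -> R^o).
  apply: (@bounded_dual _ _ 1) => [a u v|z]; rewrite /G.
    have b : \forall k \near free_ultra, `|a * F k u| <= `|a| * `|u|.
      by apply: filterS (Fb u) => j h; rewrite normrM ler_wpM2l.
    rewrite -(ulimZ _ (Fb u)) -(ulimD b (Fb v)); congr ulim.
    by apply/funext => k; exact: Fl.
  rewrite mul1r ler_norml; apply/andP; split.
    apply: (ulim_ge (Fb z)); apply: filterS (Fb z) => k.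
    by rewrite ler_norml => /andP[].
  apply: (ulim_leC (Fb z)); apply: filterS (Fb z) => k.
  by rewrite ler_norml => /andP[].
have Feb k : \forall j \near free_ultra, `|F k (e j)| <= 2.
  by apply: filterE => j; apply: le_trans (F1 _ _) _.
have Geb : \forall j \near free_ultra, `|G (e j)| <= 2.
  apply: filterE => j; have := dual_normP Gd (e j) => _.
  rewrite ler_norml; apply/andP; split.
    apply: (ulim_ge (Fb _)); apply: filterE => k.
    by have := F1 k (e j); have := e2 j; rewrite ler_norml => ? /andP[]; lra.
  apply: (ulim_leC (Fb _)); apply: filterE => k.
  by have := F1 k (e j); have := e2 j; rewrite ler_norml => ? /andP[]; lra.
have h1 : 2^-1 <= G y.
  have -> : G y = fulim (fun j => G (e j)) by exact: (yP _ Gd).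
  apply: (ulim_ge Geb); apply: filterE => j.
  by apply: (ulim_ge (Fb _)); apply: filterS (free_ultra_ge j) => k; exact: Fpos.
have h2 : G y <= - 2^-1.
  apply: (ulim_leC (Fb _)); apply: filterE => k.
  have -> : F k y = fulim (fun j => F k (e j)) by exact: (yP _ (Fd k)).
  apply: (ulim_leC (Feb k)).
  by apply: filterS (free_ultra_ge k.+1) => j; exact: Fneg.
lra.
Qed.

End Duality.

Section SplitInequality.
Context {R : realType} {X : normedModType R}.

Lemma norm_is_seminorm : is_seminorm (fun x : X => `|x|).
Proof. by split; [exact: ler_normD|exact: normrZ]. Qed.

Lemma split_sum_le n (x : 'I_n -> X) k : `|split_sum x k| <= \sum_j `|x j|.
Proof.
apply: le_trans (ler_norm_sum _ _ _) _; apply: ler_sum => j _.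
by rewrite normrZ norm_split_sign mul1r.
Qed.

Lemma split_sumZ (V : lmodType R) n (a : R) (x : 'I_n -> V) k :
  split_sum (fun j => a *: x j) k = a *: split_sum x k.
Proof.
rewrite /split_sum scaler_sumr; apply: eq_bigr => j _.
by rewrite !scalerA mulrC.
Qed.

(** Each split_sum y k has norm at most s = sum |y j|, and s <= n+1.  If the
    average of the squares is this close to (n+1)^2, then every split_sum y k
    has norm almost n+1, all |y j| are almost 1, and a functional that norms
    split_sum y k almost norms each of its terms. *)
Let james_of_extremal n (y : 'I_n.+1 -> X) : \sum_j `|y j| ^+ 2 = n.+1%:R ->
  (1 - (32 * n.+1%:R ^+ 2)^-1) * n.+1%:R ^+ 3
    < \sum_k `|split_sum y k| ^+ 2 ->
  exists f, james_seq y f.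
Proof.
set m : R := n.+1%:R => yQ big.
have m1 : 1 <= m by rewrite /m ler1n.
have m0 : m != 0 by rewrite gt_eqF//; lra.
set s := \sum_j `|y j|.
have dev : \sum_j (`|y j| - 1) ^+ 2 = 2 * m - 2 * s.
  under eq_bigr do rewrite sqrrB expr1n mulr1.
  rewrite big_split/= sumrB yQ -mulr_natl.
  under [in X in _ - X]eq_bigr do rewrite -mulr_natl.
  rewrite -mulr_sumr sumr_const card_ord -/s -[X in _ + X]/m; ring.
have dev0 j : (`|y j| - 1) ^+ 2 <= 2 * m - 2 * s.
  rewrite -dev (bigD1 j)//= lerDl; apply: sumr_ge0 => i _; exact: sqr_ge0.
have sm : s <= m.
  have := le_trans (sqr_ge0 _) (dev0 ord0); lra.
have Sk k : m - 32^-1 <= `|split_sum y k|.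
  have le1 i : `|split_sum y i| ^+ 2 <= m ^+ 2.
    rewrite lerXn2r ?nnegrE//.
    exact: le_trans (split_sum_le _ _) sm.
  have : \sum_i `|split_sum y i| ^+ 2 <= `|split_sum y k| ^+ 2 + (m - 1) * m ^+ 2.
    rewrite (bigD1 k)//= lerD2l; apply: le_trans (ler_sum _ _) _ => [i _|].
      exact: le1.
    rewrite sumr_const cardC1 card_ord -[leLHS]mulr_natl ler_wpM2r ?sqr_ge0//.
    by rewrite /m -natr1; lra.
  move=> /(lt_le_trans big).
  have -> : (1 - (32 * m ^+ 2)^-1) * m ^+ 3 = m ^+ 3 - m / 32 by field.
  move=> h; rewrite leNgt; apply/negP => lt.
  have : `|split_sum y k| ^+ 2 <= (m - 32^-1) ^+ 2.
    by rewrite lerXn2r ?nnegrE//; lra.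
  by move: h; nra.
have sm' : m - 32^-1 <= s by exact: le_trans (Sk ord0) (split_sum_le _ _).
have y1 j : 3 / 4 <= `|y j| <= 5 / 4.
  have := dev0 j => h; apply/andP; split; nra.
have [f fP] := choice (fun k => hahn_banach norm_is_seminorm (split_sum y k)).
exists f; split => [k|k|j|k j]; try by case: (fP k).
  by have /andP[] := y1 j; lra.
have [fl f1 fS] := fP k; have := fS.
rewrite (is_linear_sum fl) (bigD1 j)//= (is_linearZ fl) => e.
have : \sum_(i < n.+1 | i != j) f k (split_sign k i *: y i) <= s - `|y j|.
  have -> : s = `|y j| + \sum_(i < n.+1 | i != j) `|y i| by rewrite /s (bigD1 j).
  rewrite addrC addKr; apply: ler_sum => i _.
  apply: le_trans (ler_norm _) _; apply: le_trans (f1 _) _.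
  by rewrite normrZ norm_split_sign mul1r.
by have := Sk k; have /andP[] := y1 j; lra.
Qed.

(** The constant (n+1)^2 would be trivial, by the triangle and Cauchy-Schwarz
    inequalities.  The inequality is stated with squares because it then
    remains true for averages over random x. *)
Lemma split_inequality : superreflexive X ->
  exists (n : nat) (d : R), 0 < d /\ forall x : 'I_n.+1 -> X,
    \sum_k `|split_sum x k| ^+ 2
      <= (1 - d) * n.+1%:R ^+ 2 * \sum_j `|x j| ^+ 2.
Proof.
move=> /no_james_seq[n nJ]; set m : R := n.+1%:R.
have m0 : 0 < m by rewrite /m ltr0n.
exists n, (32 * m ^+ 2)^-1; split; first by rewrite invr_gt0 mulr_gt0 ?exprn_gt0.
move=> x; rewrite leNgt; apply/negP; rewrite -/m => big.
set Q := \sum_j `|x j| ^+ 2 in big.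
have Q0 : 0 <= Q by apply: sumr_ge0 => j _; exact: sqr_ge0.
have {Q0}Q0 : 0 < Q.
  rewrite lt_neqAle Q0 andbT; apply/eqP => e; move: big; rewrite -e mulr0.
  have x0 j : `|x j| = 0.
    have := e; rewrite /Q => /esym/eqP; rewrite psumr_eq0; last first.
      by move=> i _; exact: sqr_ge0.
    by move=> /allP/(_ j (mem_index_enum _)); rewrite /= sqrf_eq0 => /eqP.
  rewrite big1 ?ltxx// => k _.
  have := split_sum_le x k; rewrite big1 => [|j _]; last exact: x0.
  by rewrite normr_le0 => /eqP ->; rewrite normr0 expr0n.
pose a := Num.sqrt (m / Q).
have a2 : a ^+ 2 = m / Q by rewrite sqr_sqrtr// divr_ge0// ltW.
have [||f] := @james_of_extremal n (fun j => a *: x j).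
- under eq_bigr do rewrite normrZ exprMn.
  by rewrite -mulr_sumr real_normK ?num_real// a2 -/Q divfK// gt_eqF.
- under eq_bigr do rewrite split_sumZ normrZ exprMn.
  rewrite -mulr_sumr real_normK ?num_real// a2 -/m.
  have -> : (1 - (32 * m ^+ 2)^-1) * m ^+ 3 =
      m / Q * ((1 - (32 * m ^+ 2)^-1) * m ^+ 2 * Q).
    by field; rewrite !gt_eqF.
  by rewrite ltr_pM2l// divr_gt0.
exact: nJ.
Qed.

End SplitInequality.

(** * Martingales in the unit ball *)

Section Trees.
Context {R : realType} {X : normedModType R}.

Inductive conv_hull (V : lmodType R) (A : set V) : V -> Prop :=
| conv_hull_in x : A x -> conv_hull A x
| conv_hull_conv (l : R) x y : 0 <= l -> l <= 1 ->
    conv_hull A x -> conv_hull A y -> conv_hull A (l *: x + (1 - l) *: y).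

Fixpoint split_set (eps : R) (n : nat) : set X :=
  if n is m.+1 then
    conv_hull [set x | exists a b, [/\ split_set eps m a, split_set eps m b,
      eps <= `|a - b| & x = 2^-1 *: (a + b)]]
  else [set x | `|x| <= 1].

Definition unit_path (z : nat -> X) := forall j, `|z j| <= 1.

Definition path_bounded (H : (nat -> X) -> R) :=
  exists C : R, forall z, unit_path z -> `|H z| <= C.

(** The expectation over the paths of a martingale.  Only this functional is
    kept, and not the probability space, so that limits along ultrafilters can
    be taken. *)
Record is_mean (E : ((nat -> X) -> R) -> R) : Prop := {
  meanD : forall H K, path_bounded H -> path_bounded K ->
    E (fun z => H z + K z) = E H + E K;
  meanZ : forall a H, path_bounded H -> E (fun z => a * H z) = a * E H;
  mean_le : forall H K, path_bounded H -> path_bounded K ->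
    (forall z, unit_path z -> H z <= K z) -> E H <= E K;
  mean1 : E (fun=> 1) = 1 }.

Lemma path_bounded_cst (a : R) : path_bounded (fun=> a).
Proof. by exists `|a|. Qed.

Lemma path_boundedD H K : path_bounded H -> path_bounded K ->
  path_bounded (fun z => H z + K z).
Proof.
move=> [C HC] [D KD]; exists (C + D) => z uz.
by apply: le_trans (ler_normD _ _) _; apply: lerD; [exact: HC|exact: KD].
Qed.

Lemma path_boundedZ (a : R) H : path_bounded H ->
  path_bounded (fun z => a * H z).
Proof.
by move=> [C HC]; exists (`|a| * C) => z uz; rewrite normrM ler_wpM2l// HC.
Qed.

Lemma path_bounded_sqr (A : (nat -> X) -> X) (C : R) :
  (forall z, unit_path z -> `|A z| <= C) ->
  path_bounded (fun z => `|A z| ^+ 2).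
Proof.
move=> AC; exists (C ^+ 2) => z uz.
rewrite ger0_norm ?sqr_ge0// lerXn2r ?nnegrE ?AC//.
exact: le_trans (AC z uz).
Qed.

Lemma mean_cst E (a : R) : is_mean E -> E (fun=> a) = a.
Proof.
move=> mE; have := meanZ mE a (path_bounded_cst 1).
rewrite (mean1 mE) mulr1 => h; rewrite -[RHS]h.
by congr E; apply/funext => z; rewrite mulr1.
Qed.

Lemma mean_leC E H (C : R) : is_mean E -> path_bounded H ->
  (forall z, unit_path z -> H z <= C) -> E H <= C.
Proof.
move=> mE bH HC; rewrite -(mean_cst C mE); apply: mean_le => //.
exact: path_bounded_cst.
Qed.

Lemma mean_geC E H (C : R) : is_mean E -> path_bounded H ->
  (forall z, unit_path z -> C <= H z) -> C <= E H.
Proof.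
move=> mE bH HC; rewrite -(mean_cst C mE); apply: mean_le => //.
exact: path_bounded_cst.
Qed.

Lemma mean_sum E (I : Type) (s : seq I) (H : I -> (nat -> X) -> R) :
  is_mean E -> (forall i, path_bounded (H i)) ->
  path_bounded (fun z => \sum_(i <- s) H i z) /\
  E (fun z => \sum_(i <- s) H i z) = \sum_(i <- s) E (H i).
Proof.
move=> mE bH; elim: s => [|i s [ihb ih]].
  under eq_fun do rewrite big_nil.
  by rewrite big_nil; split; [exact: path_bounded_cst|exact: mean_cst].
under eq_fun do rewrite big_cons.
by rewrite big_cons -ih -meanD//; split => //; exact: path_boundedD.
Qed.

Definition path_comb (c : nat -> R) (m : nat) (z : nat -> X) : X :=
  \sum_(0 <= i < m) c i *: z i.

Lemma path_comb_le c m z : unit_path z ->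
  `|path_comb c m z| <= \sum_(0 <= i < m) `|c i|.
Proof.
move=> uz; apply: le_trans (ler_norm_sum _ _ _) _; apply: ler_sum => i _.
by rewrite normrZ ler_piMr.
Qed.

Lemma path_comb_bounded p c m :
  path_bounded (fun z => `|p + path_comb c m z| ^+ 2).
Proof.
apply: (@path_bounded_sqr _ (`|p| + \sum_(0 <= i < m) `|c i|)) => z uz.
apply: le_trans (ler_normD _ _) _; rewrite lerD2l; exact: path_comb_le.
Qed.

Let path_comb_add0 c m : (fun z => `|0 + path_comb c m z| ^+ 2) =
  (fun z => `|path_comb c m z| ^+ 2).
Proof. by apply/funext => z; rewrite add0r. Qed.

Definition path_cons (a : X) (z : nat -> X) : nat -> X :=
  fun j => if j is i.+1 then z i else a.

Lemma unit_path_cons a z : `|a| <= 1 -> unit_path z -> unit_path (path_cons a z).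
Proof. by move=> a1 uz [|j] /=. Qed.

Lemma path_comb_cons c m a z :
  path_comb c m.+1 (path_cons a z) =
  c 0%N *: a + path_comb (fun i => c i.+1) m z.
Proof. by rewrite /path_comb big_nat_recl. Qed.

Lemma path_bounded_cons a H : `|a| <= 1 -> path_bounded H ->
  path_bounded (fun z => H (path_cons a z)).
Proof. by move=> a1 [C HC]; exists C => z uz; apply/HC/unit_path_cons. Qed.

Lemma is_mean_cons E a : `|a| <= 1 -> is_mean E ->
  is_mean (fun H => E (fun z => H (path_cons a z))).
Proof.
move=> a1 mE; have bc H := @path_bounded_cons a H a1; split.
- by move=> H K bH bK; rewrite -meanD//; exact: bc.
- by move=> b H bH; rewrite -meanZ//; exact: bc.
- move=> H K bH bK HK; apply: mean_le => //; try exact: bc.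
  by move=> z uz; apply: HK; exact: unit_path_cons.
- exact: mean1.
Qed.

Lemma is_mean_conv E1 E2 (l : R) : 0 <= l -> l <= 1 ->
  is_mean E1 -> is_mean E2 -> is_mean (fun H => l * E1 H + (1 - l) * E2 H).
Proof.
move=> l0 l1 m1 m2; split.
- by move=> H K bH bK; rewrite !meanD//; ring.
- by move=> b H bH; rewrite !meanZ//; ring.
- move=> H K bH bK HK; apply: lerD; rewrite ler_wpM2l ?subr_ge0//;
    exact: mean_le.
- by rewrite !mean1//; ring.
Qed.

Lemma sqr_norm_conv (x y : X) (l : R) : 0 <= l -> l <= 1 ->
  `|l *: x + (1 - l) *: y| ^+ 2 <= l * `|x| ^+ 2 + (1 - l) * `|y| ^+ 2.
Proof.
move=> l0 l1; have h : `|l *: x + (1 - l) *: y| <= l * `|x| + (1 - l) * `|y|.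
  apply: le_trans (ler_normD _ _) _; rewrite !normrZ (ger0_norm l0).
  by rewrite ger0_norm// subr_ge0.
have h2 : `|l *: x + (1 - l) *: y| ^+ 2 <= (l * `|x| + (1 - l) * `|y|) ^+ 2.
  by rewrite lerXn2r ?nnegrE// addr_ge0// mulr_ge0// subr_ge0.
apply: le_trans h2 _; rewrite -subr_ge0.
have -> : l * `|x| ^+ 2 + (1 - l) * `|y| ^+ 2 - (l * `|x| + (1 - l) * `|y|) ^+ 2
   = l * (1 - l) * (`|x| - `|y|) ^+ 2 by ring.
by rewrite mulr_ge0 ?sqr_ge0// mulr_ge0// subr_ge0.
Qed.

Lemma split_set_unit eps n x : split_set eps n x -> `|x| <= 1.
Proof.
elim: n x => [//|n ih] x; elim => [_ [a [b [Ka Kb _ ->]]]|l u v l0 l1 _ u1 _ v1].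
  rewrite normrZ gtr0_norm ?invr_gt0//; have := ler_normD a b.
  by have := ih _ Ka; have := ih _ Kb; lra.
apply: le_trans (ler_normD _ _) _; rewrite !normrZ (ger0_norm l0).
by rewrite ger0_norm ?subr_ge0//; nra.
Qed.

(** The derivation of a point of split_set contains a martingale: its paths z go
    through the points from which the combinations are formed.  In terms of
    the increments of z, the sum of c i * z i has the coefficient
    sum_(i >= j) c i at the j-th increment.  The first estimate says that the
    conditional expectation given the starting point is a contraction.  The
    second one says the same of the conditional expectation up to the j-th
    step, where two points at distance eps are reached with equal weights. *)
Lemma split_set_mean eps n x : 0 <= eps -> split_set eps n x ->
  exists E, [/\ is_mean E,
    forall (p : X) (c : nat -> R), `|p + (\sum_(0 <= i < n.+1) c i) *: x| ^+ 2 <=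
      E (fun z => `|p + path_comb c n.+1 z| ^+ 2) &
    forall (p : X) (c : nat -> R) j, (j < n)%N ->
      (\sum_(j <= i < n.+1) c i) ^+ 2 * (eps / 2) ^+ 2 <=
      E (fun z => `|p + path_comb c n.+1 z| ^+ 2)].
Proof.
move=> eps0; elim: n x => [|n ih] x.
  move=> /= x1; exists (fun H => H (fun=> x)); split => //.
    split => // H K _ _; apply; by move=> j.
  by move=> p c; rewrite /path_comb !big_nat1.
elim => [_ [a [b [Ka Kb ab ->]]]|l u v l0 l1 _ [E1 [mE1 E1b E1c]] _ [E2 [mE2 E2b E2c]]].
  have [Ea [mEa Eab Eac]] := ih _ Ka; have [Eb [mEb Ebb Ebc]] := ih _ Kb.
  have a1 := split_set_unit Ka; have b1 := split_set_unit Kb.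
  pose E H := 2^-1 * Ea (fun z => H (path_cons a z)) +
              (1 - 2^-1) * Eb (fun z => H (path_cons b z)).
  have mE : is_mean E.
    by apply: is_mean_conv; try lra; apply: is_mean_cons.
  have EE p c : E (fun z => `|p + path_comb c n.+2 z| ^+ 2) =
      2^-1 * Ea (fun z => `|(p + c 0%N *: a) +
                            path_comb (fun i => c i.+1) n.+1 z| ^+ 2) +
      2^-1 * Eb (fun z => `|(p + c 0%N *: b) +
                            path_comb (fun i => c i.+1) n.+1 z| ^+ 2).
    rewrite /E (_ : 1 - 2^-1 = 2^-1 :> R); last by lra.
    by congr (_ * Ea _ + _ * Eb _); apply/funext => z;
      rewrite path_comb_cons addrA.
  have lowa p c := Eab (p + c 0%N *: a) (fun i => c i.+1).
  have lowb p c := Ebb (p + c 0%N *: b) (fun i => c i.+1).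
  have S0 (c : nat -> R) : \sum_(0 <= i < n.+2) c i =
      c 0%N + \sum_(0 <= i < n.+1) c i.+1 by rewrite big_nat_recl.
  have fold_a (p : X) (c : nat -> R) (y : X) : p + c 0%N *: y + (\sum_(0 <= i < n.+1) c i.+1) *: y =
      p + (\sum_(0 <= i < n.+2) c i) *: y.
    by rewrite (S0 c) scalerDl addrA.
  exists E; split => //.
    move=> p c; rewrite EE; set s := \sum_(0 <= i < n.+2) c i.
    have := lowa p c; have := lowb p c; rewrite !fold_a -/s => h1 h2.
    have := @sqr_norm_conv (p + s *: a) (p + s *: b) 2^-1.
    have -> : 2^-1 *: (p + s *: a) + (1 - 2^-1) *: (p + s *: b) =
        p + s *: (2^-1 *: (a + b)).
      rewrite (_ : 1 - 2^-1 = 2^-1 :> R); last by lra.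
      rewrite -scalerDr addrACA -mulr2n -(scaler_nat 2 p) -(scalerDr s) [LHS]scalerDr.
      by rewrite scalerA mulVf ?pnatr_eq0// scale1r !scalerA mulrC.
    by lra.
  move=> p c [|j] jn; rewrite EE.
    set s := \sum_(0 <= i < n.+2) c i.
    have := lowa p c; have := lowb p c; rewrite !fold_a -/s => h1 h2.
    have h : `|s| * eps <= `|p + s *: a| + `|p + s *: b|.
      apply: (@le_trans _ _ `|s *: (a - b)|); first by rewrite normrZ ler_wpM2l.
      have -> : s *: (a - b) = (p + s *: a) - (p + s *: b).
        by rewrite scalerBr opprD addrACA subrr add0r.
      exact: ler_normB.
    have := normr_ge0 s; have := real_normK (num_real s).
    move: h h1 h2; set A := `|p + _|; set B := `|p + _| => h h1 h2 <- s0.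
    have h3 : (`|s| * eps) ^+ 2 <= (A + B) ^+ 2.
      by rewrite lerXn2r ?nnegrE ?addr_ge0 ?mulr_ge0// /A /B.
    have -> : `|s| ^+ 2 * (eps / 2) ^+ 2 = (`|s| * eps) ^+ 2 / 4 by field.
    have := sqr_ge0 (A - B); lra.
  rewrite big_add1 /= in jn *.
  have := Eac (p + c 0%N *: a) (fun i => c i.+1) j jn.
  have := Ebc (p + c 0%N *: b) (fun i => c i.+1) j jn.
  by lra.
exists (fun H => l * E1 H + (1 - l) * E2 H); split.
- exact: is_mean_conv.
- move=> p c; set s := \sum_(_ <= i < _) c i.
  have -> : p + s *: (l *: u + (1 - l) *: v) =
      l *: (p + s *: u) + (1 - l) *: (p + s *: v).
    rewrite !scalerDr addrACA -scalerDl (addrC l) subrK scale1r.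
    by rewrite !scalerA ![s * _]mulrC.
  apply: le_trans (sqr_norm_conv _ _ l0 l1) _.
  apply: lerD; first by rewrite ler_wpM2l// E1b.
  by rewrite ler_wpM2l ?subr_ge0// E2b.
- move=> p c j jn.
  have h1 := ler_wpM2l l0 (E1c p c j jn).
  have l0' : 0 <= 1 - l by rewrite subr_ge0.
  by have h2 := ler_wpM2l l0' (E2c p c j jn); lra.
Qed.

Lemma limit_mean eps : 0 <= eps -> (forall n, exists x, split_set eps n x) ->
  exists E, is_mean E /\ forall m (c : nat -> R) j,
    (\sum_(j <= i < m) c i) ^+ 2 * (eps / 2) ^+ 2 <=
    E (fun z => `|path_comb c m z| ^+ 2).
Proof.
move=> eps0 hK.
have /choice[E EP] : forall n, exists E, is_mean E /\ forall (c : nat -> R) j, (j < n)%N ->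
      (\sum_(j <= i < n.+1) c i) ^+ 2 * (eps / 2) ^+ 2 <=
      E (fun z => `|path_comb c n.+1 z| ^+ 2).
  move=> n; have [x Kx] := hK n; have [E [mE _ Ec]] := split_set_mean eps0 Kx.
  exists E; split => // c j jn; have := Ec 0 c j jn.
  by rewrite path_comb_add0.
have EC H (C : R) : (forall z, unit_path z -> `|H z| <= C) ->
    \forall n \near free_ultra, `|E n H| <= C.
  move=> HC; apply: filterE => n; have [mE _] := EP n.
  have bH : path_bounded H by exists C.
  rewrite ler_norml; apply/andP; split.
    by apply: mean_geC => // z /HC; rewrite ler_norml => /andP[].
  by apply: mean_leC => // z /HC; rewrite ler_norml => /andP[].
exists (fun H => fulim (fun n => E n H)); split.
  split.
  - move=> H K [C HC] [D KD]; rewrite -(ulimD (EC _ _ HC) (EC _ _ KD)).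
    congr ulim; apply/funext => n; have [mE _] := EP n.
    by rewrite meanD//; [exists C|exists D].
  - move=> a H [C HC]; rewrite -(ulimZ _ (EC _ _ HC)).
    congr ulim; apply/funext => n; have [mE _] := EP n.
    by rewrite meanZ//; exists C.
  - move=> H K [C HC] [D KD] HK; apply: (ulim_le (EC _ _ HC) (EC _ _ KD)).
    apply: filterE => n; have [mE _] := EP n.
    by apply: mean_le => //; [exists C|exists D].
  - rewrite -[RHS](@ulim_cst _ free_ultra); congr ulim; apply/funext => n.
    by have [/mean1] := EP n.
move=> m c j.
have [C HC] : path_bounded (fun z => `|path_comb c m z| ^+ 2).
  have := path_comb_bounded 0 c m.
  by rewrite path_comb_add0.
apply: (ulim_ge (EC _ _ HC)).
near=> n.
have [mE] := EP n.
pose c' i := if (i < m)%N then c i else 0.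
have mn : (m <= n.+1)%N by near: n; apply: filterS (free_ultra_ge m) => n /leqW.
have jn : (j < n)%N by near: n; exact: free_ultra_ge.
move=> /(_ c' j jn).
have e (V : zmodType) (F G : nat -> V) k : (k <= n.+1)%N ->
    (forall i, F i = if (i < m)%N then G i else 0) ->
    \sum_(k <= i < n.+1) F i = \sum_(k <= i < m) G i.
  move=> kn FG; have [km|mk] := leqP k m.
    have F0 : \sum_(m <= i < n.+1) F i = 0.
      by rewrite big_nat big1// => i /andP[mi _]; rewrite FG ltnNge mi.
    rewrite (@big_cat_nat _ _ _ m)//= F0 addr0.
    by apply: eq_big_nat => i /andP[_ im]; rewrite FG im.
  rewrite [RHS]big_geq ?(ltnW mk)// big_nat big1// => i /andP[ki _].
  by rewrite FG ltnNge (leq_trans (ltnW mk) ki).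
rewrite (e _ c' c)//; last by rewrite ltnW// ltnW.
rewrite (_ : (fun z => _) = (fun z => `|path_comb c m z| ^+ 2))//.
apply/funext => z; rewrite /path_comb (e _ _ (fun i => c i *: z i))// => i.
by rewrite /c'; case: ifP => // _; rewrite scale0r.
Unshelve. all: by end_near. Qed.

End Trees.

(** * Spreading a martingale *)

Section Spreading.
Context {R : realType} {X : normedModType R}.
Variable E : (((nat -> X) -> R) -> R).
Hypothesis mE : is_mean E.

(** The coefficients of c are attached to times that go to infinity one after
    the other.  For this reason only their order matters, and zeros can be
    inserted or removed. *)
Fixpoint spread (c : seq R) (A : (nat -> X) -> X) : R :=
  if c is a :: c' then fulim (fun n => spread c' (fun z => A z + a *: z n))
  else E (fun z => `|A z| ^+ 2).

Definition unif_le (C : R) (A : (nat -> X) -> X) :=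
  forall z, unit_path z -> `|A z| <= C.

Lemma unif_le_add C A (a : R) n : unif_le C A ->
  unif_le (C + `|a|) (fun z => A z + a *: z n).
Proof.
move=> AbC z uz; apply: le_trans (ler_normD _ _) _; apply: lerD; first exact: AbC.
by rewrite normrZ ler_piMr.
Qed.

Lemma spread_bound c A C : 0 <= C -> unif_le C A ->
  0 <= spread c A <= (C + \sum_(a <- c) `|a|) ^+ 2.
Proof.
elim: c A C => [|a c ih] A C C0 AbC /=.
  rewrite big_nil addr0; apply/andP; split.
    by apply: mean_geC => //; exact: path_bounded_sqr AbC.
  apply: mean_leC => //; first exact: path_bounded_sqr AbC.
  by move=> z uz; rewrite lerXn2r ?nnegrE ?AbC.
have h n := ih _ _ (addr_ge0 C0 (normr_ge0 a)) (unif_le_add a n AbC).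
have b : \forall n \near free_ultra,
    `|spread c (fun z => A z + a *: z n)| <= (C + `|a| + \sum_(b <- c) `|b|) ^+ 2.
  by apply: filterE => n; have /andP[h1 h2] := h n; rewrite ger0_norm.
rewrite big_cons addrA; apply/andP; split.
  by apply: (ulim_ge b); apply: filterE => n; have /andP[] := h n.
by apply: (ulim_leC b); apply: filterE => n; have /andP[] := h n.
Qed.

Lemma spread_near c (a : R) A C : 0 <= C -> unif_le C A ->
  \forall n \near free_ultra,
    `|spread c (fun z => A z + a *: z n)| <= (C + `|a| + \sum_(b <- c) `|b|) ^+ 2.
Proof.
move=> C0 AbC; apply: filterE => n.
have /andP[h1 h2] := spread_bound c (addr_ge0 C0 (normr_ge0 a)) (unif_le_add a n AbC).
by rewrite ger0_norm.
Qed.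

Lemma spread0 c A : spread (0 :: c) A = spread c A.
Proof.
rewrite /= -[RHS](@ulim_cst _ free_ultra); congr ulim; apply/funext => n.
by congr spread; apply/funext => z; rewrite scale0r addr0.
Qed.

Definition nonzero_part (c : seq R) := [seq a <- c | a != 0].

Lemma spread_nonzero c A : spread (nonzero_part c) A = spread c A.
Proof.
elim: c A => [//|a c ih] A; rewrite /nonzero_part /=.
case: eqVneq => [->|_].
  by rewrite -[RHS]/(spread (0 :: c) A) spread0 ih.
by congr ulim; apply/funext => n; exact: ih.
Qed.

Lemma spread_scale (s : R) c A C : 0 <= C -> unif_le C A ->
  spread [seq s * a | a <- c] (fun z => s *: A z) = s ^+ 2 * spread c A.
Proof.
elim: c A C => [|a c ih] A C C0 AbC /=.
  rewrite -(meanZ mE); last exact: path_bounded_sqr AbC.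
  congr E; apply/funext => z; rewrite normrZ exprMn real_normK//.
  exact: num_real.
rewrite -(ulimZ _ (spread_near c a C0 AbC)); congr ulim; apply/funext => n.
rewrite -(ih _ _ (addr_ge0 C0 (normr_ge0 a)) (unif_le_add a n AbC)).
by congr spread; apply/funext => z; rewrite scalerDr scalerA.
Qed.

(** The new times are eventually later than everything in the support of g, so
    the coefficients in c count in full for the tail that starts at j. *)
Lemma spread_tail (kappa : R) (g : nat -> R) m j c :
  (forall m (c : nat -> R) j, (\sum_(j <= i < m) c i) ^+ 2 * kappa <=
     E (fun z => `|path_comb c m z| ^+ 2)) ->
  (\sum_(j <= i < m) g i + \sum_(a <- c) a) ^+ 2 * kappa <=
  spread c (path_comb g m).
Proof.
move=> Ek; elim: c m g => [|a c ih] m g /=; first by rewrite big_nil addr0.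
pose C := \sum_(0 <= i < m) `|g i|.
have C0 : 0 <= C by exact: sumr_ge0.
have gC : unif_le C (path_comb g m) by move=> z; exact: path_comb_le.
apply: (ulim_ge (spread_near c a C0 gC)).
apply: filterS2 (free_ultra_ge m) (free_ultra_ge j) => n mn jn.
pose g' i := if (i < m)%N then g i else if i == n then a else 0.
have key (V : zmodType) (F G : nat -> V) k : (k <= n)%N ->
    (forall i, F i = if (i < m)%N then G i else if i == n then F n else 0) ->
    \sum_(k <= i < n.+1) F i = \sum_(k <= i < m) G i + F n.
  move=> kn FG; rewrite big_nat_recr//=; congr (_ + _).
  have [km|mk] := leqP k m.
    have F0 : \sum_(m <= i < n) F i = 0.
      rewrite big_nat big1// => i /andP[mi ni].
      by rewrite FG ltnNge mi /= ltn_eqF.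
    rewrite (@big_cat_nat _ _ _ m)//= F0 addr0.
    by apply: eq_big_nat => i /andP[_ im]; rewrite FG im.
  rewrite [RHS]big_geq ?(ltnW mk)// big_nat big1// => i /andP[ki ni].
  by rewrite FG ltnNge (leq_trans (ltnW mk) ki) /= ltn_eqF.
have gn : g' n = a by rewrite /g' ltnNge mn eqxx.
have -> : (fun z : nat -> X => path_comb g m z + a *: z n) = path_comb g' n.+1.
  apply/funext => z; rewrite /path_comb.
  rewrite (key _ (fun i => g' i *: z i) (fun i => g i *: z i))//.
    by congr (_ + _); rewrite gn.
  move=> i; rewrite {1}/g'; case: ifP => // _; case: eqVneq => [->|_].
    by rewrite gn.
  by rewrite scale0r.
by have := ih n.+1 g'; rewrite (key _ g' g)// ?gn ?big_cons ?addrA.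
Qed.

Lemma spread_cat_tail (kappa : R) (g : nat -> R) m c1 c2 :
  (forall m (c : nat -> R) j, (\sum_(j <= i < m) c i) ^+ 2 * kappa <=
     E (fun z => `|path_comb c m z| ^+ 2)) ->
  (\sum_(a <- c2) a) ^+ 2 * kappa <= spread (c1 ++ c2) (path_comb g m).
Proof.
move=> Ek; elim: c1 m g => [|a c ih] m g /=.
  by have := spread_tail g m m c2 Ek; rewrite big_geq// add0r.
pose C := \sum_(0 <= i < m) `|g i|.
have C0 : 0 <= C by exact: sumr_ge0.
have gC : unif_le C (path_comb g m) by move=> z; exact: path_comb_le.
apply: (ulim_ge (spread_near (c ++ c2) a C0 gC)).
apply: filterS (free_ultra_ge m) => n mn.
pose g' i := if (i < m)%N then g i else if i == n then a else 0.
suff -> : (fun z : nat -> X => path_comb g m z + a *: z n) = path_comb g' n.+1 by [].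
apply/funext => z; rewrite /path_comb big_nat_recr//=.
congr (_ + _); last by rewrite /g' ltnNge mn eqxx.
rewrite (@big_cat_nat _ _ _ m 0 n)//= [X in _ + X]big_nat [X in _ + X]big1.
  by rewrite addr0; apply: eq_big_nat => i /andP[_ im]; rewrite /g' im.
by move=> i /andP[mi ni]; rewrite /g' ltnNge mi /= ltn_eqF ?scale0r.
Qed.

Section SplitSpread.
Variables (n : nat) (d : R).
Hypothesis splitX : forall x : 'I_n.+1 -> X,
  \sum_k `|split_sum x k| ^+ 2
    <= (1 - d) * n.+1%:R ^+ 2 * \sum_j `|x j| ^+ 2.

Lemma split_sumD (V : lmodType R) m (x y : 'I_m -> V) k :
  split_sum (fun j => x j + y j) k = split_sum x k + split_sum y k.
Proof.
by rewrite /split_sum -big_split/=; apply: eq_bigr => j _; rewrite scalerDr.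
Qed.

Lemma split_sum_scalar (V : lmodType R) m (v : 'I_m -> R) (x : V) k :
  split_sum (fun j => v j *: x) k = split_sum (v : 'I_m -> R^o) k *: x.
Proof.
by rewrite /split_sum scaler_suml; apply: eq_bigr => j _; rewrite scalerA.
Qed.

(** The inequality in X holds pointwise on the paths, and all its terms pass to
    expectations and to limits. *)
Lemma spread_split (C : seq ('I_n.+1 -> R)) (A : 'I_n.+1 -> (nat -> X) -> X) B :
  0 <= B -> (forall j, unif_le B (A j)) ->
  \sum_k spread [seq split_sum (v : 'I_n.+1 -> R^o) k | v <- C]
      (fun z => split_sum (A^~ z) k) <=
  (1 - d) * n.+1%:R ^+ 2 * \sum_j spread [seq v j | v <- C] (A j).
Proof.
have splitB k (A' : 'I_n.+1 -> (nat -> X) -> X) B' :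
    (forall j, unif_le B' (A' j)) ->
    unif_le (n.+1%:R * B') (fun z => split_sum (A'^~ z) k).
  move=> AB z uz; apply: le_trans (split_sum_le _ _) _.
  apply: le_trans (ler_sum _ (fun j _ => AB j z uz)) _.
  by rewrite sumr_const card_ord mulr_natl.
elim: C A B => [|v C ih] A B B0 AB /=.
  have bd j : path_bounded (fun z => `|A j z| ^+ 2) by exact: path_bounded_sqr (AB j).
  have bs k : path_bounded (fun z => `|split_sum (A^~ z) k| ^+ 2).
    exact: path_bounded_sqr (splitB k A B AB).
  have [b1 <-] := mean_sum (index_enum _) mE bs.
  have [b2 <-] := mean_sum (index_enum _) mE bd.
  rewrite -(meanZ mE _ b2); apply: mean_le => //; first exact: path_boundedZ.
pose w := \sum_j `|v j|.
have vw j : `|v j| <= w by rewrite /w (bigD1 j)//= lerDl sumr_ge0.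
have w0 : 0 <= w by exact: sumr_ge0.
have AB' m j : unif_le (B + w) (fun z => A j z + v j *: z m).
  move=> z uz; apply: le_trans (unif_le_add (v j) m (AB j) uz) _.
  by rewrite lerD2l.
have SB k := splitB k A B AB.
have nB0 : 0 <= n.+1%:R * B by rewrite mulr_ge0.
have nearL k := spread_near [seq split_sum (v : 'I_n.+1 -> R^o) k | v <- C]
   (split_sum (v : 'I_n.+1 -> R^o) k) nB0 (SB k).
have nearR j := spread_near [seq v j | v <- C] (v j) B0 (AB j).
rewrite -(ulim_sum (index_enum _) nearL) -(ulim_sum (index_enum _) nearR).
have sumb (I : finType) (f : I -> nat -> R) (D : I -> R) :
    (forall i, \forall n \near free_ultra, `|f i n| <= D i) ->
    \forall n \near free_ultra, `|\sum_i f i n| <= \sum_i D i.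
  move=> fD; have : \forall n \near free_ultra, forall i, `|f i n| <= D i.
    by apply: filter_forall.
  apply: filterS => k fk; apply: le_trans (ler_norm_sum _ _ _) _.
  by apply: ler_sum => i _.
have nL := sumb _ _ _ nearL; have nR := sumb _ _ _ nearR.
rewrite -(ulimZ _ nR).
apply: (ulim_le nL (D := `|(1 - d) * n.+1%:R ^+ 2| * _)).
  by apply: filterS nR => m; rewrite normrM => h; apply: ler_wpM2l h.
apply: filterE => m.
apply: le_trans (ih _ (B + w) (addr_ge0 B0 w0) (AB' m)).
rewrite le_eqVlt; apply/orP; left; apply/eqP; apply: eq_bigr => k _.
congr spread; apply/funext => z; rewrite split_sumD; congr (_ + _).
by rewrite split_sum_scalar.
Qed.

End SplitSpread.

End Spreading.

(** * Alternating combinations *)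

Section Alternation.
Context {R : realType}.
Implicit Types (h : R) (c : seq R).

Local Notation total c := (\sum_(a <- c) a).

(** The sums of m successively shorter tails of c are h, - h, h, and so on.  The
    sum of a tail is the coefficient of one martingale increment. *)
Fixpoint alternating (m : nat) h c : Prop :=
  if m is m'.+1 then
    exists c1 c2, [/\ c = c1 ++ c2, total c2 = h & alternating m' (- h) c2]
  else True.

Lemma alternating_cat m h c1 c2 : alternating m h c2 ->
  alternating m h (c1 ++ c2).
Proof.
case: m => [//|m] [d1 [d2 [-> e a]]].
by exists (c1 ++ d1), d2; rewrite catA.
Qed.

Lemma alternating_scale (s : R) m h c : alternating m h c ->
  alternating m (s * h) [seq s * a | a <- c].
Proof.
elim: m h c => [//|m ih] h c [d1 [d2 [-> e a]]].
exists [seq s * a | a <- d1], [seq s * a | a <- d2]; split.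
- by rewrite map_cat.
- by rewrite big_map -mulr_sumr e.
- by rewrite -mulrN; exact: ih.
Qed.

Lemma alternating_exists m h : exists c,
  [/\ alternating m h c, total c = (if m is 0%N then 0 else h) &
      \sum_(a <- c) `|a| <= 2 * m%:R * `|h| ].
Proof.
elim: m h => [|m ih] h.
  by exists [::]; rewrite !big_nil mulr0 mul0r.
have [c [ac cs cn]] := ih (- h).
exists ((h - total c) :: c); split.
- exists [::], ((h - total c) :: c); split => //.
    by rewrite big_cons subrK.
  exact: (@alternating_cat _ _ [:: h - total c]).
- by rewrite big_cons subrK.
rewrite big_cons; have : `|h - total c| <= 2 * `|h|.
  apply: le_trans (ler_normB _ _) _; rewrite mulr_natl mulr2n lerD2l cs.
  by case: (m); rewrite ?normr0 ?normrN.
by move: cn; rewrite normrN -natr1; lra.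
Qed.

Variable n : nat.
Implicit Types C : seq ('I_n.+1 -> R).

Local Notation split C k := [seq split_sum (v : 'I_n.+1 -> R^o) k | v <- C].

Definition copies (s : seq nat) c : seq ('I_n.+1 -> R) :=
  flatten [seq [seq (fun j : 'I_n.+1 => if (j : nat) == i then a else 0)
                   | a <- c] | i <- s].

Lemma nonzero_part_cat c c' :
  nonzero_part (c ++ c') = nonzero_part c ++ nonzero_part c'.
Proof. exact: filter_cat. Qed.

Let nonzero_part0 c : nonzero_part [seq (0 : R) | _ <- c] = [::].
Proof. by elim: c => [//|a c ih]; rewrite /nonzero_part /= eqxx. Qed.

Lemma copies_cons i s c : copies (i :: s) c =
  [seq (fun j : 'I_n.+1 => if (j : nat) == i then a else 0) | a <- c] ++
  copies s c.
Proof. by []. Qed.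

Lemma copies_cat s t c : copies (s ++ t) c = copies s c ++ copies t c.
Proof. by rewrite /copies map_cat flatten_cat. Qed.

Lemma copies_nonzero s c (j : 'I_n.+1) : uniq s -> (j : nat) \in s ->
  nonzero_part [seq v j | v <- copies s c] = nonzero_part c.
Proof.
have zero t : (j : nat) \notin t ->
    nonzero_part [seq v j | v <- copies t c] = [::].
  elim: t => [//|x t iht] /=; rewrite in_cons negb_or => /andP[jx jt].
  rewrite copies_cons map_cat nonzero_part_cat iht// cats0 -map_comp.
  by rewrite -(nonzero_part0 c) /comp /= (negbTE jx).
elim: s => [//|i s ih] /= /andP[ins us].
rewrite in_cons copies_cons map_cat nonzero_part_cat -map_comp /comp /=.
case: eqVneq => [ji _|ji /= js]; last by rewrite nonzero_part0 ih.
by rewrite zero ?ji// cats0 map_id.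
Qed.

Lemma split_copies_total s c (k : 'I_n.+1) : all (fun i => i <= k)%N s ->
  total (split (copies s c) k) = (size s)%:R * total c.
Proof.
rewrite /copies; elim: s => [|i s ih] /=; first by rewrite big_nil mul0r.
move=> /andP[ik sk]; rewrite map_cat big_cat/= ih// -natr1 mulrDl mul1r addrC.
congr (_ + _); rewrite -map_comp big_map; apply: eq_bigr => a _ /=.
have ilt : (i < n.+1)%N by rewrite (leq_ltn_trans ik).
rewrite /split_sum (bigD1 (Ordinal ilt))//= eqxx big1 ?addr0.
  by rewrite /split_sign /= ik scale1r.
move=> j /eqP ji; case: eqVneq => [e|_]; last by rewrite scaler0.
by exfalso; apply: ji; apply: val_inj.
Qed.

Lemma nonzero_total c c' : nonzero_part c = nonzero_part c' ->
  total c = total c'.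
Proof.
have h (d : seq R) : total (nonzero_part d) = total d.
  rewrite /nonzero_part big_filter [RHS](bigID (fun a => a == 0))/=.
  by rewrite [X in _ = X + _]big1 ?add0r// => a /eqP.
by rewrite -(h c) -(h c') => ->.
Qed.

Lemma split_sign_total (k : 'I_n.+1) :
  \sum_j split_sign k j = k.+1%:R - (n - k)%:R :> R.
Proof.
pose f (i : nat) : R := if (i <= k)%N then 1 else -1.
rewrite -[LHS](big_mkord xpredT f) (@big_cat_nat _ _ _ k.+1)//=.
rewrite (eq_big_nat _ _ (F2 := fun=> 1)) => [|i /andP[_]]; last first.
  by rewrite ltnS /f => ->.
rewrite [X in _ + X](eq_big_nat _ _ (F2 := fun=> -1)) => [|i /andP[ki _]].
  by rewrite !sumr_const_nat subn0 subSS mulNrn.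
by rewrite /f leqNgt ki.
Qed.

Lemma split_total C c (k : 'I_n.+1) :
  (forall j, nonzero_part [seq v j | v <- C] = nonzero_part c) ->
  total (split C k) = (k.+1%:R - (n - k)%:R) * total c.
Proof.
move=> Cc; rewrite big_map exchange_big/= -split_sign_total mulr_suml.
apply: eq_bigr => j _; rewrite -scaler_sumr.
by rewrite -(nonzero_total (Cc j)) big_map.
Qed.

Let order := rev (iota 0 n.+1).

Let order_in (j : 'I_n.+1) : (j : nat) \in order.
Proof. by rewrite mem_rev mem_iota add0n ltn_ord. Qed.

Let order_uniq : uniq order.
Proof. by rewrite rev_uniq iota_uniq. Qed.

(** Within each block of c the copies are placed in decreasing order.  Cut the
    i-th block between the copies after k and those up to k: the tail starting
    there contains the i-th and later blocks of the copies up to k, and only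
    the (i+1)-st and later blocks of the copies after k.  The latter have tails
    of the opposite sum, but they enter the split sum with the opposite sign, so
    that all contributions add up. *)
Lemma interlaced_aux m h c : alternating m (- h) c -> total c = h ->
  exists C, (forall j, nonzero_part [seq v j | v <- C] = nonzero_part c) /\
    forall k, alternating m (n.+1%:R * h) (split C k).
Proof.
elim: m h c => [|m ih] h c.
  by move=> _ _; exists (copies order c); split => // j; exact: copies_nonzero.
move=> [c1 [c3 [-> c3h a]]] ch.
have [C3 [C3c C3a]] := ih _ _ a c3h.
exists (copies order c1 ++ C3); split => [j|k].
  by rewrite map_cat !nonzero_part_cat C3c copies_nonzero.
have -> : order = rev (iota k.+1 (n - k)) ++ rev (iota 0 k.+1).
  rewrite -rev_cat; congr rev; rewrite -(iotaD 0).
  by rewrite addSn subnKC// -ltnS.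
have low : all (fun i => i <= k)%N (rev (iota 0 k.+1)).
  by rewrite all_rev; apply/allP => i; rewrite mem_iota add0n ltnS.
have size_low : size (rev (iota 0 k.+1)) = k.+1 by rewrite size_rev size_iota.
move: (rev (iota 0 k.+1)) low size_low => lo low size_low.
rewrite copies_cat !map_cat -catA.
exists (split (copies (rev (iota k.+1 (n - k))) c1) k),
  (split (copies lo c1) k ++ split C3 k); split => //.
  rewrite big_cat/= split_copies_total// size_low (split_total k C3c) c3h.
  move: ch; rewrite big_cat/= c3h => ch.
  have -> : total c1 = 2 * h by lra.
  have -> : (n - k)%:R = n.+1%:R - k.+1%:R :> R.
    by rewrite -natrB ?ltn_ord// subSS.
  ring.
by rewrite -mulrN; apply: alternating_cat; exact: C3a.
Qed.

Lemma interlaced m h c : alternating m.+1 h c ->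
  exists C, (forall j, nonzero_part [seq v j | v <- C] = nonzero_part c) /\
    forall k, alternating m (n.+1%:R * h) (split C k).
Proof.
move=> [c1 [c2 [-> c2h a]]]; have [C [Cc Ca]] := interlaced_aux a c2h.
exists (copies order c1 ++ C); split => [j|k].
  by rewrite map_cat !nonzero_part_cat Cc copies_nonzero.
by rewrite map_cat; apply: alternating_cat; exact: Ca.
Qed.

End Alternation.

Section Ratio.
Context {R : realType} {X : normedModType R}.

Let zero_comb : (fun z : nat -> X => 0) = path_comb (fun=> 0) 0.
Proof. by apply/funext => z; rewrite /path_comb big_geq. Qed.

(** By Bernoulli's inequality (1 + d) ^+ (3 * m) is at least (m * d) ^+ 3, which
    outgrows every quadratic function of m. *)
Let growth_contra (k : nat -> R) (kappa d : R) : 0 < kappa -> 0 < d ->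
  (forall m, kappa <= k m.+1) -> (forall m, k m.+1 <= (1 - d) * k m.+2) ->
  ~ (forall m, k m.+1 <= 4 * m.+1%:R ^+ 2).
Proof.
move=> kp d0 kl kr ku.
have d1 : d < 1.
  have := kr 0%N; have := kl 0%N; have := kl 1%N => h1 h2 h3.
  rewrite ltNge; apply/negP => d1.
  have : (1 - d) * k 2%N <= 0 by rewrite mulr_le0_ge0 ?subr_le0//; lra.
  lra.
have grow m : kappa * (1 + d) ^+ m <= k m.+1.
  elim: m => [|m ih]; first by rewrite mulr1.
  have k0 : 0 <= k m.+2 by have := kl m.+1; lra.
  rewrite exprS mulrCA; apply: le_trans (ler_wpM2l _ ih) _; first by lra.
  apply: le_trans (ler_wpM2l _ (kr m)) _; first by lra.
  rewrite mulrA ler_piMl//; nra.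
have bern m : 1 + m%:R * d <= (1 + d) ^+ m.
  elim: m => [|m ih]; first by rewrite mul0r addr0.
  rewrite exprS -natr1; apply: le_trans (ler_wpM2l _ ih); last by lra.
  by have : 0 <= m%:R :> R by []; nra.
have [N NP] : exists N : nat, 64 / (kappa * d ^+ 3) < N.+1%:R :> R.
  have := archi_boundP (_ : 0 <= 64 / (kappa * d ^+ 3)).
  rewrite divr_ge0 ?mulr_ge0 ?exprn_ge0 ?(ltW kp) ?(ltW d0)// => /(_ isT) h.
  exists (Num.bound (64 / (kappa * d ^+ 3))).
  by apply: lt_le_trans h _; rewrite ler_nat.
set x : R := N.+1%:R in NP; have x1 : 1 <= x by rewrite /x ler1n.
have := le_trans (grow (3 * N.+1)%N) (ku _); rewrite mulnC exprM.
have b := bern N.+1; rewrite -/x in b.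
have : (x * d) ^+ 3 <= ((1 + d) ^+ N.+1) ^+ 3.
  have xd : 0 <= x * d by rewrite mulr_ge0//; lra.
  by rewrite lerXn2r ?nnegrE ?exprn_ge0//; lra.
have -> : (N.+1 * 3).+1%:R = x * 3 + 1 by rewrite -[LHS]natr1 natrM.
move=> h1 h2.
have : kappa * (x * d) ^+ 3 <= 4 * (x * 3 + 1) ^+ 2.
  by apply: le_trans h2; rewrite ler_pM2l.
have : 4 * (x * 3 + 1) ^+ 2 <= 64 * x ^+ 2 by nra.
move=> h3 h4; have := le_trans h4 h3.
have x2 : 0 < x ^+ 2 by rewrite exprn_gt0; lra.
have -> : kappa * (x * d) ^+ 3 = (x * (kappa * d ^+ 3)) * x ^+ 2 by ring.
rewrite ler_pM2r//; move: NP; rewrite ltr_pdivrMr; first by lra.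
by rewrite mulr_gt0// exprn_gt0.
Qed.

(** Here k m is the infimum of the squared spread norms of the m times
    alternating sequences.  Interlaced copies of an m+1 times alternating c have
    the same spread norm as c, and their split sums alternate m times with
    height n+1; so the averaged inequality gives k m <= (1 - d) * k m.+1. *)
Lemma split_set_empty (eps : R) : superreflexive X -> 0 < eps ->
  exists n, forall x : X, ~ split_set eps n x.
Proof.
move=> srX eps0; apply: contrapT => /forallNP hn.
have [|E [mE Ek]] := @limit_mean R X _ (ltW eps0).
  by move=> n; have /existsNP[x /contrapT] := hn n; exists x.
have [n [d [d0 splitX]]] := split_inequality srX.
pose kappa := (eps / 2) ^+ 2.
have kp : 0 < kappa by rewrite exprn_gt0// divr_gt0.
pose A0 : (nat -> X) -> X := fun=> 0.
have A0le : unif_le 0 A0 by move=> z _; rewrite normr0.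
pose S m := [set spread E c A0 | c in alternating m (1 : R)].
pose k m := inf (S m).
have Slow m : lbound (S m.+1) kappa.
  move=> _ [c [c1 [c2 [-> c2s _]]] <-].
  rewrite /A0 zero_comb.
  have := spread_cat_tail mE (fun=> 0) 0 c1 c2 Ek.
  by rewrite c2s expr1n mul1r.
have Sne m : S m.+1 !=set0.
  by have [c [ac _ _]] := @alternating_exists R m.+1 1; exists (spread E c A0), c.
apply: (@growth_contra k kappa d) => // m.
- exact: lb_le_inf.
-   have key c : alternating m.+2 (1 : R) c -> k m.+1 <= (1 - d) * spread E c A0.
    move=> /(interlaced n)[C [Cc Ca]].
    have := spread_split mE splitX C (lexx 0) (fun=> A0le).
    under eq_bigr => i _.
      rewrite (_ : (fun z => split_sum ((fun _ : 'I_n.+1 => A0)^~ z) i) = A0).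
        over.
      by apply/funext => z; rewrite /split_sum big1// => j _; rewrite scaler0.
    under [in X in _ <= X]eq_bigr => i _.
      rewrite -(spread_nonzero E) Cc (spread_nonzero E); over.
    rewrite sumr_const card_ord -[_ *+ n.+1]mulr_natl => h.
    have n0 : 0 < n.+1%:R :> R by rewrite ltr0n.
    have low i : n.+1%:R ^+ 2 * k m.+1 <=
        spread E [seq split_sum (v : 'I_n.+1 -> R^o) i | v <- C] A0.
      rewrite mulrC -ler_pdivlMr ?exprn_gt0// mulrC -exprVn.
      rewrite -(spread_scale mE _ _ (lexx 0) A0le).
      rewrite (_ : (fun z => _ *: A0 z) = A0); last first.
        by apply/funext => z; rewrite scaler0.
      apply: ge_inf; first by exists kappa; exact: Slow.
      exists [seq n.+1%:R^-1 * a | a <- [seq split_sum (v : 'I_n.+1 -> R^o) i | v <- C]] => //.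
      have := alternating_scale n.+1%:R^-1 (Ca i).
      by rewrite mulr1 mulVf// gt_eqF.
    have := le_trans (ler_sum _ (fun i _ => low i)) h.
    rewrite sumr_const card_ord -[leLHS]mulr_natl => h'.
    rewrite -(ler_pM2l (exprn_gt0 3 n0)).
    by apply: le_trans (le_trans _ h') _; rewrite le_eqVlt; apply/orP; left;
      apply/eqP; ring.
  have d1 : d < 1.
    have [c [ac _ _]] := @alternating_exists R m.+2 1.
    have k0 : kappa <= k m.+1 by exact: lb_le_inf.
    have /andP[s0 _] := spread_bound mE c (lexx 0) A0le.
    have := key _ ac; rewrite ltNge => h; apply/negP => d1.
    have : (1 - d) * spread E c A0 <= 0 by rewrite mulr_le0_ge0 ?subr_le0.
    lra.
  rewrite -ler_pdivrMl ?subr_gt0//; apply: lb_le_inf => // _ [c ac <-].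
  by rewrite ler_pdivrMl ?subr_gt0//; exact: key.
- have [c [ac _ cn]] := @alternating_exists R m.+1 1.
  apply: (@le_trans _ _ (spread E c A0)).
    by apply: ge_inf; [exists kappa; exact: Slow|exists c].
  have /andP[_] := spread_bound mE c (lexx 0) A0le.
  move=> /le_trans; apply; rewrite add0r.
  have -> : 4 * m.+1%:R ^+ 2 = (2 * m.+1%:R * `|1|) ^+ 2 :> R.
    by rewrite normr1; ring.
  by rewrite lerXn2r ?nnegrE ?mulr_ge0 ?sumr_ge0.
Qed.

End Ratio.

(** * Rotundity of gauges *)

Section QuadraticRotundity.
Context {R : realType} {X : lmodType R}.
Implicit Types q : X -> R.

(** For norms this is uniform rotundity.  The parallelogram defect is additive
    in q ^+ 2, whence the stability of this form of the notion. *)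
Definition quad_rotund q := forall e : R, 0 < e -> exists2 d, 0 < d &
  forall x y, q x <= 1 -> q y <= 1 ->
    2 * q x ^+ 2 + 2 * q y ^+ 2 - q (x + y) ^+ 2 <= d -> q (x - y) <= e.

Lemma seminormBC q x y : is_seminorm q -> q (x - y) = q (y - x).
Proof. by move=> qS; rewrite -opprB seminormN. Qed.

(** A small defect forces q x and q y to be almost equal.  If they are small,
    so is q (x - y); otherwise rescale to q x = 1, where with s = q (x + y) and
    q y >= s - 1 the defect is at least (2 - s)^2. *)
Lemma ball_quad_rotund q : is_seminorm q ->
  (forall e : R, 0 < e -> exists2 t, 0 < t & forall x y, q x <= 1 -> q y <= 1 ->
    1 - t <= q (2^-1 *: (x + y)) -> q (x - y) <= e) -> quad_rotund q.
Proof.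
move=> qS qU e e0; have [t t0 tP] := qU e e0.
have [qD qZ] := qS; have q0 := seminorm_ge0 qS.
pose d' := Num.min ((2 * t) ^+ 2) 2^-1.
have d'0 : 0 < d' by rewrite lt_min exprn_gt0 ?mulr_gt0//=; lra.
have d't : d' <= (2 * t) ^+ 2 by rewrite ge_min lexx.
have d'1 : d' <= 2^-1 by rewrite ge_min lexx orbT.
exists (d' * e ^+ 2 / 4); first by rewrite divr_gt0 ?mulr_gt0 ?exprn_gt0.
suff key x y : q x <= 1 -> q y <= q x ->
    2 * q x ^+ 2 + 2 * q y ^+ 2 - q (x + y) ^+ 2 <= d' * e ^+ 2 / 4 ->
    q (x - y) <= e.
  move=> x y x1 y1; have [yx|/ltW xy] := leP (q y) (q x); first exact: key.
  move=> h; rewrite seminormBC//; apply: key => //.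
  by rewrite [2 * _ + _]addrC (addrC y).
move=> x1 yx h; have [re|re] := leP (q x) (e / 2).
  by apply: le_trans (seminormB qS _ _) _; lra.
set r := q x in x1 yx h re; have r0 : 0 < r by lra.
have rI : 0 < r^-1 by rewrite invr_gt0.
have qr v : q (r^-1 *: v) = q v / r by rewrite qZ gtr0_norm// mulrC.
have ux : q (r^-1 *: x) = 1 by rewrite qr divff// gt_eqF.
have uy : q (r^-1 *: y) <= 1 by rewrite qr ler_pdivrMr// mul1r.
set s := q (x + y) / r.
have s0 : 0 <= s by rewrite divr_ge0// ltW.
have ys : s - 1 <= q y / r.
  have : s <= (r + q y) / r by rewrite ler_pM2r// qD.
  by rewrite mulrDl divff ?gt_eqF//; lra.
have h' : 2 + 2 * (q y / r) ^+ 2 - s ^+ 2 <= d'.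
  have : (2 * r ^+ 2 + 2 * q y ^+ 2 - q (x + y) ^+ 2) / r ^+ 2 <=
      (d' * e ^+ 2 / 4) / r ^+ 2 by rewrite ler_pM2r// invr_gt0 exprn_gt0.
  have -> : (2 * r ^+ 2 + 2 * q y ^+ 2 - q (x + y) ^+ 2) / r ^+ 2 =
      2 + 2 * (q y / r) ^+ 2 - s ^+ 2 by rewrite /s; field; rewrite gt_eqF.
  move=> /le_trans; apply; rewrite ler_pdivrMr ?exprn_gt0//.
  have -> : d' * e ^+ 2 / 4 = d' * (e / 2) ^+ 2 by field.
  by rewrite ler_pM2l// lerXn2r ?nnegrE; lra.
have s1 : 1 <= s.
  rewrite leNgt; apply/negP => s1; have := sqr_ge0 (q y / r).
  have : s ^+ 2 <= 1 by rewrite expr_le1// ltW.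
  lra.
have st : 2 - s <= 2 * t.
  have : (s - 1) ^+ 2 <= (q y / r) ^+ 2.
    by rewrite lerXn2r ?nnegrE//; [lra|rewrite divr_ge0// ltW].
  move=> ys2; have h2 : (2 - s) ^+ 2 <= (2 * t) ^+ 2 by nra.
  rewrite leNgt; apply/negP => lt; move: h2; rewrite leNgt => /negP; apply.
  by rewrite ltr_pXn2r ?nnegrE//; lra.
have : q (r^-1 *: x - r^-1 *: y) <= e.
  apply: tP => //; first by rewrite ux.
  rewrite -scalerDr qZ gtr0_norm ?invr_gt0// qr -/s; lra.
rewrite -scalerBr qr ler_pdivrMr// => /le_trans; apply.
by rewrite ler_piMr// ltW.
Qed.

End QuadraticRotundity.

(** The functions h k are going to be the distances to the sets of points that
    split many times. *)
Section ConvexSum.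
Context {R : realType} {X : normedModType R}.
Variable h : nat -> X -> R.
Hypothesis h_ge0 : forall k x, 0 <= h k x.
Hypothesis h_le : forall k x, h k x <= `|x|.
Hypothesis h_conv : forall k (l : R) x y, 0 <= l -> l <= 1 ->
  h k (l *: x + (1 - l) *: y) <= l * h k x + (1 - l) * h k y.
Hypothesis h_even : forall k x, h k (- x) = h k x.
Hypothesis h_lip : forall k x y, h k x - h k y <= `|x - y|.
Hypothesis h_rotund : forall e : R, 0 < e -> exists N (d : R), 0 < d /\
  forall x y, `|x| <= 1 -> `|y| <= 1 ->
    (forall k, (k < N)%N -> 2 * h k x ^+ 2 + 2 * h k y ^+ 2
       - 4 * h k (2^-1 *: (x + y)) ^+ 2 <= d) -> `|x - y| <= e.

Let T (H : nat -> R) n : R := \sum_(0 <= k < n) 2^-1 ^+ k.+1 * H k.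

Let w0 k : 0 < 2^-1 ^+ k.+1 :> R.
Proof. by rewrite exprn_gt0// invr_gt0. Qed.

Let T_le (H : nat -> R) (C : R) n : (forall k, H k <= C) -> 0 <= C ->
  T H n <= C.
Proof.
move=> HC C0; apply: (@le_trans _ _ (C * (1 - 2^-1 ^+ n))); last first.
  by rewrite ler_piMr// lerBlDr lerDl exprn_ge0// invr_ge0.
rewrite /T; elim: n => [|n ih]; first by rewrite big_geq// expr0 subrr mulr0.
rewrite big_nat_recr//=; have := ler_wpM2l (ltW (w0 n)) (HC n).
by move: ih; rewrite !exprS; lra.
Qed.

Let T_ge0 (H : nat -> R) n : (forall k, 0 <= H k) -> 0 <= T H n.
Proof. by move=> H0; apply: sumr_ge0 => k _; rewrite mulr_ge0// ltW. Qed.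

Let T_mono (H K : nat -> R) n : (forall k, H k <= K k) -> T H n <= T K n.
Proof. by move=> HK; apply: ler_sum => k _; rewrite ler_pM2l. Qed.

Let T_lin (a b : R) (H K : nat -> R) n :
  T (fun k => a * H k + b * K k) n = a * T H n + b * T K n.
Proof. by rewrite /T !mulr_sumr -big_split/=; apply: eq_bigr => k _; ring. Qed.

Let term (x : X) k : R := h k x ^+ 2.

(** A limit along the ultrafilter instead of the sum of a series: it is additive
    and monotone on bounded sequences, with no convergence to prove. *)
Let S (x : X) : R := fulim (T (term x)).

Definition rotund_sum (x : X) : R := `|x| ^+ 2 + S x.

Let term_le x k : term x k <= `|x| ^+ 2.
Proof. by rewrite /term lerXn2r ?nnegrE. Qed.

Let T_bd x : \forall n \near free_ultra, `|T (term x) n| <= `|x| ^+ 2.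
Proof.
apply: filterE => n; rewrite ger0_norm.
  by apply: T_le => [k|]; [exact: term_le|exact: sqr_ge0].
by apply: T_ge0 => k; exact: sqr_ge0.
Qed.

Let S_ge0 x : 0 <= S x.
Proof.
by apply: (ulim_ge (T_bd x)); apply: filterE => n; apply: T_ge0 => k; exact: sqr_ge0.
Qed.

Let S_le x : S x <= `|x| ^+ 2.
Proof.
apply: (ulim_leC (T_bd x)); apply: filterE => n.
by apply: T_le => [k|]; [exact: term_le|exact: sqr_ge0].
Qed.

Let term_conv k (l : R) x y : 0 <= l -> l <= 1 ->
  term (l *: x + (1 - l) *: y) k <= l * term x k + (1 - l) * term y k.
Proof.
move=> l0 l1; apply: (@le_trans _ _ ((l * h k x + (1 - l) * h k y) ^+ 2)).
  rewrite lerXn2r ?nnegrE// ?h_conv// addr_ge0// mulr_ge0// subr_ge0//.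
rewrite -subr_ge0 /term.
have -> : l * h k x ^+ 2 + (1 - l) * h k y ^+ 2 - (l * h k x + (1 - l) * h k y) ^+ 2
   = l * (1 - l) * (h k x - h k y) ^+ 2 by ring.
by rewrite mulr_ge0 ?sqr_ge0// mulr_ge0// subr_ge0.
Qed.

Let S_lin (a b : R) x y : fulim (fun n => a * T (term x) n + b * T (term y) n) =
  a * S x + b * S y.
Proof.
rewrite -(ulimZ a (T_bd x)) -(ulimZ b (T_bd y)).
apply: (ulimD (C := `|a| * `|x| ^+ 2) (D := `|b| * `|y| ^+ 2)).
  by apply: filterS (T_bd x) => n bn; rewrite normrM ler_wpM2l.
by apply: filterS (T_bd y) => n bn; rewrite normrM ler_wpM2l.
Qed.

Let lin_bd (a b : R) x y : \forall n \near free_ultra,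
  `|a * T (term x) n + b * T (term y) n| <= `|a| * `|x| ^+ 2 + `|b| * `|y| ^+ 2.
Proof.
apply: filterS2 (T_bd x) (T_bd y) => n h1 h2.
by apply: le_trans (ler_normD _ _) _; rewrite !normrM; apply: lerD;
  rewrite ler_wpM2l.
Qed.

Lemma rotund_sum_conv (l : R) x y : 0 <= l -> l <= 1 ->
  rotund_sum (l *: x + (1 - l) *: y) <= l * rotund_sum x + (1 - l) * rotund_sum y.
Proof.
move=> l0 l1; have := sqr_norm_conv x y l0 l1.
suff : S (l *: x + (1 - l) *: y) <= l * S x + (1 - l) * S y.
  by rewrite /rotund_sum; lra.
rewrite -S_lin; apply: (ulim_le (T_bd _) (lin_bd _ _ _ _)).
apply: filterE => n; rewrite -T_lin; apply: T_mono => k; exact: term_conv.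
Qed.

Lemma rotund_sum_ge x : `|x| ^+ 2 <= rotund_sum x.
Proof. by rewrite /rotund_sum lerDl. Qed.

Lemma rotund_sum_le x : rotund_sum x <= 2 * `|x| ^+ 2.
Proof. by rewrite /rotund_sum; have := S_le x; lra. Qed.

Lemma rotund_sum_even x : rotund_sum (- x) = rotund_sum x.
Proof.
rewrite /rotund_sum normrN /S; congr (_ + ulim _ (T _)).
by apply/funext => k; rewrite /term h_even.
Qed.

Lemma rotund_sum_lip x y : `|x| <= 2 -> `|y| <= 2 ->
  rotund_sum x <= rotund_sum y + 8 * `|x - y|.
Proof.
move=> x2 y2; have n0 := normr_ge0 (x - y).
have h1 : `|x| ^+ 2 <= `|y| ^+ 2 + 4 * `|x - y|.
  have := ler_normD (x - y) y; rewrite subrK.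
  by have := normr_ge0 x; have := normr_ge0 y; nra.
have h2 : S x <= S y + 4 * `|x - y|.
  rewrite -lerBlDl -[S x]mul1r -[S y]mul1r -mulNr -S_lin.
  apply: (ulim_leC (lin_bd _ _ _ _)); apply: filterE => n; rewrite -T_lin.
  apply: T_le; last by rewrite mulr_ge0.
  move=> k; rewrite /term; have := h_lip k x y; have := h_le k x.
  by have := h_le k y; have := h_ge0 k x; have := h_ge0 k y; nra.
by rewrite /rotund_sum; lra.
Qed.

Let gap k x y := 2 * term x k + 2 * term y k - 4 * term (2^-1 *: (x + y)) k.

Let gap_ge0 k x y : 0 <= gap k x y.
Proof.
have := @term_conv k 2^-1 x y.
have -> : 1 - 2^-1 = 2^-1 :> R by lra.
by rewrite -scalerDr /gap; lra.
Qed.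

(** All terms of the series have nonnegative convexity defects, so each of them
    is bounded by the defect of the sum. *)
Lemma rotund_sum_gap k x y :
  2^-1 ^+ k.+1 * (2 * h k x ^+ 2 + 2 * h k y ^+ 2
     - 4 * h k (2^-1 *: (x + y)) ^+ 2) <=
  2 * rotund_sum x + 2 * rotund_sum y - 4 * rotund_sum (2^-1 *: (x + y)).
Proof.
set m := 2^-1 *: (x + y).
have hn : 0 <= 2 * `|x| ^+ 2 + 2 * `|y| ^+ 2 - 4 * `|m| ^+ 2.
  have := @sqr_norm_conv _ _ x y 2^-1.
  have -> : 1 - 2^-1 = 2^-1 :> R by lra.
  by rewrite -scalerDr -/m; lra.
suff : 2^-1 ^+ k.+1 * gap k x y <= 2 * S x + 2 * S y - 4 * S m.
  by rewrite /rotund_sum /gap /term; lra.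
have b : \forall n \near free_ultra,
    `|1 * (2 * T (term x) n + 2 * T (term y) n) + -4 * T (term m) n| <=
    (`|2| * `|x| ^+ 2 + `|2| * `|y| ^+ 2) + `|-4| * `|m| ^+ 2.
  apply: filterS2 (lin_bd 2 2 x y) (T_bd m) => n h1 h2.
  apply: le_trans (ler_normD _ _) _; rewrite mul1r; apply: lerD => //.
  by rewrite normrM ler_wpM2l.
have -> : 2 * S x + 2 * S y - 4 * S m =
   fulim (fun n => 1 * (2 * T (term x) n + 2 * T (term y) n) + -4 * T (term m) n).
  rewrite -S_lin.
  have -> : - (4 * S m) = fulim (fun n => -4 * T (term m) n).
    by rewrite (ulimZ (-4) (T_bd m)) mulNr.
  under [in RHS]eq_fun do rewrite mul1r.
  rewrite -(ulimD (lin_bd 2 2 x y) (D := `|-4| * `|m| ^+ 2))//.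
  by apply: filterS (T_bd m) => n h2; rewrite normrM ler_wpM2l.
apply: (ulim_ge b); apply: filterS (free_ultra_ge k.+1) => n kn.
rewrite -T_lin -T_lin.
have e i : 1 * (2 * term x i + 2 * term y i) + -4 * term m i = gap i x y.
  by rewrite /gap -/m; ring.
rewrite /T (eq_bigr _ (fun i _ => congr1 _ (e i))) big_mkord.
rewrite (bigD1 (Ordinal kn))//= lerDl; apply: sumr_ge0 => i _.
by rewrite mulr_ge0// ltW.
Qed.

Definition rotund_gauge (x : X) : R :=
  inf [set s | 0 < s /\ rotund_sum (s^-1 *: x) <= 1].

Local Notation G x := [set s : R | 0 < s /\ rotund_sum (s^-1 *: x) <= 1].
Local Notation q := rotund_gauge.

Let G_lb x : lbound (G x) `|x|.
Proof.
move=> s [s0 F1]; have := le_trans (rotund_sum_ge _) F1.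
rewrite normrZ gtr0_norm ?invr_gt0// expr_le1 ?mulr_ge0 ?invr_ge0 ?(ltW s0)//.
by rewrite ler_pdivrMl// mulr1.
Qed.

Let G_in x s : 2 * `|x| <= s -> 0 < s -> G x s.
Proof.
move=> xs s0; split => //; apply: le_trans (rotund_sum_le _) _.
have : `|s^-1 *: x| <= 2^-1.
  by rewrite normrZ gtr0_norm ?invr_gt0// ler_pdivrMl//; lra.
by have := normr_ge0 (s^-1 *: x); nra.
Qed.

Let G_ne x : G x !=set0.
Proof.
by exists (2 * `|x| + 1); apply: G_in; [rewrite lerDl|rewrite ltr_wpDl].
Qed.

Lemma rotund_gauge_ge x : `|x| <= q x.
Proof. by apply: lb_le_inf; [exact: G_ne|exact: G_lb]. Qed.

Lemma rotund_gauge_ge0 x : 0 <= q x.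
Proof. exact: le_trans (rotund_gauge_ge x). Qed.

Lemma rotund_gauge_le x : q x <= 2 * `|x|.
Proof.
apply/ler_addgt0Pr => e e0; apply: ge_inf; first by exists `|x|; exact: G_lb.
apply: G_in; first by rewrite lerDl ltW.
by rewrite ltr_wpDl// mulr_ge0.
Qed.

Let F0 : rotund_sum 0 = 0.
Proof.
apply/eqP; rewrite eq_le; apply/andP; split.
  by have := rotund_sum_le 0; rewrite normr0 expr0n/= mulr0.
by have := rotund_sum_ge 0; rewrite normr0 expr0n.
Qed.

Lemma rotund_gauge_lt x s : q x < s -> 0 < s /\ rotund_sum (s^-1 *: x) <= 1.
Proof.
move=> /(inf_lt (G_ne x))[t [t0 Ft] ts].
have s0 : 0 < s by exact: lt_trans ts.
split => //; have := @rotund_sum_conv (t / s) (t^-1 *: x) 0.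
rewrite scaler0 addr0 scalerA mulrAC divff ?gt_eqF// mul1r F0 mulr0 addr0.
have l1 : t / s <= 1 by rewrite ler_pdivrMr// mul1r ltW.
have l0 : 0 <= t / s by rewrite divr_ge0// ltW.
move=> /(_ l0 l1) /le_trans; apply.
by rewrite mulr_ile1//; exact: le_trans (rotund_sum_ge _).
Qed.

Lemma rotund_gauge_le1 x : rotund_sum x <= 1 -> q x <= 1.
Proof.
move=> F1; apply: ge_inf; first by exists `|x|; exact: G_lb.
by split => //; rewrite invr1 scale1r.
Qed.

Lemma rotund_sum_le1 x : q x <= 1 -> rotund_sum x <= 1.
Proof.
move=> q1; apply/ler_addgt0Pr => e e0.
pose s := 1 + e / 8.
have s1 : 1 < s by rewrite /s ltrDl divr_gt0.
have [s0 Fs] := rotund_gauge_lt (le_lt_trans q1 s1).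
have x1 : `|x| <= 1 by exact: le_trans (rotund_gauge_ge x) q1.
have sI : s^-1 <= 1 by rewrite invf_le1// ltW.
have sI0 : 0 < s^-1 by rewrite invr_gt0.
have := @rotund_sum_lip x (s^-1 *: x).
have -> : `|s^-1 *: x| = s^-1 * `|x| by rewrite normrZ gtr0_norm.
have -> : `|x - s^-1 *: x| = (1 - s^-1) * `|x|.
  by rewrite -{1}[x]scale1r -scalerBl normrZ ger0_norm// subr_ge0.
have sE : 1 - s^-1 <= e / 8.
  have : (s - 1) * s^-1 <= s - 1 by rewrite ler_piMr//; lra.
  by rewrite mulrBl divff ?gt_eqF// mul1r /s; lra.
have n0 := normr_ge0 x.
have p1 : s^-1 * `|x| <= 1 by rewrite mulr_ile1// ltW.
have p2 : (1 - s^-1) * `|x| <= e / 8.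
  by apply: le_trans sE; rewrite ler_piMr// subr_ge0.
by move=> lip; have := lip (le_trans x1 _) (le_trans p1 _); lra.
Qed.

Lemma rotund_gauge_seminorm : is_seminorm q.
Proof.
split => [x y|a x].
  apply/ler_addgt0Pr => e e0.
  have [|s0 Fs] := @rotund_gauge_lt x (q x + e / 2); first by rewrite ltrDl divr_gt0.
  have [|t0 Ft] := @rotund_gauge_lt y (q y + e / 2); first by rewrite ltrDl divr_gt0.
  set s := q x + e / 2 in s0 Fs; set t := q y + e / 2 in t0 Ft.
  have st0 : 0 < s + t by exact: addr_gt0.
  have -> : q x + q y + e = s + t by rewrite /s /t; lra.
  apply: ge_inf; first by exists `|x + y|; exact: G_lb.
  split => //.
  have -> : (s + t)^-1 *: (x + y) =
      (s / (s + t)) *: (s^-1 *: x) + (1 - s / (s + t)) *: (t^-1 *: y).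
    rewrite !scalerA scalerDr; congr (_ *: _ + _ *: _).
      by field; rewrite !gt_eqF.
    by field; rewrite !gt_eqF.
  have l0 : 0 <= s / (s + t) by rewrite divr_ge0// ltW.
  have l1 : s / (s + t) <= 1 by rewrite ler_pdivrMr// mul1r lerDl ltW.
  apply: le_trans (rotund_sum_conv _ _ l0 l1) _; nra.
have qN y : q (- y) = q y.
  rewrite /rotund_gauge; congr inf; apply/funext => s /=.
  by rewrite scalerN rotund_sum_even.
wlog a0 : a x / 0 < a => [hw|].
  have [a0|a0|->] := ltgtP a 0; last 2 first.
  - exact: hw.
  - rewrite scale0r normr0 mul0r; apply/eqP; rewrite eq_le rotund_gauge_ge0 andbT.
    by have := rotund_gauge_le 0; rewrite normr0 mulr0.
  - have := hw (- a) x; rewrite scaleNr qN normrN => -> //.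
    by rewrite oppr_gt0.
have qZ (b : R) y : 0 < b -> q (b *: y) <= b * q y.
  move=> b0; apply/ler_addgt0Pr => e e0.
  have [|s0 Fs] := @rotund_gauge_lt y (q y + e / b); first by rewrite ltrDl divr_gt0.
  have -> : b * q y + e = b * (q y + e / b) by field; rewrite gt_eqF.
  apply: ge_inf; first by exists `|b *: y|; exact: G_lb.
  split; first by rewrite mulr_gt0.
  rewrite scalerA (_ : _ * b = (q y + e / b)^-1)//.
  by move: (q y + e / b) s0 => u u0; field; rewrite !gt_eqF.
rewrite gtr0_norm//; apply/eqP; rewrite eq_le qZ//=.
have := qZ a^-1 (a *: x); rewrite invr_gt0 => /(_ a0).
by rewrite scalerA mulVf ?gt_eqF// scale1r ler_pdivlMl.
Qed.

(** If the gauge of a midpoint is almost 1, then rotund_sum is almost 1 there, by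
    the Lipschitz estimate, while it is at most 1 at x and y.  So its convexity
    defect is small, and with it that of every h k. *)
Lemma rotund_gauge_rotund : quad_rotund q.
Proof.
apply: ball_quad_rotund; first exact: rotund_gauge_seminorm.
have [qD qZ] := rotund_gauge_seminorm.
move=> e e0; have [|N [d [d0 dP]]] := @h_rotund (e / 2); first by rewrite divr_gt0.
pose t := Num.min 4^-1 (d * 2^-1 ^+ N / 128).
have t0 : 0 < t.
  by rewrite lt_min divr_gt0 ?mulr_gt0 ?exprn_gt0 ?invr_gt0//= andbT.
have t1 : t <= 4^-1 by rewrite ge_min lexx.
have t2 : 128 * t <= d * 2^-1 ^+ N.
  have : t <= d * 2^-1 ^+ N / 128 by rewrite ge_min lexx orbT.
  lra.
exists t => // x y x1 y1; set m := 2^-1 *: (x + y) => qm.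
have nx : `|x| <= 1 by exact: le_trans (rotund_gauge_ge x) x1.
have ny : `|y| <= 1 by exact: le_trans (rotund_gauge_ge y) y1.
have nm : `|m| <= 1.
  rewrite /m normrZ gtr0_norm ?invr_gt0//; have := ler_normD x y; lra.
apply: le_trans (rotund_gauge_le _) _.
suff : `|x - y| <= e / 2 by lra.
apply: dP => // k kN; rewrite -/m.
have Fx := rotund_sum_le1 x1; have Fy := rotund_sum_le1 y1.
have Fm : 1 - 32 * t <= rotund_sum m.
  pose w := (1 - 2 * t)^-1 *: m.
  have p0 : 0 < 1 - 2 * t by lra.
  have Fw : 1 < rotund_sum w.
    rewrite ltNge; apply/negP => /rotund_gauge_le1.
    by rewrite /w qZ gtr0_norm ?invr_gt0// ler_pdivrMl//; lra.
  have i1 : (1 - 2 * t)^-1 - 1 <= 4 * t.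
    have -> : (1 - 2 * t)^-1 - 1 = 2 * t / (1 - 2 * t) by field; rewrite gt_eqF.
    rewrite ler_pdivrMr//; nra.
  have i0 : 1 <= (1 - 2 * t)^-1 by rewrite invf_ge1//; lra.
  have wm : `|w - m| <= 4 * t.
    rewrite /w -{2}[m]scale1r -scalerBl normrZ ger0_norm ?subr_ge0//.
    by apply: le_trans i1; rewrite ler_piMr// subr_ge0.
  have w2 : `|w| <= 2.
    have := ler_normD (w - m) m; rewrite subrK; lra.
  have m2 : `|m| <= 2 by lra.
  by have := rotund_sum_lip w2 m2; lra.
have := rotund_sum_gap k x y; rewrite -/m.
set D := _ - _ => gapk.
have : 2^-1 ^+ k.+1 * D <= d * 2^-1 ^+ N by lra.
have : d * 2^-1 ^+ N <= d * 2^-1 ^+ k.+1.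
  by rewrite ler_pM2l//; apply: ler_wiXn2l => //; lra.
move=> a1 a2; have := le_trans a2 a1; rewrite mulrC ler_pM2r//.
Qed.

End ConvexSum.

(** * Uniformly rotund renorming *)

Section SetDistance.
Context {R : realType} {X : normedModType R}.

Definition set_dist (A : set X) (x : X) : R := inf [set `|x - z| | z in A].

Variable A : set X.
Hypothesis A_sym : forall x, A x -> A (- x).
Hypothesis A_conv : forall (l : R) x y, 0 <= l -> l <= 1 -> A x -> A y ->
  A (l *: x + (1 - l) *: y).

Let D x := [set `|x - z| | z in A].

Let D_lb x : lbound (D x) 0.
Proof. by move=> _ [z _ <-]. Qed.

Lemma set_dist_ge0 x : 0 <= set_dist A x.
Proof.
have [e|/set0P ne] := eqVneq (D x) set0.
  by rewrite /set_dist -/(D x) e inf0.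
by apply: lb_le_inf => //; exact: D_lb.
Qed.

Let dist_in x z : A z -> set_dist A x <= `|x - z|.
Proof.
by move=> Az; apply: ge_inf; [by exists 0; exact: (@D_lb x)|exists z].
Qed.

Lemma set_dist_lt x e : A !=set0 -> set_dist A x < e ->
  exists2 z, A z & `|x - z| < e.
Proof.
move=> [z Az] /(inf_lt (_ : D x !=set0))[|_ [t At <-] h]; last by exists t.
by exists `|x - z|, z.
Qed.

Let empty_dist x : A = set0 -> set_dist A x = 0.
Proof. by move=> ->; rewrite /set_dist image_set0 inf0. Qed.

Lemma set_dist_le x : set_dist A x <= `|x|.
Proof.
have [A0|/set0P[z Az]] := eqVneq A set0; first by rewrite empty_dist.
have A0 : A 0.
  have := A_conv (_ : 0 <= 2^-1 :> R) (_ : 2^-1 <= 1 :> R) Az (A_sym Az).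
  have -> : 1 - 2^-1 = 2^-1 :> R by lra.
  by rewrite -scalerDr subrr scaler0; apply; lra.
by have := dist_in x A0; rewrite subr0.
Qed.

Lemma set_dist_lip x y : set_dist A x - set_dist A y <= `|x - y|.
Proof.
have [A0|/set0P ne] := eqVneq A set0; first by rewrite !empty_dist// subrr.
rewrite lerBlDr; apply/ler_addgt0Pr => e e0.
have [z Az yz] := set_dist_lt ne (ltr_pwDr e0 (lexx (set_dist A y))).
apply: le_trans (dist_in x Az) _.
have := ler_normD (x - y) (y - z); rewrite addrA subrK; lra.
Qed.

Lemma set_dist_conv (l : R) x y : 0 <= l -> l <= 1 ->
  set_dist A (l *: x + (1 - l) *: y) <= l * set_dist A x + (1 - l) * set_dist A y.
Proof.
move=> l0 l1; have [A0|/set0P ne] := eqVneq A set0.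
  by rewrite !empty_dist// !mulr0 addr0.
apply/ler_addgt0Pr => e e0.
have [z Az xz] := set_dist_lt ne (ltr_pwDr e0 (lexx (set_dist A x))).
have [t At yt] := set_dist_lt ne (ltr_pwDr e0 (lexx (set_dist A y))).
apply: le_trans (dist_in _ (A_conv l0 l1 Az At)) _.
have -> : l *: x + (1 - l) *: y - (l *: z + (1 - l) *: t) =
    l *: (x - z) + (1 - l) *: (y - t) by rewrite opprD addrACA !scalerBr.
apply: le_trans (ler_normD _ _) _; rewrite !normrZ (ger0_norm l0).
rewrite ger0_norm ?subr_ge0//.
have l0' : 0 <= 1 - l by rewrite subr_ge0.
have := ler_wpM2l l0 (ltW xz); have := ler_wpM2l l0' (ltW yt); lra.
Qed.

Lemma set_dist_even x : set_dist A (- x) = set_dist A x.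
Proof.
rewrite /set_dist; congr inf; apply/seteqP; split => _ [z Az <-].
  by exists (- z); [exact: A_sym|rewrite -(normrN (- x - z)) opprD !opprK].
by exists (- z); [exact: A_sym|rewrite -(normrN (x - z)) opprD].
Qed.

Lemma set_dist0 x : A x -> set_dist A x = 0.
Proof.
move=> Ax; apply/eqP; rewrite eq_le set_dist_ge0 andbT.
by have := dist_in x Ax; rewrite subrr normr0.
Qed.

End SetDistance.

Section RotundNorm.
Context {R : realType} {X : normedModType R}.

Lemma split_set_conv eps n (l : R) (x y : X) : 0 <= l -> l <= 1 ->
  split_set eps n x -> split_set eps n y ->
  split_set eps n (l *: x + (1 - l) *: y).
Proof.
case: n => [|n] l0 l1 /= Kx Ky; last exact: conv_hull_conv.
apply: le_trans (ler_normD _ _) _; rewrite !normrZ (ger0_norm l0).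
by rewrite ger0_norm ?subr_ge0//; nra.
Qed.

Lemma split_set_sym eps n (x : X) : split_set eps n x -> split_set eps n (- x).
Proof.
elim: n x => [|n ih] x /=; first by rewrite normrN.
elim => [_ [a [b [Ka Kb ab ->]]]|l u v l0 l1 _ hu _ hv].
  apply: conv_hull_in; exists (- a), (- b); split; try exact: ih.
    by rewrite -opprD normrN.
  by rewrite -opprD scalerN.
by rewrite opprD -!scalerN; exact: conv_hull_conv.
Qed.

(** If x and y at distance e nearly lie in the n-th set, then their midpoint
    nearly lies in the next one; as the defect of the distance to that set is
    small, x and y themselves nearly lie in it.  The error grows by a factor 4
    in each step.  After N steps the N-th set would be nonempty. *)
Let rotund_chain (eps e : R) N (x y : X) : 0 < eps -> eps <= e / 2 ->
  (forall z : X, ~ split_set eps N z) -> `|x| <= 1 -> `|y| <= 1 ->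
  e <= `|x - y| ->
  ~ (forall n, (n <= N)%N ->
      2 * set_dist (split_set eps n) x ^+ 2 +
      2 * set_dist (split_set eps n) y ^+ 2 -
      4 * set_dist (split_set eps n) (2^-1 *: (x + y)) ^+ 2
        <= (e / (8 * 4 ^+ N)) ^+ 2).
Proof.
move=> eps0 epse KN x1 y1 xye small.
set eta0 := e / (8 * 4 ^+ N) in small.
have e0 : 0 < e by lra.
have fN : 0 < 4 ^+ N :> R by rewrite exprn_gt0.
have eta00 : 0 < eta0 by rewrite divr_gt0// mulr_gt0.
have chain n : (n <= N)%N -> [/\ (split_set eps n : set X) !=set0,
    set_dist (split_set eps n) x <= 4 ^+ n * eta0 &
    set_dist (split_set eps n) y <= 4 ^+ n * eta0].
  elim: n => [|n ih] nN.
    split; first by exists x.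
    - by rewrite set_dist0 ?mul1r ?ltW//; exact: split_set_sym.
    - by rewrite set_dist0 ?mul1r ?ltW//; exact: split_set_sym.
  have [ne dx dy] := ih (ltnW nN).
  set eta := 4 ^+ n * eta0 in dx dy.
  have ge : eta0 <= eta by rewrite ler_peMl ?(ltW eta00)// exprn_ege1//; lra.
  have eta_e : 8 * eta <= e.
    have : eta <= 4 ^+ N * eta0.
      by rewrite ler_pM2r// ler_weXn2l//; [lra|exact: ltnW].
    have -> : 4 ^+ N * eta0 = e / 8 by rewrite /eta0; field; rewrite gt_eqF.
    lra.
  have [x' Kx' xx'] : exists2 z, split_set eps n z & `|x - z| < 2 * eta.
    by apply: set_dist_lt => //; lra.
  have [y' Ky' yy'] : exists2 z, split_set eps n z & `|y - z| < 2 * eta.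
    by apply: set_dist_lt => //; lra.
  have xy' : eps <= `|x' - y'|.
    have := ler_distD x' x y; have := ler_distD y' x' y; rewrite (distrC y'); lra.
  have Km : split_set eps n.+1 (2^-1 *: (x' + y')).
    by apply: conv_hull_in; exists x', y'.
  have dm : set_dist (split_set eps n.+1) (2^-1 *: (x + y)) <= 2 * eta.
    have := set_dist_lip (split_set eps n.+1) (2^-1 *: (x + y)) (2^-1 *: (x' + y')).
    rewrite (set_dist0 Km) subr0 => /le_trans; apply.
    rewrite -scalerBr opprD addrACA normrZ gtr0_norm ?invr_gt0//.
    have := ler_normD (x - x') (y - y'); lra.
  have := small _ nN.
  have := set_dist_ge0 (split_set eps n.+1) (2^-1 *: (x + y)).
  have := set_dist_ge0 (split_set eps n.+1) x.
  have := set_dist_ge0 (split_set eps n.+1) y.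
  move: dm; set a := set_dist _ x; set b := set_dist _ y; set c := set_dist _ _.
  move=> dm b0 a0 c0 h.
  have c2 : c ^+ 2 <= (2 * eta) ^+ 2 by rewrite lerXn2r ?nnegrE//; lra.
  have e2 : eta0 ^+ 2 <= eta ^+ 2 by rewrite lerXn2r ?nnegrE//; lra.
  rewrite exprS -mulrA -/eta; split; first by exists (2^-1 *: (x' + y')).
  - have : a ^+ 2 <= (4 * eta) ^+ 2 by have := sqr_ge0 b; nra.
    by rewrite ler_pXn2r ?nnegrE//; lra.
  - have : b ^+ 2 <= (4 * eta) ^+ 2 by have := sqr_ge0 a; nra.
    by rewrite ler_pXn2r ?nnegrE//; lra.
by have [[z /KN]] := chain N (leqnn N).
Qed.

(** The distances to the sets split_set eps n, for all n and for a sequence of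
    eps tending to 0, are enumerated as the functions h k. *)
Lemma superreflexive_rotund_norm : superreflexive X ->
  exists q : X -> R, [/\ is_seminorm q, forall x, `|x| <= q x,
    forall x, q x <= 2 * `|x| & quad_rotund q].
Proof.
move=> srX.
pose eps (i : nat) : R := i.+1%:R^-1.
have eps0 i : 0 < eps i by rewrite invr_gt0 ltr0n.
pose code k : nat * nat := odflt (0, 0)%N (unpickle k).
pose K k := split_set (X := X) (eps (code k).1) (code k).2.
pose h k x := set_dist (K k) x.
have Ks k x : K k x -> K k (- x) by exact: split_set_sym.
have Kc k (l : R) x y : 0 <= l -> l <= 1 -> K k x -> K k y ->
    K k (l *: x + (1 - l) *: y) by exact: split_set_conv.
have h_ge0 k x : 0 <= h k x by exact: set_dist_ge0.
have h_le k x : h k x <= `|x| by apply: set_dist_le; [exact: Ks|exact: Kc].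
have h_conv k (l : R) x y : 0 <= l -> l <= 1 ->
    h k (l *: x + (1 - l) *: y) <= l * h k x + (1 - l) * h k y.
  by apply: set_dist_conv; exact: Kc.
have h_even k x : h k (- x) = h k x by apply: set_dist_even; exact: Ks.
have h_lip k x y : h k x - h k y <= `|x - y| by exact: set_dist_lip.
have h_rot (e : R) : 0 < e -> exists N (d : R), 0 < d /\
    forall x y, `|x| <= 1 -> `|y| <= 1 ->
    (forall k, (k < N)%N -> 2 * h k x ^+ 2 + 2 * h k y ^+ 2
       - 4 * h k (2^-1 *: (x + y)) ^+ 2 <= d) -> `|x - y| <= e.
  move=> e0.
  have [i ie] : exists i, eps i <= e / 2.
    have : 0 <= 2 / e by rewrite divr_ge0// ltW.
    move=> /archi_boundP hb; exists (Num.bound (2 / e)).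
    rewrite /eps invf_ple ?posrE ?divr_gt0 ?ltr0n// invf_div.
    by apply: ltW; apply: lt_trans hb _; rewrite ltr_nat.
  have [M KM] := split_set_empty srX (eps0 i).
  exists (\max_(n < M.+1) pickle (i, n : nat)).+1, ((e / (8 * 4 ^+ M)) ^+ 2).
  split; first by rewrite exprn_gt0// divr_gt0// mulr_gt0// exprn_gt0.
  move=> x y x1 y1 small; rewrite leNgt; apply/negP => /ltW xye.
  apply: (rotund_chain (eps0 i) ie KM x1 y1 xye) => n nM.
  have := small (pickle (i, n)); rewrite /h /K /code pickleK /=; apply.
  rewrite ltnS; have nM' : (n < M.+1)%N by [].
  exact: (leq_bigmax (F := fun n : 'I_M.+1 => pickle (i, n : nat)) (Ordinal nM')).
exists (rotund_gauge h); split.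
- exact: rotund_gauge_seminorm.
- by move=> x; exact: rotund_gauge_ge.
- by move=> x; exact: rotund_gauge_le.
- exact: rotund_gauge_rotund.
Qed.

End RotundNorm.

(** * Approximation by uniformly rotund norms *)

Section RotundTools.
Context {R : realType} {X : lmodType R}.
Implicit Types p q A : X -> R.

Lemma seminorm_par_ge0 p x y : is_seminorm p ->
  0 <= 2 * p x ^+ 2 + 2 * p y ^+ 2 - p (x + y) ^+ 2.
Proof.
move=> pS; have [pD _] := pS; have := seminorm_ge0 pS.
move=> p0; have := pD x y; have := p0 x; have := p0 y; have := p0 (x + y).
by have := sqr_ge0 (p x - p y); nra.
Qed.

Lemma sqrt_sum_sqr_le (a b : R) : 0 <= a -> 0 <= b ->
  Num.sqrt (a ^+ 2 + b ^+ 2) <= a + b.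
Proof.
move=> a0 b0; have ab : 0 <= a + b by exact: addr_ge0.
rewrite -[leRHS](ger0_norm ab) -[leRHS]sqrtr_sqr ler_wsqrtr//; nra.
Qed.

Lemma sqrt_sum_sqr2 (a b : R) : Num.sqrt (a ^+ 2 + b ^+ 2) ^+ 2 = a ^+ 2 + b ^+ 2.
Proof. by rewrite sqr_sqrtr// addr_ge0 ?sqr_ge0. Qed.

Lemma sqrt_sum_sqr_ge (a b : R) : 0 <= a -> a <= Num.sqrt (a ^+ 2 + b ^+ 2).
Proof.
move=> a0; rewrite -{1}(ger0_norm a0) -sqrtr_sqr ler_wsqrtr//.
by rewrite lerDl sqr_ge0.
Qed.

Lemma seminorm_scale p (s : R) : 0 <= s -> is_seminorm p ->
  is_seminorm (fun x => s * p x).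
Proof.
move=> s0 [pD pZ]; split => [x y|a x]; last by rewrite pZ; ring.
by rewrite -mulrDr ler_wpM2l.
Qed.

Lemma seminorm_hypot p q : is_seminorm p -> is_seminorm q ->
  is_seminorm (fun x => Num.sqrt (p x ^+ 2 + q x ^+ 2)).
Proof.
move=> pS qS; have p0 := seminorm_ge0 pS; have q0 := seminorm_ge0 qS.
have [[pD pZ] [qD qZ]] := (pS, qS); split => [x y|a x]; last first.
  rewrite pZ qZ !exprMn -mulrDr sqrtrM ?sqr_ge0//.
  by rewrite sqrtr_sqr normr_id.
set P := Num.sqrt (p x ^+ 2 + _); set Q := Num.sqrt (p y ^+ 2 + _).
have P0 : 0 <= P by exact: sqrtr_ge0.
have Q0 : 0 <= Q by exact: sqrtr_ge0.
have P2 : P ^+ 2 = p x ^+ 2 + q x ^+ 2 by exact: sqrt_sum_sqr2.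
have Q2 : Q ^+ 2 = p y ^+ 2 + q y ^+ 2 by exact: sqrt_sum_sqr2.
have PQ : 0 <= P + Q by exact: addr_ge0.
rewrite -[leRHS](ger0_norm PQ) -[leRHS]sqrtr_sqr ler_wsqrtr//.
have h1 : p (x + y) ^+ 2 <= (p x + p y) ^+ 2.
  by rewrite lerXn2r ?nnegrE ?addr_ge0.
have h2 : q (x + y) ^+ 2 <= (q x + q y) ^+ 2.
  by rewrite lerXn2r ?nnegrE ?addr_ge0.
have cs : p x * p y + q x * q y <= P * Q.
  have s0 : 0 <= p x * p y + q x * q y by rewrite addr_ge0 ?mulr_ge0.
  have PQ0 : 0 <= P * Q by rewrite mulr_ge0.
  rewrite -(ler_pXn2r (n := 2))// exprMn P2 Q2.
  by have := sqr_ge0 (p x * q y - p y * q x); nra.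
rewrite sqrrD P2 Q2; apply: le_trans (lerD h1 h2) _; lra.
Qed.

Lemma quad_rotund_scale q (r e : R) : is_seminorm q -> quad_rotund q ->
  0 < r -> 0 < e -> exists2 d, 0 < d &
    forall x y, q x <= r -> q y <= r ->
    2 * q x ^+ 2 + 2 * q y ^+ 2 - q (x + y) ^+ 2 <= d -> q (x - y) <= e.
Proof.
move=> [qD qZ] qr r0 e0; have [|d d0 dP] := qr (e / r); first by rewrite divr_gt0.
exists (d * r ^+ 2); first by rewrite mulr_gt0// exprn_gt0.
move=> x y xr yr h; have rI : 0 < r^-1 by rewrite invr_gt0.
have qs v : q (r^-1 *: v) = q v / r by rewrite qZ gtr0_norm// mulrC.
have := dP (r^-1 *: x) (r^-1 *: y).
rewrite -(scalerDr _ x) -(scalerBr _ x) !qs => h3.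
suff : q (x - y) / r <= e / r by rewrite ler_pM2r.
apply: h3; [by rewrite ler_pdivrMr// mul1r|by rewrite ler_pdivrMr// mul1r|].
have -> : 2 * (q x / r) ^+ 2 + 2 * (q y / r) ^+ 2 - (q (x + y) / r) ^+ 2 =
  (2 * q x ^+ 2 + 2 * q y ^+ 2 - q (x + y) ^+ 2) / r ^+ 2.
  by field; rewrite gt_eqF.
by rewrite ler_pdivrMr// exprn_gt0.
Qed.

(** The last hypothesis holds if A ^+ 2 is the sum of c * q ^+ 2 and of other
    squared seminorms, because these have nonnegative defects. *)
Lemma quad_rotund_dom q A (c C : R) : is_seminorm q -> quad_rotund q ->
  0 < c -> 0 < C ->
  (forall x, q x <= C * A x) -> (forall x, A x <= C * q x) ->
  (forall x y, c * (2 * q x ^+ 2 + 2 * q y ^+ 2 - q (x + y) ^+ 2) <=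
     2 * A x ^+ 2 + 2 * A y ^+ 2 - A (x + y) ^+ 2) ->
  quad_rotund A.
Proof.
move=> qS qr c0 C0 qA Aq dom e e0.
have [|d d0 dP] := @quad_rotund_scale q C (e / C) qS qr C0; first by rewrite divr_gt0.
exists (c * d); first by rewrite mulr_gt0.
move=> x y x1 y1 h; apply: le_trans (Aq _) _.
rewrite mulrC -ler_pdivlMr//; apply: dP.
- by apply: le_trans (qA _) _; rewrite ler_piMr// ltW.
- by apply: le_trans (qA _) _; rewrite ler_piMr// ltW.
by rewrite -(ler_pM2l c0); exact: le_trans (dom x y) h.
Qed.

End RotundTools.

Section RotundApprox.
Context {R : realType} {X : normedModType R}.

Definition equivalent_seminorm (A : X -> R) := exists a b : R,
  [/\ 0 < a, 0 < b & forall x, a * `|x| <= A x /\ A x <= b * `|x|].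

Lemma rotund_approx (M : X -> R) (e : R) : superreflexive X ->
  equivalent_norm M -> 0 < e ->
  exists A : X -> R, [/\ is_seminorm A, quad_rotund A, equivalent_seminorm A &
    forall x, (1 + e) * A x <= M x /\ M x <= (1 + e) ^+ 2 * A x].
Proof.
move=> srX [MD MZ _ [a [b [a0 b0 ab]]]] e0.
have [q [qS q1 q2 qr]] := superreflexive_rotund_norm srX.
have MS : is_seminorm M by [].
have M0 := seminorm_ge0 MS; have q0 := seminorm_ge0 qS.
pose s := a * e / 2; have s0 : 0 < s by rewrite divr_gt0// mulr_gt0.
have sqS : is_seminorm (fun x => s * q x) by apply: seminorm_scale => //; exact: ltW.
have sM x : s * q x <= e * M x.
  apply: (@le_trans _ _ (s * (2 * `|x|))); first by rewrite ler_pM2l.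
  have -> : s * (2 * `|x|) = e * (a * `|x|) by rewrite /s; field.
  by rewrite ler_pM2l//; case: (ab x).
pose M' x := Num.sqrt (M x ^+ 2 + (s * q x) ^+ 2).
have M'S : is_seminorm M' by exact: seminorm_hypot.
have M'M x : M' x <= (1 + e) * M x.
  apply: le_trans (sqrt_sum_sqr_le _ _) _ => //.
    by rewrite mulr_ge0// ltW.
  by rewrite mulrDl mul1r lerD2l.
have MM' x : M x <= M' x by exact: sqrt_sum_sqr_ge.
pose t := ((1 + e) ^+ 2)^-1.
have e1 : 0 < 1 + e by rewrite addr_gt0.
have t0 : 0 < t by rewrite invr_gt0 exprn_gt0.
have low x : t * a * `|x| <= t * M' x.
  by rewrite -mulrA ler_pM2l//; case: (ab x) => h _; exact: le_trans h (MM' x).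
have up x : t * M' x <= t * (1 + e) * b * `|x|.
  rewrite -!mulrA ler_pM2l//; apply: le_trans (M'M x) _.
  by rewrite ler_pM2l//; case: (ab x).
exists (fun x => t * M' x); split.
- by apply: seminorm_scale => //; exact: ltW.
- pose C := 2 / (t * a) + t * (1 + e) * b.
  have ta : 0 < t * a by rewrite mulr_gt0.
  have tb : 0 < t * (1 + e) * b by rewrite !mulr_gt0.
  have C0 : 0 < C by rewrite addr_gt0// divr_gt0.
  apply: (@quad_rotund_dom _ _ q _ ((t * s) ^+ 2) C) => //.
  + by rewrite exprn_gt0// mulr_gt0.
  + move=> x; apply: le_trans (q2 x) _.
    have M'0 := seminorm_ge0 M'S x.
    apply: (@le_trans _ _ (2 / (t * a) * (t * M' x))).
      rewrite -mulrA ler_pM2l// mulrC ler_pdivlMr// mulrC; exact: low.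
    by apply: ler_wpM2r; [rewrite mulr_ge0// ltW|rewrite lerDl ltW].
  + move=> x; apply: le_trans (up x) _.
    apply: (@le_trans _ _ (t * (1 + e) * b * q x)); first by rewrite ler_pM2l.
    by apply: ler_wpM2r; [exact: q0|rewrite lerDr ltW// divr_gt0].
  + move=> x y; have := seminorm_par_ge0 x y MS.
    have M2 z : M' z ^+ 2 = M z ^+ 2 + (s * q z) ^+ 2 by exact: sqrt_sum_sqr2.
    rewrite !exprMn !M2 !exprMn => h.
    by have := mulr_ge0 (sqr_ge0 t) h; lra.
- by exists (t * a), (t * (1 + e) * b); split=> //; rewrite !mulr_gt0.
- move=> x; split.
    have -> : (1 + e) * (t * M' x) = M' x / (1 + e).
      by rewrite /t; field; rewrite gt_eqF.
    by rewrite ler_pdivrMr// mulrC.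
  by rewrite mulrA /t divff ?mul1r// expf_neq0// gt_eqF.
Qed.

End RotundApprox.

(** * Weakly null sequences *)

Section Kernels.
Context {R : realType} {V : lmodType R}.

(** Intersecting with one more kernel lowers the dimension by at most one; so if
    the intersection were finite dimensional, the whole space would be. *)
Lemma common_kernel (f : nat -> V -> R) n : infinite_dimensional V ->
  (forall i, is_linear (f i)) ->
  exists x, x != 0 /\ forall i, (i < n)%N -> f i x = 0.
Proof.
move=> infV fl; apply: contrapT => nex.
have : exists m (e : 'I_m -> V), forall x,
    (forall i, (i < n)%N -> f i x = 0) -> lin_span e x.
  exists 0%N, (fun=> 0) => x xk; exists (fun=> 0); rewrite big_ord0.
  by apply: contrapT => /eqP x0; apply: nex; exists x.
elim: n {nex} => [|n ih] [m [e eP]].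
  apply: infV; exists m, e; apply/seteqP; split => // x _; exact: eP.
apply: ih.
have [[x0 [x0k fx0]]|no] := pselect (exists x0,
    (forall i, (i < n)%N -> f i x0 = 0) /\ f n x0 != 0); last first.
  exists m, e => x xk; apply: eP => i; rewrite ltnS leq_eqVlt => /orP[/eqP ->|]; last exact: xk.
  by apply: contrapT => /eqP fx; apply: no; exists x.
exists m.+1, (fun i => if unlift ord0 i is Some j then e j else x0) => x xk.
have [|c xc] := eP (x - (f n x / f n x0) *: x0).
  move=> i; rewrite ltnS leq_eqVlt (is_linearB (fl i)) (is_linearZ (fl i)).
  move=> /orP[/eqP ->|ik]; first by rewrite divfK// subrr.
  by rewrite (xk _ ik) (x0k _ ik) mulr0 subrr.
exists (fun i => if unlift ord0 i is Some j then c j else f n x / f n x0).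
rewrite (bigD1_ord ord0)//= unlift_none.
under eq_bigr do rewrite liftK.
by rewrite -xc addrC subrK.
Qed.

End Kernels.

Section SpanDistance.
Context {R : realType} {V : lmodType R}.
Variables (A : V -> R) (u : nat -> V).
Hypothesis AS : is_seminorm A.

Let comb (c : nat -> R) n : V := \sum_(0 <= i < n) c i *: u i.

Let comb_widen c m n : (m <= n)%N ->
  exists c', comb c m = comb c' n.
Proof.
move=> mn; exists (fun i => if (i < m)%N then c i else 0).
rewrite /comb [RHS](@big_cat_nat _ _ _ m)//= [X in _ + X]big_nat [X in _ + X]big1.
  by rewrite addr0; apply: eq_big_nat => i /andP[_ ->].
by move=> i /andP[mi _]; rewrite ltnNge mi scale0r.
Qed.

Let span : set V := [set z | exists c n, z = comb c n].

Let spanD y z : span y -> span z -> span (y + z).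
Proof.
move=> [c [m ->]] [d [n ->]].
have [c' ->] := comb_widen c (leq_addr n m).
have [d' ->] := comb_widen d (leq_addl m n).
exists (fun i => c' i + d' i), (m + n)%N; rewrite /comb -big_split/=.
by apply: eq_bigr => i _; rewrite scalerDl.
Qed.

Let spanZ (a : R) y : span y -> span (a *: y).
Proof.
move=> [c [m ->]]; exists (fun i => a * c i), m.
by rewrite /comb scaler_sumr; apply: eq_bigr => i _; rewrite scalerA.
Qed.

Let span0 : span 0.
Proof. by exists (fun=> 0), 0%N; rewrite /comb big_geq. Qed.

Let D y := [set A (y - z) | z in span].
Let p y := inf (D y).

Let D_lb y : lbound (D y) 0.
Proof. by move=> _ [z _ <-]; exact: seminorm_ge0. Qed.

Let p_le y z : span z -> p y <= A (y - z).
Proof. by move=> sz; apply: ge_inf; [exists 0; exact: D_lb|exists z]. Qed.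

Let p_lt y (e : R) : p y < e -> exists2 z, span z & A (y - z) < e.
Proof.
move=> /(inf_lt (_ : D y !=set0))[|_ [t At <-] h]; last by exists t.
by exists (A (y - 0)), 0.
Qed.

Let p_ge0 y : 0 <= p y.
Proof. by apply: lb_le_inf; [exists (A (y - 0)), 0|exact: D_lb]. Qed.

Let p_seminorm : is_seminorm p.
Proof.
have [AD AZ] := AS; split => [x y|a x].
  apply/ler_addgt0Pr => e e0.
  have [|z sz xz] := @p_lt x (p x + e / 2); first by rewrite ltrDl divr_gt0.
  have [|t st yt] := @p_lt y (p y + e / 2); first by rewrite ltrDl divr_gt0.
  apply: le_trans (p_le _ (spanD sz st)) _; rewrite opprD addrACA.
  by apply: le_trans (AD _ _) _; lra.
have half (b : R) y : p (b *: y) <= `|b| * p y.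
  apply/ler_addgt0Pr => e e0.
  have [|z sz yz] := @p_lt y (p y + e / (`|b| + 1)).
    by rewrite ltrDl divr_gt0// ltr_wpDl.
  apply: le_trans (p_le _ (spanZ b sz)) _; rewrite -scalerBr AZ.
  have b1 : 0 < `|b| + 1 by rewrite ltr_wpDl.
  apply: le_trans (ler_wpM2l (normr_ge0 b) (ltW yz)) _.
  by rewrite mulrDr lerD2l mulrA ler_pdivrMr// [leLHS]mulrC ler_pM2l// lerDl.
have [->|a0] := eqVneq a 0.
  rewrite scale0r normr0 mul0r; apply/eqP; rewrite eq_le p_ge0 andbT.
  by apply: le_trans (p_le _ span0) _; rewrite subr0 seminorm0.
apply/eqP; rewrite eq_le half/=; have := half a^-1 (a *: x).
rewrite scalerA mulVf// scale1r normfV mulrC ler_pdivlMr ?normr_gt0//.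
by rewrite mulrC.
Qed.

(** Apply the Hahn-Banach theorem to the distance from the span, which is
    a seminorm. *)
Lemma span_dense (y : V) :
  (forall g, is_linear g -> (forall x, `|g x| <= A x) -> (forall n, g (u n) = 0) ->
    g y = 0) ->
  forall e : R, 0 < e -> exists c n, A (y - \sum_(0 <= i < n) c i *: u i) < e.
Proof.
move=> gy e e0.
have [g [gl gp gy']] := hahn_banach p_seminorm y.
have py : p y = 0.
  rewrite -gy'; apply: gy => // [x|n].
    apply: le_trans (gp x) _; apply: le_trans (p_le _ span0) _.
    by rewrite subr0.
  apply/eqP; rewrite -normr_le0; apply: le_trans (gp _) _.
  have sn : span (u n).
    exists (fun i => if i == n then 1 else 0), n.+1.
    rewrite /comb big_nat_recr//= eqxx scale1r big_nat big1 ?add0r// => i /andP[_ ni].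
    by rewrite ltn_eqF// scale0r.
  by apply: le_trans (p_le _ sn) _; rewrite subrr seminorm0.
have [|_ [c [n ->]] h] := @p_lt y e; first by rewrite py.
by exists c, n.
Qed.

End SpanDistance.

Section WeaklyNullSequence.
Context {R : realType} {X : normedModType R}.
Variable A : X -> R.
Hypothesis AS : is_seminorm A.
Hypothesis AE : equivalent_seminorm A.
Hypothesis infX : infinite_dimensional X.
Hypothesis reflX : reflexive_space X.

Let supportE := choice (fun v : X => hahn_banach AS v).

Definition support (v : X) : X -> R := projT1 supportE v.

Lemma support_linear v : is_linear (support v).
Proof. by have [] := projT2 supportE v. Qed.

Lemma support_le v x : `|support v x| <= A x.
Proof. by have [_ + _] := projT2 supportE v; apply. Qed.

Lemma support_self v : support v v = A v.
Proof. by have [] := projT2 supportE v. Qed.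

Lemma support_dual v : dual (support v : X -> R^o).
Proof.
have [a [b [a0 b0 ab]]] := AE.
apply: (@bounded_dual _ _ _ b); first exact: support_linear.
by move=> x; apply: le_trans (support_le _ _) _; case: (ab x).
Qed.

Lemma equivalent_seminorm_eq0 x : A x = 0 -> x = 0.
Proof.
have [a [b [a0 b0 ab]]] := AE; have [h _] := ab x; move=> Ax.
by apply/eqP; rewrite -normr_le0 -(ler_pM2l a0) mulr0 -Ax.
Qed.

(** The coefficients are the k-th finite sequence of rationals. *)
Let qcomb (k : nat) (s : seq X) : X :=
  \sum_(0 <= i < size s) ratr (nth 0 (odflt [::] (unpickle k : option (seq rat))) i)
    *: nth 0 s i.

Let next_spec (s : seq X) (x : X) := A x = 1 /\ forall k, (k < size s)%N ->
  support (qcomb k s) x = 0 /\ support (nth 0 s k) x = 0.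

Let next_ex s : exists x, next_spec s x.
Proof.
pose f i := if (i < size s)%N then support (qcomb i s)
            else support (nth 0 s (i - size s)).
have fl i : is_linear (f i).
  by rewrite /f; case: ifP => _; exact: support_linear.
have [x [x0 xf]] := common_kernel (size s + size s) infX fl.
have Ax : 0 < A x.
  rewrite lt_neqAle seminorm_ge0// andbT; apply/eqP => /esym/equivalent_seminorm_eq0.
  by apply/eqP.
exists ((A x)^-1 *: x); split.
  by rewrite (proj2 AS) gtr0_norm ?invr_gt0// mulVf// gt_eqF.
move=> k ks; rewrite !(is_linearZ (support_linear _)).
have := xf k; rewrite /f ks => -> //; last by rewrite ltn_addr.
have e : (size s + k < size s)%N = false by rewrite ltnNge leq_addr.
have := xf (size s + k)%N; rewrite /f e addKn ltn_add2l => -> //.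
by rewrite mulr0.
Qed.

Let next s := projT1 (cid (next_ex s)).

Let nextP s : next_spec s (next s).
Proof. exact: projT2 (cid (next_ex s)). Qed.

Let hist := fix hist n := if n is m.+1 then rcons (hist m) (next (hist m))
  else [::].

Let u n := next (hist n).

Let hist_size n : size (hist n) = n.
Proof. by elim: n => //= n ih; rewrite size_rcons ih. Qed.

Let hist_nth n i : (i < n)%N -> nth 0 (hist n) i = u i.
Proof.
elim: n => //= n ih; rewrite ltnS leq_eqVlt nth_rcons hist_size.
by move=> /orP[/eqP ->|lt]; rewrite ?ltnn ?eqxx// lt ih.
Qed.

Let u1 n : A (u n) = 1.
Proof. by have [] := nextP (hist n). Qed.

Let u_support k n : (k < n)%N -> support (u k) (u n) = 0.
Proof.
move=> kn; have [_ /(_ k)] := nextP (hist n).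
by rewrite hist_size => /(_ kn)[_]; rewrite hist_nth.
Qed.

Let u_qcomb (q : seq rat) : \forall n \near \oo,
  support (\sum_(0 <= i < size q) ratr (nth 0 q i) *: u i) (u n) = 0.
Proof.
exists (maxn (pickle q).+1 (size q)) => // n /=; rewrite geq_max => /andP[kn qn].
have [_ /(_ (pickle q))] := nextP (hist n).
rewrite hist_size => /(_ kn)[+ _]; rewrite /qcomb pickleK /= hist_size.
have -> : \sum_(0 <= i < n) ratr (nth 0 q i) *: nth 0 (hist n) i =
   \sum_(0 <= i < size q) ratr (nth 0 q i) *: u i; last by [].
rewrite (@big_cat_nat _ _ _ (size q))//= [X in _ + X]big_nat [X in _ + X]big1.
  rewrite addr0; apply: eq_big_nat => i /andP[_ iq].
  by rewrite hist_nth// (leq_trans iq).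
by move=> i /andP[qi _]; rewrite nth_default// raddf0 scale0r.
Qed.

Let rat_approx (c : R) (e : R) : 0 < e -> exists q : rat, `|c - ratr q| < e.
Proof.
move=> e0; have [|q] := @rat_in_itvoo _ (c - e) (c + e); first by lra.
rewrite in_itv /= => /andP[h1 h2]; exists q.
by rewrite ltr_distl; apply/andP; split; lra.
Qed.

(** As a weak limit, y lies in the closed span of u, so a rational combination w
    of u is close to y.  The norming functional of w vanishes on all late terms
    of u, hence at y; therefore A w <= A (y - w). *)
Let limit0 (V : set_system nat) (UV : UltraFilter V) (y : X) : \oo `<=` V ->
  (forall f, dual f -> f y = ulim V (fun j => f (u j) : R)) -> y = 0.
Proof.
move=> Voo yP; have [a [b [a0 b0 ab]]] := AE; have [AD AZ] := AS.
apply: equivalent_seminorm_eq0; apply/eqP; rewrite eq_le seminorm_ge0// andbT.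
apply/ler_addgt0Pr => e e0; rewrite add0r.
have [||c [n cn]] := @span_dense _ _ A u AS y _ (e / 4); last 2 first.
- by rewrite divr_gt0.
- have /choice[q qP] i : exists q : rat, `|c i - ratr q| < e / (4 * n.+1%:R).
    by apply: rat_approx; rewrite divr_gt0// mulr_gt0.
  pose s := mkseq q n.
  pose w := \sum_(0 <= i < size s) ratr (nth 0 s i) *: u i.
  have wE : w = \sum_(0 <= i < n) ratr (q i) *: u i.
    by rewrite /w size_mkseq; apply: eq_big_nat => i /andP[_ ni]; rewrite nth_mkseq.
  have yw : A (y - w) <= e / 2.
    have -> : y - w = (y - \sum_(0 <= i < n) c i *: u i) +
        \sum_(0 <= i < n) (c i - ratr (q i)) *: u i.
      rewrite wE; under [X in _ = _ + X]eq_bigr do rewrite scalerBl.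
      by rewrite sumrB addrA subrK.
    apply: le_trans (AD _ _) _.
    have : A (\sum_(0 <= i < n) (c i - ratr (q i)) *: u i) <= e / 4.
      apply: le_trans (seminorm_sum AS _ _ _) _.
      apply: (@le_trans _ _ (\sum_(0 <= i < n) e / (4 * n.+1%:R))).
        by apply: ler_sum => i _; rewrite AZ u1 mulr1 ltW.
      rewrite sumr_const_nat subn0 -[leLHS]mulr_natl.
      have -> : e / (4 * n.+1%:R) = (e / 4) / n.+1%:R by rewrite invfM mulrA.
      rewrite mulrCA ler_piMr ?divr_ge0 ?ltW// ltr_pdivrMr ?ltr0n// mul1r ltr_nat//.
    by move: cn; lra.
  have wy : support w y = 0.
    have -> : support w y = ulim V (fun j => support w (u j)).
      exact: (yP _ (support_dual w)).
    apply: ulim_eq; apply: (@cvg_near_cst _ _ _ _ V); apply: Voo.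
    exact: u_qcomb.
  have : A w <= A (y - w).
    rewrite -support_self -[leLHS]subr0 -wy -(is_linearB (support_linear w)).
    apply: le_trans (ler_norm _) _; apply: le_trans (support_le _ _) _.
    by rewrite seminormBC.
  have : A y <= A (y - w) + A w by rewrite -{1}(subrK w y) AD.
  lra.
- move=> g gl gA gu.
  have gd : dual (g : X -> R^o).
    apply: (@bounded_dual _ _ _ b) => // x.
    by apply: le_trans (gA _) _; case: (ab x).
  have -> : g y = ulim V (fun j => g (u j)) by exact: (yP _ gd).
  by under eq_fun do rewrite gu; exact: ulim_cst.
Qed.

(** Each term is chosen in the kernel of the norming functionals of the earlier
    terms and of more and more of their rational combinations. *)
Lemma weakly_null_sequence : exists u : nat -> X, [/\ forall n, A (u n) = 1,
  forall k n, (k < n)%N -> support (u k) (u n) = 0 &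
  forall f : X -> R^o, dual f -> f \o u @ \oo --> (0 : R)].
Proof.
exists u; split => // f df.
have [a [b [a0 b0 ab]]] := AE.
apply/cvgrPdist_lt => e e0; apply: contrapT => nnear.
pose B := [set n | e <= `|f (u n)|].
have FB : ProperFilter (within B \oo).
  apply: Build_ProperFilter => h; apply: nnear.
  have {}h : \forall n \near \oo, B n -> False by exact: h.
  near=> n; rewrite sub0r normrN ltNge; apply/negP.
  by near: n; exact: h.
have [V [UV VB]] := ultraFilterLemma FB.
have Voo : \oo `<=` V.
  by move=> P P_; apply: VB; apply: filterS P_.
have uE j : `|u j| <= a^-1.
  by have [h _] := ab (u j); rewrite u1 in h; rewrite -[leRHS]mulr1 ler_pdivlMl.
have [y yP] := reflexive_ulim UV reflX uE.
have y0 := limit0 UV Voo yP.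
have fb : \forall j \near V, `|f (u j) : R| <= dual_norm f * a^-1.
  apply: filterE => j; apply: le_trans (dual_normP df _) _.
  by rewrite ler_wpM2l// dual_norm_ge0.
pose fu : nat -> R := fun j => f (u j).
have ful : fu @ V --> ulim V fu by exact: (ulim_cvg fb).
have /cvgrPdist_lt/(_ e e0) := ful; rewrite /fu.
have -> : ulim V (fun j => f (u j)) = 0 :> R.
  rewrite -[LHS](yP f df) y0; case: df => fl _; exact: (is_linear0 fl).
have VBB : V B by apply: VB; exact: withinT.
move=> h; have [n [h1]] := @filter_ex _ V _ _ (filterI h VBB).
by rewrite /B /= sub0r normrN in h1 *; rewrite leNgt h1.
Unshelve. all: by end_near. Qed.

End WeaklyNullSequence.

(** * Flattening a uniformly rotund norm *)

Section WeakConvergence.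
Context {R : realType} {X : normedModType R}.

Lemma weak_cvg0 (v : nat -> X) :
  (forall f : X -> R^o, dual f -> f \o v @ \oo --> (0 : R)) ->
  v @ \oo --> (0 : weak X).
Proof.
move=> vf; pose ev := fun x : X => (fun f => \val f x) : {ptws (@dual R X) -> R}.
have evv : ev \o v @ \oo --> (ev 0 : {ptws (@dual R X) -> R}).
  apply/cvg_sup => g W /= [_ [[V Vop <-] V0 VW]].
  have dg : dual (\val g) by exact: set_valP.
  have g0 : (\val g) (0 : X) = 0 by case: dg => gl _; exact: (is_linear0 gl).
  have /(vf _ dg) : nbhs (0 : R) V.
    by apply: open_nbhs_nbhs; split => //; rewrite -g0.
  move=> h; have {}h : \forall n \near \oo, V (\val g (v n)) by exact: h.
  suff : \forall n \near \oo, W (ev (v n)) by [].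
  by apply: filterS h => n Vn; exact: VW.
move=> A /= [_ [[B Bop <-] B0 BA]].
have /evv : nbhs (ev 0) B by apply: open_nbhs_nbhs.
move=> h; have {}h : \forall n \near \oo, B (ev (v n)) by exact: h.
suff : \forall n \near \oo, A (v n) by [].
by apply: filterS h => n; exact: BA.
Qed.

End WeakConvergence.

Section FiniteMin.
Context {R : realType}.

Lemma finite_min (d : nat -> R) n : (forall k, 0 < d k) ->
  exists2 t, 0 < t & forall k, (k < n)%N -> t <= d k.
Proof.
move=> d0; elim: n => [|n [t t0 tP]]; first by exists 1.
exists (Num.min t (d n)); first by rewrite lt_min t0 d0.
move=> k; rewrite ltnS leq_eqVlt => /orP[/eqP ->|kn].
  by rewrite ge_min lexx orbT.
by rewrite ge_min tP.
Qed.

Lemma midpoint_gap (X : lmodType R) (p : X -> R) (x y : X) (t : R) :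
  is_seminorm p -> t <= 1 -> p x <= 1 -> p y <= 1 ->
  1 - t <= p (2^-1 *: (x + y)) ->
  2 * p x ^+ 2 + 2 * p y ^+ 2 - p (x + y) ^+ 2 <= 8 * t.
Proof.
move=> pS t1 x1 y1; rewrite (proj2 pS) gtr0_norm ?invr_gt0// => h.
have p0 := seminorm_ge0 pS; have := p0 x; have := p0 y; have := p0 (x + y).
have hx : p x ^+ 2 <= 1 by rewrite expr_le1.
have hy : p y ^+ 2 <= 1 by rewrite expr_le1.
move=> pxy _ _; have : (2 - 2 * t) ^+ 2 <= p (x + y) ^+ 2.
  by rewrite lerXn2r ?nnegrE//; lra.
have := sqr_ge0 t; nra.
Qed.

End FiniteMin.

Section Poles.
Context {R : realType} {X : lmodType R}.
Variable A : X -> R.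
Hypothesis AS : is_seminorm A.
Hypothesis AQ : quad_rotund A.
Variables (u : nat -> X) (f : nat -> X -> R).
Hypothesis fl : forall n, is_linear (f n).
Hypothesis fA : forall n x, `|f n x| <= A x.
Hypothesis u1 : forall n, A (u n) = 1.
Hypothesis fu : forall n, f n (u n) = 1.
Hypothesis fu0 : forall k n, (k < n)%N -> f k (u n) = 0.

Let A0 := seminorm_ge0 AS.
Let AZ := proj2 AS.

(** If s * f k x > 1 - t for a sign s, then A (s u k + x) > 2 - t, and uniform
    rotundity brings x close to s u k. *)
Let near_pole (t : R) : 0 < t -> (forall x y, A x <= 1 -> A y <= 1 ->
    2 * A x ^+ 2 + 2 * A y ^+ 2 - A (x + y) ^+ 2 <= 4 * t -> A (x - y) <= 3^-1) ->
  forall k x, A x = 1 -> 1 - t < `|f k x| ->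
  exists2 s : R, `|s| = 1 & A (s *: u k - x) <= 3^-1.
Proof.
move=> t0 tP k x Ax fx.
have key (s : R) : `|s| = 1 -> 1 - t < s * f k x -> A (s *: u k - x) <= 3^-1.
  move=> s1 h; apply: tP; rewrite ?AZ ?s1 ?u1 ?mulr1 ?Ax//.
  have h2 : 1 + s * f k x <= A (s *: u k + x).
    have -> : 1 + s * f k x = s * f k (s *: u k + x).
      rewrite (is_linearD (fl k)) (is_linearZ (fl k)) fu mulr1 mulrDr.
      by have := real_normK (num_real s); rewrite s1 expr1n expr2 => <-.
    apply: le_trans (ler_norm _) _; rewrite normrM s1 mul1r; exact: fA.
  have [t1|t1] := leP t 1.
    have : (2 - t) ^+ 2 <= A (s *: u k + x) ^+ 2.
      by rewrite lerXn2r ?nnegrE//; lra.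
    by have := sqr_ge0 t; lra.
  by have := sqr_ge0 (A (s *: u k + x)); lra.
have [f0|f0] := leP 0 (f k x).
  exists 1; first by rewrite normr1.
  by apply: key; rewrite ?normr1 ?mul1r//; rewrite ger0_norm in fx.
exists (-1); first by rewrite normrN1.
by apply: key; rewrite ?normrN1// mulN1r; rewrite ltr0_norm in fx.
Qed.

(** A point of two slices would be close to both poles, up to signs; but f m
    shows that the poles u m and u n, m < n, have distance at least 1, whatever
    the signs. *)
Lemma disjoint_slices : exists2 t : R, 0 < t <= 2^-1 &
  forall m n x, m != n -> (1 - t) * A x < `|f m x| -> `|f n x| <= (1 - t) * A x.
Proof.
have [|d d0 dP] := @AQ 3^-1; first by rewrite invr_gt0.
pose t := Num.min (d / 4) 2^-1.
have t0 : 0 < t by rewrite lt_min divr_gt0//= invr_gt0.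
have t1 : t <= 2^-1 by rewrite ge_min lexx orbT.
have td : 4 * t <= d.
  have : t <= d / 4 by rewrite ge_min lexx.
  lra.
exists t; first by rewrite t0.
have tP x y : A x <= 1 -> A y <= 1 ->
    2 * A x ^+ 2 + 2 * A y ^+ 2 - A (x + y) ^+ 2 <= 4 * t -> A (x - y) <= 3^-1.
  by move=> x1 y1 h; apply: dP => //; exact: le_trans h td.
have pole := near_pole t0 tP.
suff key m n x : (m < n)%N -> A x = 1 -> 1 - t < `|f m x| -> 1 - t < `|f n x| ->
    False.
  move=> m n x mn fm; rewrite leNgt; apply/negP => fn.
  have Ax : 0 < A x.
    rewrite lt_neqAle A0 andbT; apply/eqP => Ax.
    by have := fA m x; rewrite -Ax mulr0 in fm *; rewrite leNgt fm.
  have Ax1 : A ((A x)^-1 *: x) = 1.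
    by rewrite AZ gtr0_norm ?invr_gt0// mulVf// gt_eqF.
  have sc k : (1 - t) * A x < `|f k x| -> 1 - t < `|f k ((A x)^-1 *: x)|.
    rewrite (is_linearZ (fl k)) normrM gtr0_norm ?invr_gt0//.
    by rewrite ltr_pdivlMl// mulrC.
  by move: mn; rewrite neq_ltn => /orP[mn|mn]; apply: (key _ _ _ mn Ax1); exact: sc.
move=> mn Ax1 fm fn.
have [s s1 hs] := pole _ _ Ax1 fm; have [r r1 hr] := pole _ _ Ax1 fn.
have : `|f m (s *: u m - r *: u n)| <= 2 / 3.
  apply: le_trans (fA _ _) _.
  have -> : s *: u m - r *: u n = (s *: u m - x) - (r *: u n - x).
    by rewrite opprB addrA subrK.
  by apply: le_trans (seminormB AS _ _) _; lra.
rewrite (is_linearB (fl m)) !(is_linearZ (fl m)) fu fu0// mulr0 subr0 mulr1 s1.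
lra.
Qed.

End Poles.

Section Construction.
Context {R : realType} {X : normedModType R}.
Variables (A : X -> R) (u : nat -> X) (f : nat -> X -> R) (tau : R).

Definition flat_weight (n : nat) : R := tau / 5 / n.+1%:R.

Definition project_away n x := x - f n.+1 x *: u n.+1.

(** The square of this seminorm is the sum of three squares.  The middle term
    makes it exceed A near the pole u n.  The first one, which ignores the
    direction u n.+1, gives rotundity in all other directions, uniformly in n.
    The last one gives rotundity in the direction u n.+1 too, but its weight
    tends to 0. *)
Definition flat n x : R := Num.sqrt (Num.sqrt (
  (Num.sqrt (tau / 5) * A (project_away n x)) ^+ 2 +
  ((1 + tau) * `|f n x|) ^+ 2) ^+ 2 +
  (Num.sqrt (flat_weight n) * A x) ^+ 2).

Definition flat_family k : X -> R := if k is n.+1 then flat n else A.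

Definition flattened_norm (x : X) : R := sup (range (flat_family^~ x)).

Variables (e theta : R).
Hypothesis AS : is_seminorm A.
Hypothesis AQ : quad_rotund A.
Hypothesis AE : equivalent_seminorm A.
Hypotheses (e0 : 0 < e) (e1 : e <= 1).
Hypothesis fl : forall n, is_linear (f n).
Hypothesis fA : forall n x, `|f n x| <= A x.
Hypothesis u1 : forall n, A (u n) = 1.
Hypothesis fu : forall n, f n (u n) = 1.
Hypothesis fu0 : forall k n, (k < n)%N -> f k (u n) = 0.
Hypothesis u_null :
  forall g : X -> R^o, dual g -> g \o u @ \oo --> (0 : R).
Hypothesis theta_bd : 0 < theta <= 2^-1.
Hypothesis slices : forall m n x, m != n -> (1 - theta) * A x < `|f m x| ->
  `|f n x| <= (1 - theta) * A x.
Hypothesis tau0 : 0 < tau.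
Hypothesis tau_e : tau <= e / 2.
Hypothesis tau_theta : tau <= theta / 4.

Let A0 := seminorm_ge0 AS.
Let AD := proj1 AS.
Let AZ := proj2 AS.

Local Notation del := flat_weight.
Local Notation T := project_away.
Local Notation P := flat_family.
Local Notation N := flattened_norm.

Let del0 n : 0 < del n.
Proof. by rewrite !divr_gt0// ltr0n. Qed.

Let del_le n : del n <= tau / 5.
Proof.
rewrite ler_pdivrMr ?ltr0n// ler_peMr ?ler1n//.
by rewrite ltW// divr_gt0.
Qed.

Let TL n (a : R) x y : T n (a *: x + y) = a *: T n x + T n y.
Proof.
rewrite /T (fl n.+1) scalerBr scalerDl scalerA opprD addrACA.
by [].
Qed.

Let TD n x y : T n (x + y) = T n x + T n y.
Proof. by have := TL n 1 x y; rewrite !scale1r. Qed.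

Let TZ n (a : R) x : T n (a *: x) = a *: T n x.
Proof.
by rewrite /T (is_linearZ (fl n.+1)) scalerBr scalerA.
Qed.

Let AT_seminorm n : is_seminorm (fun x => A (T n x)).
Proof. by split => [x y|a x]; rewrite ?TD ?TZ ?AZ. Qed.

Let f_seminorm n : is_seminorm (fun x => `|f n x|).
Proof.
split => [x y|a x]; first by rewrite (is_linearD (fl n)) ler_normD.
by rewrite (is_linearZ (fl n)) normrM.
Qed.

Let AT_le n x : A (T n x) <= 2 * A x.
Proof.
apply: le_trans (seminormB AS _ _) _; rewrite AZ u1 mulr1.
by have := fA n.+1 x; lra.
Qed.

Let flat_seminorm n : is_seminorm (flat n).
Proof.
apply: (seminorm_hypot _ (seminorm_scale (sqrtr_ge0 _) AS)).
apply: (seminorm_hypot (seminorm_scale (sqrtr_ge0 _) (AT_seminorm n))).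
by apply: (seminorm_scale _ (f_seminorm n)); rewrite addr_ge0// ltW.
Qed.

Let flat2 n x : flat n x ^+ 2 =
  tau / 5 * A (T n x) ^+ 2 + (1 + tau) ^+ 2 * `|f n x| ^+ 2 + del n * A x ^+ 2.
Proof.
rewrite /flat !sqrt_sum_sqr2 !exprMn !sqr_sqrtr//; first exact: ltW.
by rewrite ltW// divr_gt0.
Qed.

Let flat_ge0 n x : 0 <= flat n x.
Proof. exact: sqrtr_ge0. Qed.

Let le_of_sqr (a b : R) : 0 <= a -> 0 <= b -> a ^+ 2 <= b ^+ 2 -> a <= b.
Proof. by move=> a0 b0; rewrite ler_pXn2r. Qed.

Let flat_le n x : flat n x <= (1 + e) * A x.
Proof.
have e10 : 0 <= (1 + e) * A x by rewrite mulr_ge0// addr_ge0// ltW.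
apply: le_of_sqr => //; rewrite flat2.
have h1 : A (T n x) ^+ 2 <= (2 * A x) ^+ 2 by rewrite lerXn2r ?nnegrE ?mulr_ge0.
have h2 : `|f n x| ^+ 2 <= A x ^+ 2 by rewrite lerXn2r ?nnegrE.
have h3 := del_le n; have tp := tau0;
have Ax2 : 0 <= A x ^+ 2 by exact: sqr_ge0.
have k1 : tau / 5 * A (T n x) ^+ 2 <= tau / 5 * (2 * A x) ^+ 2.
  by rewrite ler_pM2l// divr_gt0.
have k2 : (1 + tau) ^+ 2 * `|f n x| ^+ 2 <= (1 + tau) ^+ 2 * A x ^+ 2.
  by rewrite ler_wpM2l ?sqr_ge0.
have k3 : del n * A x ^+ 2 <= tau / 5 * A x ^+ 2 by rewrite ler_wpM2r.
have : (tau + (1 + tau) ^+ 2) * A x ^+ 2 <= (1 + e) ^+ 2 * A x ^+ 2.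
  have t2 : tau ^+ 2 <= e ^+ 2.
    by rewrite lerXn2r ?nnegrE//; have := tau_e; have := tau0; lra.
  by rewrite ler_wpM2r//; have := tau_e; have := tau0; lra.
lra.
Qed.

Let kappa : R := 1 - theta / 4.

Let flat_inactive n x : `|f n x| <= (1 - theta) * A x -> flat n x <= kappa * A x.
Proof.
have /andP[th0 th1] := theta_bd.
move=> fx; have k0 : 0 <= kappa * A x by rewrite mulr_ge0// /kappa; lra.
apply: le_of_sqr => //; rewrite flat2.
have h1 : A (T n x) ^+ 2 <= (2 * A x) ^+ 2 by rewrite lerXn2r ?nnegrE ?mulr_ge0.
have h2 : `|f n x| ^+ 2 <= ((1 - theta) * A x) ^+ 2.
  by rewrite lerXn2r ?nnegrE ?mulr_ge0//; lra.
have h3 := del_le n; have tp := tau0; have tt := tau_theta.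
have Ax2 : 0 <= A x ^+ 2 by exact: sqr_ge0.
have k1 : tau / 5 * A (T n x) ^+ 2 <= tau / 5 * (2 * A x) ^+ 2.
  by rewrite ler_pM2l// divr_gt0.
have k2 : (1 + tau) ^+ 2 * `|f n x| ^+ 2 <= (1 + tau) ^+ 2 * ((1 - theta) * A x) ^+ 2.
  by rewrite ler_wpM2l ?sqr_ge0.
have k3 : del n * A x ^+ 2 <= tau / 5 * A x ^+ 2 by rewrite ler_wpM2r.
have : (tau + ((1 + tau) * (1 - theta)) ^+ 2) * A x ^+ 2 <= kappa ^+ 2 * A x ^+ 2.
  rewrite ler_wpM2r// /kappa.
  have l1 : (1 + tau) * (1 - theta) <= 1 - 3 / 4 * theta.
    have : 0 <= tau * theta by rewrite mulr_ge0// ltW.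
    lra.
  have l0 : 0 <= (1 + tau) * (1 - theta).
    by rewrite mulr_ge0//; lra.
  have l2 : ((1 + tau) * (1 - theta)) ^+ 2 <= (1 - 3 / 4 * theta) ^+ 2.
    by rewrite lerXn2r ?nnegrE//; lra.
  by nra.
lra.
Qed.


(** The defect of a sum of squares bounds the defects of its terms. *)
Let flat_gap n x y :
  tau / 5 * (2 * A (T n x) ^+ 2 + 2 * A (T n y) ^+ 2 - A (T n (x + y)) ^+ 2) <=
    2 * flat n x ^+ 2 + 2 * flat n y ^+ 2 - flat n (x + y) ^+ 2 /\
  del n * (2 * A x ^+ 2 + 2 * A y ^+ 2 - A (x + y) ^+ 2) <=
    2 * flat n x ^+ 2 + 2 * flat n y ^+ 2 - flat n (x + y) ^+ 2.
Proof.
rewrite !flat2; have h1 := seminorm_par_ge0 x y (AT_seminorm n).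
have h2 := seminorm_par_ge0 x y (f_seminorm n).
have h3 := seminorm_par_ge0 x y AS.
have t5 : 0 <= tau / 5 by rewrite ltW// divr_gt0.
have g1 := mulr_ge0 t5 h1; have g2 := mulr_ge0 (sqr_ge0 (1 + tau)) h2.
have g3 := mulr_ge0 (ltW (del0 n)) h3.
by split; lra.
Qed.

Let P_seminorm k : is_seminorm (P k).
Proof. by case: k => [|n] //; exact: flat_seminorm. Qed.

Let P_ge0 k x : 0 <= P k x.
Proof. exact: seminorm_ge0 (P_seminorm k) x. Qed.

Let P_le k x : P k x <= (1 + e) * A x.
Proof.
case: k => [|n]; last exact: flat_le.
by rewrite /= ler_peMl// lerDl ltW.
Qed.

Let N_ge k x : P k x <= N x.
Proof.
apply: ub_le_sup; last by exists k.
by exists ((1 + e) * A x) => _ [j _ <-]; exact: P_le.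
Qed.

Let N_lub x (c : R) : (forall k, P k x <= c) -> N x <= c.
Proof.
move=> h; apply: ge_sup; first by exists (P 0%N x), 0%N.
by move=> _ [k _ <-].
Qed.

Lemma flattened_norm_ge x : A x <= N x.
Proof. exact: (N_ge 0 x). Qed.

Lemma flattened_norm_le x : N x <= (1 + e) * A x.
Proof. by apply: N_lub => k; exact: P_le. Qed.

Lemma flattened_seminorm : is_seminorm N.
Proof.
have half (a : R) x : N (a *: x) <= `|a| * N x.
  by apply: N_lub => k; rewrite (proj2 (P_seminorm k)) ler_wpM2l.
split => [x y|a x].
  apply: N_lub => k; apply: le_trans (proj1 (P_seminorm k) x y) _.
  by apply: lerD; exact: N_ge.
apply/eqP; rewrite eq_le half/=; have [->|a0] := eqVneq a 0.
  by rewrite normr0 mul0r; exact: le_trans (P_ge0 0 _) (N_ge _ _).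
have := half a^-1 (a *: x).
by rewrite scalerA mulVf// scale1r normfV ler_pdivlMl ?normr_gt0.
Qed.

Let NS := flattened_seminorm.

Let P_rotund k (eta : R) : 0 < eta -> exists d : R, 0 < d /\
  forall x y, P k x <= 1 -> P k y <= 1 ->
  2 * P k x ^+ 2 + 2 * P k y ^+ 2 - P k (x + y) ^+ 2 <= d -> N (x - y) <= eta.
Proof.
move=> eta0.
have NA z : A z <= eta / 2 -> N z <= eta.
  move=> h; apply: le_trans (flattened_norm_le z) _.
  have := ler_wpM2r (A0 z) e1; lra.
have eta2 : 0 < eta / 2 by rewrite divr_gt0.
case: k => [|n] /=.
  have [d d0 dP] := AQ eta2; exists d; split => // x y x1 y1 h.
  by apply: NA; exact: dP.
have sd : 0 < Num.sqrt (del n) by rewrite sqrtr_gt0.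
have AC z : flat n z <= 1 -> A z <= (Num.sqrt (del n))^-1.
  move=> z1; rewrite -[leRHS]mulr1 ler_pdivlMl//; apply: le_trans z1.
  by rewrite /flat addrC sqrt_sum_sqr_ge// mulr_ge0// ltW.
have sdI : 0 < (Num.sqrt (del n))^-1 by rewrite invr_gt0.
have [d d0 dP] := quad_rotund_scale AS AQ sdI eta2.
exists (del n * d); split; first by rewrite mulr_gt0.
move=> x y x1 y1 h; apply: NA; apply: dP; try exact: AC.
by rewrite -(ler_pM2l (del0 n)); apply: le_trans h; case: (flat_gap n x y).
Qed.

Let active x (t : R) : t < N x -> exists k, t < P k x.
Proof.
move=> tN; apply: contrapT => /forallNP nk; move: tN; apply/negP.
by rewrite -leNgt; apply: N_lub => k; rewrite leNgt; apply/negP.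
Qed.

Let gap_of_active k x y (t : R) : t <= 1 -> N x <= 1 -> N y <= 1 ->
  1 - t < P k (2^-1 *: (x + y)) ->
  2 * P k x ^+ 2 + 2 * P k y ^+ 2 - P k (x + y) ^+ 2 <= 8 * t.
Proof.
move=> t1 x1 y1 h; apply: midpoint_gap => //; last exact: ltW.
- exact: le_trans (N_ge _ _) x1.
- exact: le_trans (N_ge _ _) y1.
Qed.

(** At x all [flat n] but at most one are at most kappa * A x, with kappa < 1.
    They stay below 1 - theta / 8 at every midpoint of x and a point of the ball,
    so N is almost attained at the midpoint by A or by the remaining one. *)
Let lur_modulus x (eta : R) : N x = 1 -> 0 < eta -> exists2 t, 0 < t &
  forall y, N y <= 1 -> 1 - t < N (2^-1 *: (x + y)) -> N (x - y) <= eta.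
Proof.
move=> Nx eta0; have /andP[th0 th1] := theta_bd.
have [n0 n0P] : exists n0, forall n, n != n0 -> `|f n x| <= (1 - theta) * A x.
  have [[n0 h]|no] := pselect (exists n, (1 - theta) * A x < `|f n x|).
    by exists n0 => n nn0; apply: slices h; rewrite eq_sym.
  by exists 0%N => n _; rewrite leNgt; apply/negP => h; apply: no; exists n.
have [d [d0 dP]] := @P_rotund 0 _ eta0.
have [d' [d'0 d'P]] := @P_rotund n0.+1 _ eta0.
pose t := Num.min (theta / 8) (Num.min (d / 8) (d' / 8)).
have t0 : 0 < t by rewrite !lt_min !divr_gt0.
have t1 : t <= theta / 8 by rewrite ge_min lexx.
have t2 : t <= d / 8 by rewrite !ge_min lexx orbT.
have t3 : t <= d' / 8 by rewrite !ge_min lexx !orbT.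
exists t => // y Ny mid; have [k Pk] := active mid.
have tle1 : t <= 1 by lra.
have Px j : P j x <= 1 by rewrite -Nx N_ge.
have Py j : P j y <= 1 by exact: le_trans (N_ge _ _) Ny.
have gap := gap_of_active tle1 _ Ny Pk; rewrite Nx lexx in gap.
have {}gap := gap isT.
case: k => [|n] in Pk gap; first by apply: dP => //; lra.
have [nn0|nn0] := eqVneq n n0.
  by rewrite nn0 in gap; apply: d'P => //; lra.
exfalso; move: Pk; apply/negP; rewrite -leNgt.
have [pD pZ] := P_seminorm n.+1.
rewrite pZ gtr0_norm ?invr_gt0//.
have := pD x y; have := flat_inactive (n0P _ nn0); have := Py n.+1.
have Ax : A x <= 1 by rewrite -Nx flattened_norm_ge.
have : kappa * A x <= kappa by rewrite ler_piMr// /kappa; lra.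
by rewrite /kappa /=; lra.
Qed.

(** Suppose that N is almost attained at the midpoint by [flat n].  For the
    finitely many small n, the rotundity of [flat n] makes x - y small.  For large
    n the first term of [flat n] makes x - y almost proportional to u n.+1, where
    g is small. *)
Let wur_modulus (g : X -> R^o) (eta : R) : dual g -> 0 < eta ->
  exists2 t, 0 < t & forall x y, N x <= 1 -> N y <= 1 ->
    1 - t < N (2^-1 *: (x + y)) -> `|g (x - y)| <= eta.
Proof.
move=> dg eta0; have [a [b [a0 b0 ab]]] := AE.
have gl : is_linear (g : X -> R) by case: dg.
pose G := dual_norm g / a + 1.
have G0 : 0 < G by rewrite ltr_wpDl// divr_ge0 ?dual_norm_ge0// ltW.
have gG z : `|g z| <= G * A z.
  apply: le_trans (dual_normP dg z) _.
  apply: (@le_trans _ _ (dual_norm g / a * A z)).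
    rewrite -mulrA ler_wpM2l ?dual_norm_ge0// ler_pdivlMl//.
    by case: (ab z).
  by rewrite ler_wpM2r// lerDl.
have [n0 n0P] : exists n0, forall n, (n0 <= n)%N -> `|g (u n)| <= eta / 4.
  have gu := u_null dg; have eta4 : 0 < eta / 4 by rewrite divr_gt0.
  have /cvgrPdist_le/(_ _ eta4)[n0 _ h] := gu.
  by exists n0 => n nn0; have := h n nn0; rewrite /= sub0r normrN.
have etaG : 0 < eta / G by rewrite divr_gt0.
have [d dP] := choice (fun k => P_rotund k etaG).
have [t1 t10 t1P] := finite_min n0.+1 (fun k => proj1 (dP k)).
have r2 : 0 < 2 :> R by [].
have etaG2 : 0 < eta / (2 * G) by rewrite divr_gt0// mulr_gt0.
have [d' d'0 d'P] := quad_rotund_scale AS AQ r2 etaG2.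
pose t := Num.min 1 (Num.min (t1 / 8) (tau / 5 * d' / 8)).
have t0 : 0 < t by rewrite !lt_min ltr01 divr_gt0//= divr_gt0// mulr_gt0// divr_gt0.
have tle1 : t <= 1 by rewrite ge_min lexx.
have t2 : t <= t1 / 8 by rewrite !ge_min lexx orbT.
have t3 : t <= tau / 5 * d' / 8 by rewrite !ge_min lexx !orbT.
exists t => // x y Nx Ny mid; have [k Pk] := active mid.
have gap := gap_of_active tle1 Nx Ny Pk.
have Px := le_trans (N_ge k x) Nx; have Py := le_trans (N_ge k y) Ny.
have [kn|nk] := leqP k n0.
  apply: le_trans (gG _) _; rewrite mulrC -ler_pdivlMr//.
  apply: le_trans (flattened_norm_ge _) _; have [_] := dP k; apply => //.
  by have := t1P k kn; lra.
case: k => [//|n] /= in Pk gap Px Py nk.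
have Ax := le_trans (flattened_norm_ge x) Nx.
have Ay := le_trans (flattened_norm_ge y) Ny.
have hT : A (T n (x - y)) <= eta / (2 * G).
  have -> : T n (x - y) = T n x - T n y.
    by rewrite -scaleN1r TD TZ scaleN1r.
  apply: d'P.
  - by have := AT_le n x; lra.
  - by have := AT_le n y; lra.
  rewrite -TD -(@ler_pM2l _ (tau / 5)) ?divr_gt0//.
  have [h _] := flat_gap n x y; apply: le_trans h _; lra.
have -> : x - y = T n (x - y) + f n.+1 (x - y) *: u n.+1 by rewrite subrK.
rewrite (is_linearD gl); apply: le_trans (ler_normD _ _) _.
have g1 : `|g (T n (x - y)) : R| <= eta / 2.
  apply: le_trans (gG _) _; rewrite mulrC -ler_pdivlMr//.
  by rewrite -mulrA -invfM in hT *.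
have g2 : `|g (f n.+1 (x - y) *: u n.+1) : R| <= 2 * (eta / 4).
  rewrite (is_linearZ gl) normrM; apply: ler_pM => //; last exact: n0P (ltnW nk).
  apply: le_trans (fA _ _) _; apply: le_trans (seminormB AS _ _) _; lra.
lra.
Qed.

Lemma flattened_equivalent : equivalent_norm N.
Proof.
have [a [b [a0 b0 ab]]] := AE; have [ND NZ] := NS; split => //.
  move=> x Nx; apply/eqP; rewrite -normr_le0 -(ler_pM2l a0) mulr0 -Nx.
  by apply: le_trans (flattened_norm_ge x); case: (ab x).
exists a, ((1 + e) * b); split => //; first by rewrite mulr_gt0// addr_gt0.
move=> x; have [h1 h2] := ab x; split.
  exact: le_trans h1 (flattened_norm_ge x).
apply: le_trans (flattened_norm_le x) _.
by rewrite -mulrA ler_pM2l// addr_gt0.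
Qed.

Lemma flattened_lur : locally_uniformly_rotund N.
Proof.
move=> x Nx y y1 mid; apply/cvgrPdist_le => eta eta0.
have [t t0 tP] := lur_modulus Nx eta0.
have /cvgrPdist_lt/(_ t t0) := mid; apply: filterS => n h.
rewrite sub0r normrN ger0_norm ?seminorm_ge0//; apply: tP => //.
by move: h; rewrite ltr_distlC => /andP[].
Qed.

Lemma flattened_wur : weakly_uniformly_rotund N.
Proof.
move=> x y x1 y1 mid; apply: weak_cvg0 => g dg.
have gl : is_linear (g : X -> R) by case: dg.
apply/cvgrPdist_le => eta eta0.
have [t t0 tP] := wur_modulus dg eta0.
have /cvgrPdist_lt/(_ t t0) := mid; apply: filterS => n h.
rewrite sub0r normrN /= -opprB (is_linearN gl) normrN; apply: tP => //.
by move: h; rewrite ltr_distlC => /andP[].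
Qed.

(** The points u n + tau u n.+1 and u n - tau u n.+1 lie in the n-th slice, and
    there [flat n] hardly distinguishes them from u n.  Normalized by r n, they
    have norm at most 1 and a midpoint whose norm tends to 1. *)
Lemma flattened_not_ur : ~ uniformly_rotund N.
Proof.
move=> ur; have /andP[th0 th1] := theta_bd.
have tp := tau0; have tt := tau_theta; have te := tau_e; have ee1 := e1.
pose r n : R := Num.sqrt (flat n (u n) ^+ 2 + 4 * del n).
have Tu n : T n (u n.+1) = 0 by rewrite /T fu scale1r subrr.
have flat_u n : 1 + tau <= flat n (u n).
  apply: le_of_sqr => //; first by lra.
  rewrite flat2 fu normr1 expr1n mulr1 addrAC lerDr addr_ge0//.
    by rewrite mulr_ge0 ?sqr_ge0// ltW// divr_gt0.
  by rewrite mulr_ge0 ?sqr_ge0// ltW.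
have r2 n : r n ^+ 2 = flat n (u n) ^+ 2 + 4 * del n.
  by rewrite sqr_sqrtr// addr_ge0 ?sqr_ge0// mulr_ge0// ltW.
have rge n : flat n (u n) <= r n.
  apply: le_of_sqr => //; first exact: sqrtr_ge0.
  by rewrite r2 lerDl mulr_ge0// ltW.
have r1 n : 1 + tau <= r n by exact: le_trans (flat_u n) (rge n).
have r0 n : 0 < r n by have := r1 n; lra.
have r3 n : r n <= 3.
  apply: le_of_sqr => //; first exact: ltW.
  rewrite r2; have := flat_le n (u n); rewrite u1 mulr1 => h.
  have : flat n (u n) ^+ 2 <= (1 + e) ^+ 2.
    by rewrite lerXn2r ?nnegrE//; have := e0; lra.
  have : (1 + e) ^+ 2 <= 2 ^+ 2 by rewrite lerXn2r ?nnegrE//; have := e0; lra.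
  by have := del_le n; lra.
(* Of all the seminorms only flat n can exceed 1 + tau at z, and it differs
     from its value at u n only through its last term. *)
have near_u n (s : R) : `|s| = tau -> N (u n + s *: u n.+1) <= r n.
  move=> sn; set z := u n + s *: u n.+1.
  have Az : A z <= 1 + tau.
    by apply: le_trans (AD _ _) _; rewrite AZ !u1 sn mulr1.
  have fz : f n z = 1.
    by rewrite (is_linearD (fl n)) (is_linearZ (fl n)) fu fu0// mulr0 addr0.
  apply: N_lub => -[|m] /=; first exact: le_trans (r1 n).
  have [->|mn] := eqVneq m n.
    apply: le_of_sqr => //; first exact: ltW.
    rewrite r2 !flat2 fz fu /z TD TZ Tu scaler0 addr0 -/z u1.
    have : A z ^+ 2 <= 2 ^+ 2 by rewrite lerXn2r ?nnegrE//; lra.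
    have dn := del0 n; rewrite -(ler_pM2l dn) expr1n; lra.
  have : `|f m z| <= (1 - theta) * A z.
    apply: (@slices n); first by rewrite eq_sym.
    rewrite fz normr1; apply: (@le_lt_trans _ _ ((1 - theta) * (1 + tau))).
      by rewrite ler_wpM2l//; lra.
    have : 0 < theta * tau by rewrite mulr_gt0.
    lra.
  move=> /flat_inactive/le_trans; apply; apply: le_trans (r1 n).
  apply: le_trans Az; rewrite ler_piMl// /kappa; lra.
pose x n := (r n)^-1 *: (u n + tau *: u n.+1).
pose y n := (r n)^-1 *: (u n + (- tau) *: u n.+1).
have NZ := proj2 NS.
have rI n : 0 < (r n)^-1 by rewrite invr_gt0.
have x1 n : N (x n) <= 1.
  by rewrite NZ gtr0_norm// ler_pdivrMl// mulr1 near_u// gtr0_norm.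
have y1 n : N (y n) <= 1.
  by rewrite NZ gtr0_norm// ler_pdivrMl// mulr1 near_u// normrN gtr0_norm.
have mid n : 2^-1 *: (x n + y n) = (r n)^-1 *: u n.
  rewrite /x /y -scalerDr scaleNr addrACA subrr addr0 -mulr2n -(scaler_nat 2 (u n)).
  by rewrite !scalerA; congr (_ *: _); field; rewrite gt_eqF.
have dif n : y n - x n = (- (2 * tau / r n)) *: u n.+1.
  rewrite /x /y -scalerBr opprD addrACA subrr add0r -scalerBl scalerA.
  by congr (_ *: _); ring.
have := ur x y x1 y1.
have Nmid n : 1 - 4 * del n <= N (2^-1 *: (x n + y n)) <= 1.
  rewrite mid NZ gtr0_norm//; apply/andP; split; last first.
    have NS' := proj1 NS; have := NS' (x n) (y n); rewrite -(scalerKV (_ : 2 != 0 :> R) (x n + y n)) ?pnatr_eq0//.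
    by rewrite mid NZ NZ gtr0_norm// gtr0_norm//; have := x1 n; have := y1 n; lra.
  have h1 : flat n (u n) / r n <= (r n)^-1 * N (u n).
    by rewrite mulrC ler_pM2l//; exact: (N_ge n.+1).
  apply: le_trans h1.
  have q0 : 0 <= flat n (u n) / r n by rewrite divr_ge0// ltW.
  have q1 : flat n (u n) / r n <= 1 by rewrite ler_pdivrMr// mul1r.
  have q2 : (flat n (u n) / r n) ^+ 2 = 1 - 4 * del n / r n ^+ 2.
    rewrite expr_div_n (_ : flat n (u n) ^+ 2 = r n ^+ 2 - 4 * del n); last first.
      by rewrite r2; ring.
    by field; rewrite gt_eqF.
  have : 4 * del n / r n ^+ 2 <= 4 * del n.
    rewrite ler_pdivrMr ?exprn_gt0// ler_peMr//; first by rewrite mulr_ge0// ltW.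
    by rewrite exprn_ege1//; have := r1 n; lra.
  by nra.
have dto0 : (fun n => 1 - 4 * del n) @ \oo --> (1 : R).
  rewrite -[X in _ --> X]subr0; apply: cvgB; first exact: cvg_cst.
  rewrite -(mulr0 4); apply: cvgM; first exact: cvg_cst.
  rewrite -(mulr0 (tau / 5)); apply: cvgM; first exact: cvg_cst.
  exact: cvg_harmonic.
have midto1 : (fun n => N (2^-1 *: (x n + y n))) @ \oo --> (1 : R).
  apply: (@squeeze_cvgr _ _ _ _ (fun n => 1 - 4 * del n) (fun=> 1)) => //.
    by apply: filterE => n; exact: Nmid.
  exact: cvg_cst.
move=> /(_ midto1)/cvgrPdist_lt/(_ (2 * tau / 3)).
rewrite divr_gt0 ?mulr_gt0// => /(_ isT)[n _ /(_ n (leqnn n))] /=.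
rewrite sub0r normrN ger0_norm ?seminorm_ge0// dif NZ normrN.
rewrite gtr0_norm ?divr_gt0 ?mulr_gt0// ltNge => /negP; apply.
apply: (@le_trans _ _ (2 * tau / r n)).
  by rewrite ler_pM2l ?mulr_gt0// lef_pV2 ?posrE.
rewrite ler_peMr//; first by rewrite ltW// divr_gt0// mulr_gt0.
by rewrite -(u1 n.+1) flattened_norm_ge.
Qed.

End Construction.

(** Every space is finitely representable in itself. *)
Lemma superreflexive_reflexive (R : realType) (X : completeNormedModType R) :
  superreflexive X -> reflexive_space X.
Proof.
apply => F _ eps eps0; exists id; split => // y _.
by split => //; rewrite ler_peMl// lerDl ltW.
Qed.

(** A lies between M / (1 + e)^2 and M / (1 + e), which leaves room for a norm
    between A and (1 + e) * A. *)
Lemma LUR_WUR_not_UR_dense (R : realType) (X : completeNormedModType R) :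
  infinite_dimensional X -> superreflexive X ->
  norm_dense (@LUR_WUR_not_UR R X).
Proof.
move=> infX srX M MN eps eps0.
pose e := Num.min eps 1 / 3.
have e0 : 0 < e by rewrite divr_gt0// lt_min eps0 ltr01.
have e_eps : e <= eps / 3 by rewrite ler_pM2r// ge_min lexx.
have e_1 : e <= 1 / 3 by rewrite ler_pM2r// ge_min lexx orbT.
have e1 : e <= 1 by lra.
have [A [AS AQ AE AM]] := rotund_approx srX MN e0.
have [u [u1 u0 unull]] :=
  weakly_null_sequence AS AE infX (superreflexive_reflexive srX).
pose f n := support AS (u n).
have fl n : is_linear (f n) by exact: support_linear.
have fA n x : `|f n x| <= A x by exact: support_le.
have fu n : f n (u n) = 1 by rewrite /f support_self.
have [theta theta_bd slices] := disjoint_slices AS AQ fl fA u1 fu u0.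
have th0 : 0 < theta by case/andP: theta_bd.
pose tau := Num.min (e / 2) (theta / 4).
have tau0 : 0 < tau by rewrite /tau lt_min; apply/andP; split; rewrite divr_gt0.
have tau_e : tau <= e / 2 by rewrite ge_min lexx.
have tau_theta : tau <= theta / 4 by rewrite ge_min lexx orbT.
have NA := flattened_norm_le AS e0 fA u1 tau0 tau_e.
have AN := flattened_norm_ge AS e0 fA u1 tau0 tau_e.
exists (flattened_norm A u f tau).
  split.
  - exact: (@flattened_equivalent _ _ _ _ _ _ e).
  - exact: (@flattened_lur _ _ _ _ _ _ e theta).
  - exact: (@flattened_wur _ _ _ _ _ _ e).
  - exact: (@flattened_not_ur _ _ _ _ _ _ e theta).
move=> x; have [h1 h2] := AM x; split; first exact: le_trans (NA x) h1.
apply: le_trans h2 _.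
have N0 : 0 <= flattened_norm A u f tau x.
  by apply: le_trans (AN x); exact: seminorm_ge0.
apply: (@le_trans _ _ ((1 + e) ^+ 2 * flattened_norm A u f tau x)).
  by rewrite ler_wpM2l ?sqr_ge0.
by apply: ler_wpM2r => //; nra.
Qed.

Theorem theorem3 (R : realType) (X : completeNormedModType R)
  (hinf : infinite_dimensional X) (hsr : superreflexive X) :
  (exists N : X -> R, LUR_WUR_not_UR N) /\
  norm_dense (@LUR_WUR_not_UR R X).
Proof.
have dense := LUR_WUR_not_UR_dense hinf hsr; split => //.
have norm_equivalent : equivalent_norm (fun x : X => `|x|).
  split; [exact: ler_normD|exact: normrZ|by move=> x /normr0_eq0|].
  by exists 1, 1; split=> // x; rewrite mul1r.
by have [N SN _] := dense _ norm_equivalent 1 ltr01; exists N.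
Qed.
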